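(* Let $n\ge 1$, let $m_1,\dots,m_n$ be nonnegative integers, and let $a,b,c,d,e,f,z_1,\dots,z_n$ be nonzero complex numbers with $a^3q^2=bcdef$. Put $\lambda=a^2q/bcf$. Then $$\sum_{y_1=0}^{m_1}\cdots\sum_{y_n=0}^{m_n} \Bigg(\frac{\Delta(zq^y)}{\Delta(z)}\prod_{k=1}^n\frac{\theta(az_kq^{y_k+|y|})} {\theta(az_k)}\prod_{1\leq j<k\leq n}\frac{1}{(z_jz_k)_{y_j+y_k}} \prod_{j,k=1}^n\frac{(q^{-m_j}z_k/z_j,q^{m_j}z_jz_k)_{y_k}}{(qz_k/z_j)_{y_k}}$$ $$\times\prod_{j=1}^n\frac{(az_j)_{|y|}(aq/z_j)_{|y|-y_j}} {(aq^{1+m_j}z_j,aq^{1-m_j}/z_j)_{|y|}}\cdot\frac{(b,c,d,e)_{|y|}}{(aq/f)_{|y|}} \prod_{k=1}^n\frac{(fz_k)_{y_k}}{(aqz_k/b,aqz_k/c,aqz_k/d,aqz_k/e)_{y_k}} \,q^{|y|}\Bigg)$$ $$=\prod_{k=1}^n\frac{(aqz_k,z_k/\lambda,\lambda qz_k/d,\lambda qz_k/e)_{m_k}} {(\lambda qz_k,z_k/a,aqz_k/d,aqz_k/e)_{m_k}}\sum_{y_1=0}^{m_1}\cdots\sum_{y_n=0}^{m_n} \Bigg(\frac{\Delta(zq^y)}{\Delta(z)}\prod_{k=1}^n\frac{\theta(\lambda z_kq^{y_k+|y|})} {\theta(\lambda z_k)}$$ $$\times\prod_{1\leq j<k\leq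 n}\frac{1}{(z_jz_k)_{y_j+y_k}} \prod_{j,k=1}^n\frac{(q^{-m_j}z_k/z_j,q^{m_j}z_jz_k)_{y_k}}{(qz_k/z_j)_{y_k}} \prod_{j=1}^n\frac{(\lambda z_j)_{|y|} (\lambda q/z_j)_{|y|-y_j}} {(\lambda q^{1+m_j}z_j,\lambda q^{1-m_j}/z_j)_{|y|}}$$ $$\times\frac{(\lambda b/a,\lambda c/a,d,e)_{|y|}}{(aq/f)_{|y|}} \prod_{k=1}^n\frac{(\lambda fz_k/a)_{y_k}}{(aqz_k/b,aqz_k/c,\lambda qz_k/d, \lambda qz_k/e)_{y_k}}\,q^{|y|}\Bigg).$$
   Context: Fix $p\in\mathbb C$ with $|p|<1$ and $q\in\mathbb C\setminus\{0\}$. For $x\neq 0$ put $\theta(x)=\prod_{j=0}^\infty(1-p^jx)(1-p^{j+1}/x)$ (so $\theta(x)=1-x$ when $p=0$). The elliptic Pochhammer symbol is $(a)_k=\theta(a)\theta(aq)\cdots\theta(aq^{k-1})$ for integers $k\ge 0$, with $(a)_0=1$, and $(a_1,\dots,a_r)_k=(a_1)_k\cdots(a_r)_k$. Everything after a slash is in the denominator, e.g. $a^2q/bcf$ means $a^2q/(bcf)$. For $z=(z_1,\dots,z_n)$, the elliptic Vandermonde determinant is $\Delta(z)=\prod_{1\le j<k\le n}z_j\,\theta(z_k/z_j)$, and $zq^y=(z_1q^{y_1},\dots,z_nq^{y_n})$, $|y|=y_1+\dots+y_n$. Standing assumption: all expressions are well-defined, i.e. the parameters are such that no denominator occurring on either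 side vanishes. *)

(* Defs.v *)
From HB Require Import structures.
From mathcomp Require Import all_boot all_order all_algebra.
From mathcomp Require Import all_classical all_reals all_analysis.
From mathcomp Require Import complex.

Set Implicit Arguments.
Unset Strict Implicit.
Unset Printing Implicit Defensive.

Import Order.TTheory GRing.Theory Num.Theory numFieldNormedType.Exports.
Local Open Scope classical_set_scope.
Local Open Scope ring_scope.

(* The field of complex numbers is R[i], for R : realType. The cast to R[i]^o
   only selects the topology given by the modulus. The limit exists whenever
   |p| < 1 and x != 0. *)
Definition theta (R : realType) (p x : R[i]) : R[i] :=
  limn (fun N : nat =>
    (\prod_(0 <= j < N) ((1 - p ^+ j * x) * (1 - p ^+ j.+1 / x))) : R[i]^o).

(* (a)_k *)
Definition ellpoch (R : realType) (p q a : R[i]) (k : nat) : R[i] :=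
  \prod_(0 <= i < k) theta p (a * q ^+ i).

(* (a_1, ..., a_r)_k for s = [:: a_1; ...; a_r] *)
Definition ellpochs (R : realType) (p q : R[i]) (s : seq R[i]) (k : nat) :
  R[i] := \prod_(a <- s) ellpoch p q a k.

Definition ellDelta (R : realType) (p : R[i]) (n : nat) (z : 'I_n -> R[i]) :
  R[i] := \prod_(j < n) \prod_(k < n | (j < k)%N) (z j * theta p (z k / z j)).

(* The multi-indices y = (y_1, ..., y_n) with 0 <= y_j <= m_j. *)
Definition box (n : nat) (m : 'I_n -> nat) : finType :=
  {dffun forall j : 'I_n, 'I_(m j).+1}.

(* |y| *)
Definition norm1 (n : nat) (m : 'I_n -> nat) (y : box m) : nat :=
  (\sum_(j < n) y j)%N.

(* The two multiple sums of the transformation have summands of the same shape.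
   They differ in the following data:
   - a : the parameter denoted a on the left and lambda on the right;
   - B : the parameters of the Pochhammer symbols ( . )_|y| in the numerator,
         and g : that of the one in the denominator;
   - f : the coefficient of z_k in the numerator symbols ( . z_k)_(y_k),
         and V : those in the denominator.
   The subtraction |y| - y_j is in nat; it is exact because y_j <= |y|. *)
Definition summand (R : realType) (p q : R[i]) (n : nat) (m : 'I_n -> nat)
    (z : 'I_n -> R[i]) (a : R[i]) (B : seq R[i]) (g f : R[i]) (V : seq R[i])
    (y : box m) : R[i] :=
  ellDelta p (fun k => z k * q ^+ y k) / ellDelta p z
  * (\prod_(k < n)
       (theta p (a * z k * q ^+ (y k + norm1 y)) / theta p (a * z k)))
  * (\prod_(j < n) \prod_(k < n | (j < k)%N)
       (1 / ellpoch p q (z j * z k) (y j + y k)))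
  * (\prod_(j < n) \prod_(k < n)
       (ellpochs p q [:: q ^- m j * z k / z j; q ^+ m j * z j * z k] (y k)
        / ellpoch p q (q * z k / z j) (y k)))
  * (\prod_(j < n)
       (ellpoch p q (a * z j) (norm1 y)
        * ellpoch p q (a * q / z j) (norm1 y - y j)
        / ellpochs p q [:: a * q ^+ (1 + m j) * z j;
                           a * q ^ (1 - (m j)%:Z) / z j] (norm1 y)))
  * (ellpochs p q B (norm1 y) / ellpoch p q g (norm1 y))
  * (\prod_(k < n)
       (ellpoch p q (f * z k) (y k)
        / ellpochs p q [seq v * z k | v <- V] (y k)))
  * q ^+ norm1 y.

(* No denominator of [summand] vanishes, for any y in the range of summation. *)
Definition summand_welldef (R : realType) (p q : R[i]) (n : nat)
    (m : 'I_n -> nat) (z : 'I_n -> R[i]) (a g : R[i]) (V : seq R[i]) : Prop :=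
  [/\ ellDelta p z != 0,
      forall k : 'I_n, theta p (a * z k) != 0
    & forall y : box m,
      [/\ forall j k : 'I_n, (j < k)%N ->
            ellpoch p q (z j * z k) (y j + y k) != 0,
          forall j k : 'I_n, ellpoch p q (q * z k / z j) (y k) != 0,
          forall j : 'I_n,
            ellpochs p q [:: a * q ^+ (1 + m j) * z j;
                             a * q ^ (1 - (m j)%:Z) / z j] (norm1 y) != 0,
          ellpoch p q g (norm1 y) != 0
        & forall k : 'I_n,
            ellpochs p q [seq v * z k | v <- V] (y k) != 0]].

(* Main.v *)
(* Consider first the case where all m_j = 1, with variables w_1, ..., w_N. With
   the product K = b c fixed, both sides are functions of b in a space of theta
   functions invariant under b |-> K / b, of dimension N + 1. They agree at b = 1,
   where the left-hand side has a single term and the right-hand side is an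
   evaluation proved by the same method, and at b = a q w_k, where the variable
   w_k drops out of the sum and induction on N applies. The interpolation argument
   needs only Weierstrass' three-term identity for theta, which follows from the
   fact that theta(x y) theta(x / y) has rank two as a function of x and y, a
   consequence of the Jacobi triple product.

   The general case is the specialization of w to the geometric progressions
   z_j, z_j q, ..., z_j q^(m_j - 1): the terms that are not indexed by initial
   segments of the progressions contain a factor theta(1) = 0.

   This proves the theorem when no theta function occurring in the argument
   vanishes. Any parameters are limits of such generic ones, obtained by scaling
   them by powers of a real number s tending to 1, and both sides are continuous. *)

Require Import Defs.
From HB Require Import structures.
From mathcomp Require Import all_classical all_reals all_analysis.
From mathcomp Require Import complex.
From mathcomp Require Import all_boot all_order all_algebra.
From mathcomp Require Import ring lra zify.
Set Implicit Arguments.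
Unset Strict Implicit.
Unset Printing Implicit Defensive.
Import Order.TTheory GRing.Theory Num.Theory numFieldNormedType.Exports.
Local Open Scope ring_scope.

(** * Interpolation by theta functions *)

(** [K = b c] is kept fixed because [la = a^2 q / (K f)] and [d e = la a q] then do not move with
    [b], and [b |-> K / b] merely exchanges [b] and [c]. The nodes are the zeros that the summand
    offers: at [b = 1] the symbol [(b)_|y|] kills all terms but the empty one, and at [b = a q w_k]
    the cleared denominator [theta(a q w_k / b)] kills the terms without [k]. On the right [b]
    becomes [la b / a], which sends [a q w_k] to [la q w_k]; hence one node removes the same
    variable from both sides. At [b = 1] the right-hand parameters satisfy
    [(la c / a)(la f / a) = la q], so a pair of factors becomes constant and a shorter sum remains.
    The interpolation forces the detour through generic parameters: it divides by theta values that
    keep the nodes apart, and the well-definedness of the two sides says nothing about these. *)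

Section ThetaAlgebra.
Variables (F : fieldType) (th : F -> F).

(* [even_theta K alpha] is invariant under x |-> K / x. *)
Definition even_theta (K alpha x : F) := th (alpha * x) * th (alpha * (K / x)).

(** Lagrange interpolation of [even_theta K alpha] at [x0] and [x1]: each term on the right vanishes
    at one of the nodes. The factor [x0 / x1] comes from exchanging the nodes in
    [even_theta K x1^-1 x0], and the last hypothesis keeps them apart modulo [x |-> K / x]. This
    form involves no square root of [K]. *)
Definition weierstrass_identity := forall K alpha x x0 x1 : F,
  K != 0 -> alpha != 0 -> x != 0 -> x0 != 0 -> x1 != 0 ->
  even_theta K x1^-1 x0 != 0 ->
  even_theta K alpha x * even_theta K x1^-1 x0 =
  even_theta K alpha x0 * even_theta K x1^-1 x
  - x0 / x1 * even_theta K alpha x1 * even_theta K x0^-1 x.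

Hypothesis th1 : th 1 = 0.
Hypothesis thV : forall x : F, x != 0 -> th x^-1 = - th x / x.
Hypothesis th3 : weierstrass_identity.

Lemma thV_neq0 x : x != 0 -> th x != 0 -> th x^-1 != 0.
Proof.
by move=> x0 tx; rewrite thV // mulf_neq0 ?oppr_eq0 ?invr_eq0.
Qed.

(* The span of the products of M functions [even_theta K alpha], restricted to
   nonzero arguments; its dimension is at most M + 1. *)
Inductive theta_space (K : F) : nat -> (F -> F) -> Prop :=
| theta_space_const c f : (forall x, x != 0 -> f x = c) -> theta_space K 0 f
| theta_space_mul M alpha f g : alpha != 0 -> theta_space K M g ->
    (forall x, x != 0 -> f x = even_theta K alpha x * g x) ->
    theta_space K M.+1 f
| theta_space_lin M c f g h : theta_space K M g -> theta_space K M h ->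
    (forall x, x != 0 -> f x = c * g x + h x) -> theta_space K M f.

Lemma theta_space0 K M : exists2 f, theta_space K M f & forall x, f x = 0.
Proof.
elim: M => [|M [f Vf f0]].
  by exists (fun=> 0) => //; apply: (@theta_space_const _ 0).
exists (fun x => even_theta K 1 x * f x).
  by apply: (@theta_space_mul _ _ 1 _ f); rewrite ?oner_neq0.
by move=> x; rewrite f0 mulr0.
Qed.

Lemma theta_space_eq0 K M f : (forall x, x != 0 -> f x = 0) -> theta_space K M f.
Proof.
move=> f0; have [g Vg g0] := theta_space0 K M.
by apply: (theta_space_lin (c := 0) Vg Vg) => x /f0 ->; rewrite g0 mulr0 addr0.
Qed.

Lemma theta_space_scale K M c f g : theta_space K M g ->
  (forall x, x != 0 -> f x = c * g x) -> theta_space K M f.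
Proof.
move=> Vg fE; have [h Vh h0] := theta_space0 K M.
by apply: (theta_space_lin (c := c) Vg Vh) => x /fE ->; rewrite h0 addr0.
Qed.

Lemma theta_space_ext K M f g : theta_space K M g ->
  (forall x, x != 0 -> f x = g x) -> theta_space K M f.
Proof.
by move=> Vg fE; apply: (theta_space_scale (c := 1) Vg) => x /fE ->; rewrite mul1r.
Qed.

Lemma theta_space_sum K M (I : finType) (P : pred I) (f : I -> F -> F) :
  (forall i, P i -> theta_space K M (f i)) ->
  theta_space K M (fun x => \sum_(i | P i) f i x).
Proof.
move=> Vf.
have [s sP] : {s | s = filter P (index_enum I)} by exists (filter P (index_enum I)).
have {}Vf i : i \in s -> theta_space K M (f i).
  by rewrite sP mem_filter => /andP[/Vf].
apply: (@theta_space_ext _ _ _ (fun x => \sum_(i <- s) f i x)); last first.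
  by move=> x _; rewrite sP big_filter.
elim: s {sP} Vf => [|i s IH] Vf.
  by apply: theta_space_eq0 => x _; rewrite big_nil.
have Vs : theta_space K M (fun x => \sum_(j <- s) f j x).
  by apply: IH => j js; apply: Vf; rewrite inE js orbT.
apply: (theta_space_lin (c := 1) (Vf i _) Vs); rewrite ?mem_head //.
by move=> x _; rewrite big_cons mul1r.
Qed.

(* Euclidean division by the element of degree one vanishing at [x0]. *)
Lemma theta_space_div K x0 x1 M f : K != 0 -> x0 != 0 -> x1 != 0 ->
  even_theta K x1^-1 x0 != 0 -> theta_space K M f ->
  exists c g, (if M is M'.+1 then theta_space K M' g else forall x, g x = 0)
  /\ forall x, x != 0 ->
       f x = c * even_theta K x1^-1 x ^+ M + even_theta K x0^-1 x * g x.
Proof.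
move=> K0 nx0 nx1 d0; elim => {M f}.
- move=> c f fE; exists c, (fun=> 0); split=> // x /fE ->.
  by rewrite mulr1 mulr0 addr0.
- move=> M f2 f g al0 Vg [c [g' [Vg' gE]]] fE.
  rename f2 into al.
  (* By [th3], [A] and [B] are the coordinates of the new factor in the elements vanishing at [x1]
     and at [x0]. The [B] part of the old remainder is divisible and joins the quotient. *)
  pose A := even_theta K al x0 / even_theta K x1^-1 x0.
  pose B := - (x0 / x1 * even_theta K al x1) / even_theta K x1^-1 x0.
  have hE x : x != 0 -> even_theta K al x =
      A * even_theta K x1^-1 x + B * even_theta K x0^-1 x.
    move=> nx; apply: (mulIf d0); rewrite (th3 K0 al0 nx nx0 nx1 d0) /A /B.
    by field; rewrite d0 nx1.
  exists (A * c), (fun x => B * c * even_theta K x1^-1 x ^+ M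
                            + even_theta K al x * g' x); split; last first.
    by move=> x nx; rewrite fE // gE // mulrDr [in LHS]mulrCA {1}hE // exprS; ring.
  apply: (@theta_space_lin _ _ (B * c) _
    (fun x => even_theta K x1^-1 x ^+ M) (fun x => even_theta K al x * g' x)) => //.
    elim: M {Vg Vg' gE} => [|M IH]; first exact: (@theta_space_const _ 1).
    by apply: (theta_space_mul (invr_neq0 nx1) IH) => x _; rewrite exprS.
  case: M Vg Vg' gE => [|M] _ Vg' _.
    by apply: theta_space_eq0 => x _; rewrite Vg' mulr0.
  exact: (theta_space_mul al0 Vg').
- move=> M c f g h _ [cg [g' [Vg gE]]] _ [ch [h' [Vh hE]]] fE.
  exists (c * cg + ch), (fun x => c * g' x + h' x); split.
    case: M Vg Vh {gE hE} => [|M] Vg Vh; last exact: (theta_space_lin Vg Vh).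
    by move=> x; rewrite Vg Vh mulr0 addr0.
  by move=> x nx; rewrite fE // gE // hE //; ring.
Qed.

Lemma theta_space_0_const K M f : theta_space K M f -> M = 0%N ->
  exists c, forall x, x != 0 -> f x = c.
Proof.
elim=> {M f} [c f fE _|//|M c f g h _ IHg _ IHh fE M0]; first by exists c.
have [[cg gE] [ch hE]] := (IHg M0, IHh M0).
by exists (c * cg + ch) => x nx; rewrite fE // gE // hE.
Qed.

(** Evaluating the division by the element vanishing at [x0] at that very node forces the remainder
    to vanish; the quotient has degree one less and vanishes at the other nodes, where the divisor
    is nonzero. The pairwise condition says that no two nodes are identified by [x |-> K / x] or by
    the zeros of [th]. *)
Lemma theta_space_interpolation K M f (xs : seq F) : K != 0 ->
  theta_space K M f -> size xs = M.+1 -> all (fun x => x != 0) xs ->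
  pairwise (fun x y => even_theta K y^-1 x != 0) xs ->
  (forall x, x \in xs -> f x = 0) ->
  forall x, x != 0 -> f x = 0.
Proof.
move=> K0; elim: M f xs => [|M IH] f xs Vf.
  case: xs => // x0 [|//] _ /andP[nx0 _] _ f0.
  have [c fc] := theta_space_0_const Vf (erefl _).
  by move=> x /fc ->; rewrite -(fc x0) // f0 ?mem_head.
case: xs => [//|x0 [//|x1 xs]] [sz] /= /and3P[nx0 nx1 nxs].
move=> /andP[/andP[d01 d0s]] /andP[d1s dxs] f0.
have [c [g [Vg fE]]] := theta_space_div K0 nx0 nx1 d01 Vf.
have u0 : even_theta K x0^-1 x0 = 0 by rewrite /even_theta mulVf // th1 mul0r.
have c0 : c = 0.
  have := f0 x0; rewrite mem_head => /(_ isT).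
  rewrite fE // u0 mul0r addr0 => /eqP.
  by rewrite mulf_eq0 expf_eq0 (negPf d01) /= orbF => /eqP.
have g0 : forall x, x != 0 -> g x = 0.
  apply: (IH g (x1 :: xs)); rewrite //= ?sz ?nx1 ?nxs ?d1s ?dxs //.
  move=> x xin.
  have nx : x != 0 by move: xin; rewrite inE => /predU1P[->//|/(allP nxs)].
  have dx : even_theta K x^-1 x0 != 0.
    by move: xin; rewrite inE => /predU1P[->//|/(allP d0s)].
  have := f0 x; rewrite inE xin orbT => /(_ isT).
  rewrite fE // c0 mul0r add0r => /eqP; rewrite mulf_eq0 => /orP[|/eqP//].
  (* The pairwise condition has the roles of [x] and [x0] exchanged: [thV] reverses the first
     factor, and the second is symmetric. *)
  move: dx; rewrite /even_theta !mulf_eq0 negb_or => /andP[dl dr] /orP[|] /eqP E.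
    have := thV_neq0 _ dl; rewrite mulf_neq0 ?invr_eq0 // => /(_ isT).
    by rewrite invfM invrK mulrC E eqxx.
  move: dr; rewrite (_ : x^-1 * (K / x0) = x0^-1 * (K / x)) ?E ?eqxx //.
  by rewrite mulrCA [RHS]mulrCA (mulrC x^-1).
by move=> x nx; rewrite fE // c0 mul0r add0r g0 // mulr0.
Qed.

End ThetaAlgebra.

(** * Sums over subsets *)

Section SubsetSums.
Variables (F : fieldType) (th : F -> F).
Hypothesis th1 : th 1 = 0.
Hypothesis thV : forall x : F, x != 0 -> th x^-1 = - th x / x.
Hypothesis th3 : weierstrass_identity th.

Variables (q : F) (T : finType) (w : T -> F) (lt : rel T).
Hypothesis q0 : q != 0.
Hypothesis w0 : forall j, w j != 0.
Hypothesis lt_irr : irreflexive lt.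
Hypothesis lt_tot : forall j k, j != k -> lt j k = ~~ lt k j.

Definition poch (b : F) (r : nat) := \prod_(0 <= i < r) th (b * q ^+ i).

Lemma pochS b r : poch b r.+1 = poch b r * th (b * q ^+ r).
Proof. by rewrite /poch big_nat_recr. Qed.

Lemma pochSl b r : poch b r.+1 = th b * poch (b * q) r.
Proof.
rewrite /poch big_nat_recl // expr0 mulr1; congr (_ * _).
by apply: eq_bigr => i _; rewrite exprS mulrA.
Qed.

Lemma poch_neq0 b r : (forall i, (i < r)%N -> th (b * q ^+ i) != 0) -> poch b r != 0.
Proof.
elim: r => [|r IH] tb; first by rewrite /poch big_geq // oner_neq0.
by rewrite pochS mulf_neq0 ?tb // IH // => i ir; apply/tb/ltnW.
Qed.

(** When all m_j = 1, the factor [(q w_j w_k)_(y_j) (q w_j w_k)_(y_k) / (w_j w_k)_(y_j + y_k)] takes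
    this value whether one or both of the indices lie in I, which explains the disjunction in
    [pair_prod]. *)
Definition pair_ratio j k := th (q * (w j * w k)) / th (w j * w k).

Definition pair_prod (A I : {set T}) :=
  \prod_(j in A) \prod_(k in A)
    if lt j k && ((j \in I) || (k \in I)) then pair_ratio j k else 1.

(* [Psi] and [Phi] are, up to normalisation, multiple sums with all m_j = 1;
   I is the set of the indices j with y_j = 1. *)
Definition kern (a : F) (A I : {set T}) :=
  (-1) ^+ #|I| / q ^+ 'C(#|I|, 2)
  * (\prod_(k in I) \prod_(l in A :\: I)
       (th (q^-1 * (w k / w l)) / th (w k / w l)))
  * pair_prod A I
  * (\prod_(j in I) (th (q * (w j * w j)) / th (a * q ^+ #|I| * w j)))
  * (\prod_(j in A :\: I)
       (th (a * q ^+ #|I| / w j) / th (a * q ^+ #|I|.+1 * w j))).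

(** [numer] is [(b)_|y|] over the symbols with base [a q w_j / b], and [denom] is the symbols with
    base [f w_j] over [(a q / f)_|y|], each multiplied by the full denominator, which does not
    depend on I. After this clearing [numer] is a product of theta functions of [b]. *)
Definition numer (a b : F) (A I : {set T}) :=
  poch b #|I| * \prod_(j in A :\: I) th (a * q * w j / b).

Definition denom (a f : F) (A I : {set T}) :=
  poch (a * q ^+ #|I|.+1 / f) (#|A| - #|I|) * \prod_(j in I) th (f * w j).

Definition Psi a b c d (A : {set T}) :=
  \sum_(I : {set T} | I \subset A)
    kern a A I * numer a b A I * numer a c A I * numer a d A I.

Definition Phi a b c d e f (A : {set T}) :=
  \sum_(I : {set T} | I \subset A)
    kern a A I * numer a b A I * numer a c A I * numer a d A I
    * numer a e A I * denom a f A I.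

(** * Removing one variable from the sum *)

Section Step.
Variables (A : {set T}) (k : T).
Hypothesis kA : k \in A.

Section Term.
Variable I : {set T}.
Hypothesis IA : I \subset A :\ k.

Let kI : k \notin I.
Proof. by apply/negP => /(subsetP IA); rewrite !inE eqxx. Qed.

Let cardkI : #|k |: I| = #|I|.+1.
Proof. by rewrite cardsU1 kI. Qed.

Let setDkI : A :\: (k |: I) = (A :\ k) :\: I.
Proof. by rewrite setDDl. Qed.

Lemma pair_prod_setU1 :
  pair_prod A (k |: I) = \prod_(j in A :\ k) pair_ratio j k * pair_prod (A :\ k) I.
Proof.
have symg i j : pair_ratio i j = pair_ratio j i by rewrite /pair_ratio (mulrC (w i)).
rewrite /pair_prod (big_setD1 k kA) /= (big_setD1 k kA) /= lt_irr mul1r.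
rewrite [X in _ * X = _](eq_bigr (fun i => (if lt i k then pair_ratio i k else 1) *
   \prod_(l in A :\ k) if lt i l && ((i \in I) || (l \in I))
     then pair_ratio i l else 1)); last first.
  move=> i; rewrite !inE => /andP[ik iA].
  rewrite (big_setD1 k kA) /= !inE eqxx orbT andbT; congr (_ * _).
  apply: eq_bigr => l; rewrite !inE => /andP[lk lA].
  by rewrite (negPf ik) (negPf lk).
rewrite big_split /= mulrA -big_split /=; congr (_ * _).
apply: eq_bigr => i; rewrite !inE eqxx /= andbT => /andP[ik _].
by rewrite (lt_tot ik) symg; case: (lt k i); rewrite ?mulr1 ?mul1r // symg.
Qed.

Lemma numer_setU1 a c :
  numer a c A (k |: I) = th c * numer (a * q) (c * q) (A :\ k) I.
Proof.
rewrite /numer cardkI pochSl setDkI mulrA; congr (_ * _).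
apply: eq_bigr => j _; congr th.
by rewrite [a * q * q * _]mulrAC -mulf_div divff ?mulr1.
Qed.

Lemma denom_setU1 a f :
  denom a f A (k |: I) = th (f * w k) * denom (a * q) f (A :\ k) I.
Proof.
rewrite /denom cardkI (cardsD1 k A) kA add1n subSS big_setU1 //=.
by rewrite [q ^+ _.+2]exprS !mulrA; congr (_ * _); rewrite mulrC.
Qed.

(** The point is that the prefactor does not depend on I. The last factor of [(a q w_k)_(|I|+1)]
    cancels the denominator of [kern] at [k]. Inversion turns the cross factors between [k] and [l],
    multiplied by [th (w_l / w_k)], into [q^-1 th (q w_l / w_k)], which is what [numer] contains
    after [a] becomes [a q]. The powers of q from these inversions and from the binomial coefficient
    add up to [#|A| - 1]. *)
Lemma kern_numer_setU1 a : a != 0 ->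
  (forall l, l \in A -> l != k -> th (w k / w l) != 0) ->
  th (a * q ^+ #|I|.+1 * w k) != 0 ->
  kern a A (k |: I) * numer a (a * q * w k) A (k |: I) =
  - (q ^+ #|A|.-1)^-1 * th (q * (w k * w k)) * \prod_(j in A :\ k) pair_ratio j k
  * (kern (a * q) (A :\ k) I * numer (a * q) (a * q * w k) (A :\ k) I).
Proof.
move=> a0 twk tk.
have aqE m : a * q ^+ m.+1 = a * q * q ^+ m by rewrite exprS mulrA.
rewrite /kern /numer cardkI setDkI pair_prod_setU1 !big_setU1 //=.
rewrite !(aqE #|I|) !(aqE #|I|.+1) pochS in tk *.
rewrite [X in X * (\prod_(j in _ :\: _) th (_ / _))](_ : _ = poch (a * q * w k) #|I| *
   th (a * q * q ^+ #|I| * w k)); last by congr (_ * th _); rewrite mulrAC.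
have -> : \prod_(j in (A :\ k) :\: I) th (a * q * w j / (a * q * w k))
   = \prod_(j in (A :\ k) :\: I) th (w j / w k).
  by apply: eq_bigr => j _; congr th; rewrite -mulf_div divff ?mul1r ?mulf_neq0.
have -> : \prod_(j in (A :\ k) :\: I) th (a * q * q * w j / (a * q * w k))
   = \prod_(j in (A :\ k) :\: I) th (q * (w j / w k)).
  apply: eq_bigr => j _; congr th.
  by rewrite -(mulrA (a * q)) -mulf_div divff ?mul1r ?mulf_neq0 // mulrA.
have qE : q ^+ #|A|.-1 = q ^+ #|I| * q ^+ #|(A :\ k) :\: I|.
  by rewrite -exprD [in LHS](cardsD1 k A) kA add1n /= (cardsD (A :\ k) I) (setIidPr IA) subnKC ?subset_leq_card.
have prodE : \prod_(l in (A :\ k) :\: I)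
      (th (q^-1 * (w k / w l)) / th (w k / w l)) *
    \prod_(j in (A :\ k) :\: I) th (w j / w k) =
    (q ^+ #|(A :\ k) :\: I|)^-1 * \prod_(j in (A :\ k) :\: I) th (q * (w j / w k)).
  rewrite -big_split -exprVn -prodr_const -big_split /=.
  apply: eq_bigr => l; rewrite !inE => /and3P[_ lk lA].
  have nwkl : w k / w l != 0 by rewrite mulf_neq0 ?invr_eq0.
  have -> : w l / w k = (w k / w l)^-1 by rewrite invf_div.
  rewrite (thV nwkl).
  have -> : q^-1 * (w k / w l) = (q * (w k / w l)^-1)^-1 by rewrite invfM invrK.
  rewrite thV ?mulf_neq0 ?invr_eq0 //.
  have := twk _ lA lk; move: (th (w k / w l)) (th _) => u v u0.
  by field; rewrite u0 q0 !w0.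
rewrite binS bin1 qE exprS exprD.
move: (\prod_(i in I) \prod_(l in _) _) (pair_prod _ _)
  (\prod_(i in I) (_ / _)) (\prod_(j in _) (th (_ / _) / _)) (poch _ _) prodE tk.
move: (\prod_(i in _) pair_ratio _ _) (th (q * _)) (\prod_(l in _) (th _ / th _))
  (\prod_(j in _) th (w j / w k)) (\prod_(j in _) th (q * _)) (th _) => x1 x2 x3 x4 x5 x6.
move=> y1 y2 y3 y4 y5 prodE tk.
have q1 := expf_neq0 #|I| q0.
have q2 := expf_neq0 #|(A :\ k) :\: I| q0.
have q3 := expf_neq0 'C(#|I|, 2) q0.
move: (_ ^+ #|I|) (q ^+ _) (q ^+ _) (q ^+ _) q1 q2 q3 prodE => s z1 z2 z3 q1 q2 q3 prodE.
transitivity (- s * z2^-1 / z1 * y1 * x1 * y2 * x2 * y3 * y4 * y5 * (x3 * x4)).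
  by field; rewrite tk q1 q3.
by rewrite prodE; field; rewrite q1 q2 q3.
Qed.

End Term.

(** A set I without [k] contributes the factor [th (a q w_k / (a q w_k)) = th 1]; the remaining sets
    are [k |: I]. *)
Lemma sum_kern_step a (G : {set T} -> F) : a != 0 ->
  (forall l, l \in A -> l != k -> th (w k / w l) != 0) ->
  (forall i, th (a * q ^+ i * w k) != 0) ->
  \sum_(I : {set T} | I \subset A) kern a A I * numer a (a * q * w k) A I * G I =
  - (q ^+ #|A|.-1)^-1 * th (q * (w k * w k)) * \prod_(j in A :\ k) pair_ratio j k
  * \sum_(I : {set T} | I \subset A :\ k)
      kern (a * q) (A :\ k) I * numer (a * q) (a * q * w k) (A :\ k) I * G (k |: I).
Proof.
move=> a0 twk tk.
rewrite (bigID (fun I : {set T} => k \in I)) /= [X in _ + X]big1 ?addr0; last first.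
  move=> I /andP[IA kI]; rewrite /numer (big_setD1 k) ?inE ?kI ?kA //=.
  by rewrite divff ?mulf_neq0 // th1 mul0r !mulr0 mul0r.
rewrite (reindex_onto (fun I => k |: I) (fun I => I :\ k)) /=; last first.
  by move=> I /andP[_ kI]; rewrite setD1K.
rewrite mulr_sumr.
have dom I : ((k |: I \subset A) && (k \in k |: I) && ((k |: I) :\ k == I))
    = (I \subset A :\ k).
  rewrite subUset sub1set kA setU11 subsetD1 andbT /=; congr (_ && _).
  apply/eqP/idP => [<-|kI]; first by rewrite !inE eqxx.
  by apply/setP => j; rewrite !inE; case: eqP => // ->; rewrite (negPf kI).
apply: eq_big => [I|I]; first exact: dom.
rewrite dom => IA.
by rewrite kern_numer_setU1 ?mulrA.
Qed.

End Step.

Lemma theta_space_poch K M (u : F) r g f : K != 0 -> u != 0 ->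
  theta_space th K M g ->
  (forall x, x != 0 -> f x = poch (u * x) r * poch (u * (K / x)) r * g x) ->
  theta_space th K (r + M) f.
Proof.
move=> K0 u0 Vg; elim: r f => [|r IH] f fE.
  by apply: theta_space_ext Vg _ => x /fE ->; rewrite /poch !big_geq // !mul1r.
have uq : u * q ^+ r != 0 by rewrite mulf_neq0 ?expf_neq0.
apply: (theta_space_mul uq (IH _ (fun x _ => erefl))) => x nx.
rewrite fE // !pochS /even_theta !(mulrAC u (q ^+ r)); ring.
Qed.

Lemma theta_space_prod K M (I : finType) (B : {set I}) (u : I -> F) g f :
  K != 0 -> (forall j, u j != 0) -> theta_space th K M g ->
  (forall x, x != 0 -> f x =
     (\prod_(j in B) th (u j * x)) * (\prod_(j in B) th (u j * (K / x))) * g x) ->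
  theta_space th K (#|B| + M) f.
Proof.
move=> K0 u0 Vg; move: {2}#|B| (erefl #|B|) => n.
elim: n B f => [|n IH] B f cB fE.
  have B0 : B = set0 by apply/eqP; rewrite -cards_eq0 cB.
  rewrite cB; apply: theta_space_ext Vg _ => x /fE ->.
  by rewrite B0 !big_set0 !mul1r.
have [j jB] : exists j, j \in B by apply/set0Pn; rewrite -card_gt0 cB.
have cB' : #|B :\ j| = n by apply: succn_inj; rewrite -cB [RHS](cardsD1 j) jB.
have VB := IH (B :\ j) _ cB' (fun x _ => erefl).
rewrite cB' in VB; rewrite cB.
apply: (theta_space_mul (u0 j) VB) => x nx.
by rewrite fE // !(big_setD1 j jB) /= /even_theta; ring.
Qed.

(* For fixed [K = b c], the summand as a function of [b] lies in a space of
   dimension [#|A| + 1]. *)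
Lemma theta_space_numer K a v (A I : {set T}) c f : K != 0 -> a != 0 -> v != 0 ->
  I \subset A ->
  (forall b, b != 0 -> f b = c * (numer a (v * b) A I * numer a (v * (K / b)) A I)) ->
  theta_space th K #|A| f.
Proof.
move=> K0 a0 v0 IA fE.
have -> : #|A| = (#|I| + (#|A :\: I| + 0))%N.
  by rewrite addn0 cardsD (setIidPr IA) subnKC // subset_leq_card.
(* With this coefficient [u_j], one has [a q w_j / (v b) = u_j (K / b)] and
   [a q w_j / (v K / b) = u_j b], so the two complementary products combine to functions
   [even_theta K u_j]. *)
have u0 j : a * q * w j / (v * K) != 0 by rewrite !mulf_neq0 ?invr_eq0 ?mulf_neq0.
have V0 : theta_space th K 0 (fun=> c) by apply: (@theta_space_const _ _ _ c).
have V1 := theta_space_prod (B := A :\: I) K0 u0 V0 (fun x _ => erefl).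
apply: (theta_space_poch K0 v0 V1) => b nb.
rewrite fE // /numer.
rewrite (_ : \prod_(j in A :\: I) th (a * q * w j / (v * b)) =
  \prod_(j in A :\: I) th (a * q * w j / (v * K) * (K / b))); last first.
  by apply: eq_bigr => j _; congr th; field; rewrite v0 nb K0.
rewrite (_ : \prod_(j in A :\: I) th (a * q * w j / (v * (K / b))) =
  \prod_(j in A :\: I) th (a * q * w j / (v * K) * b)); last first.
  by apply: eq_bigr => j _; congr th; field; rewrite v0 nb K0.
ring.
Qed.

(** The first two conditions separate the node [1] from the nodes [a q w_j], the third, at [i = 1],
    separates the latter from each other's images under [x |-> K / x]. The powers of q make the
    condition stable under [(a, K) |-> (a q, K q)], the shift of the induction. *)
Definition nondegenerate a K (A : {set T}) :=
  [/\ forall j i, j \in A -> th (a * q ^+ i * w j) != 0,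
      forall j, j \in A -> th (a * q * w j / K) != 0
    & forall j k i, j \in A -> k \in A -> j != k ->
        th (a ^+ 2 * q ^+ i.+1 * (w j * w k) / K) != 0].

Lemma nondegenerateD1 a K A k : K != 0 -> nondegenerate a K A ->
  nondegenerate (a * q) (K * q) (A :\ k).
Proof.
move=> K0 [H1 H2 H3]; split.
- by move=> j i /setD1P[_ jA]; rewrite -(mulrA a) -exprS; apply: H1.
- by move=> j /setD1P[_ jA]; rewrite [a * q * q * _]mulrAC -mulf_div divff ?mulr1 // H2.
- move=> j l i /setD1P[_ jA] /setD1P[_ lA] jl.
  rewrite (_ : _ / _ = a ^+ 2 * q ^+ i.+2 * (w j * w l) / K) ?H3 //.
  by rewrite [q ^+ i.+2]exprS; field; rewrite q0 K0.
Qed.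

Definition separated (A : {set T}) := forall j k, j \in A -> k \in A -> j != k ->
  th (w j / w k) != 0 /\ th (w j * w k) != 0.

Lemma separatedD1 A k : separated A -> separated (A :\ k).
Proof. by move=> H j l /setD1P[_ jA] /setD1P[_ lA]; apply: H. Qed.

Lemma theta_space_vanish a K A f : a != 0 -> K != 0 -> separated A ->
  nondegenerate a K A -> theta_space th K #|A| f ->
  f 1 = 0 -> (forall k, k \in A -> f (a * q * w k) = 0) ->
  forall b, b != 0 -> f b = 0.
Proof.
move=> a0 K0 sA [H1 H2 H3] Vf f1 fk.
have aq0 k : a * q * w k != 0 by rewrite !mulf_neq0.
have tV x : x != 0 -> th x != 0 -> th x^-1 != 0 by apply: thV_neq0.
apply: (@theta_space_interpolation _ _ th1 thV th3 K #|A| f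
          (1 :: [seq a * q * w k | k <- enum A])) => //.
- by rewrite /= size_map -cardE.
- by rewrite /= oner_neq0; apply/allP => x /mapP[k _ ->].
- rewrite /= pairwise_map; apply/andP; split.
    apply/allP => x /mapP[k]; rewrite mem_enum => kA ->.
    rewrite /even_theta mulr1 divr1 mulf_neq0 ?tV //.
      by rewrite -(expr1 q) H1.
    by rewrite -[K]invrK -invfM tV ?H2 // mulf_neq0 ?invr_eq0.
  have := enum_uniq A; rewrite uniq_pairwise.
  apply: (sub_in_pairwise (P := mem A)); last first.
    by apply/allP => x; rewrite mem_enum.
  move=> j k jA kA /= jk; rewrite /even_theta mulf_neq0 //.
    have [+ _] := sA _ _ jA kA jk.
    by rewrite (_ : _ * _ = w j / w k) //; field; rewrite a0 q0 w0.
  have := tV _ _ (H3 j k 1 jA kA jk).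
  rewrite !mulf_neq0 ?invr_eq0 ?expf_neq0 // => /(_ isT).
  by congr (th _ != 0); field; rewrite a0 q0 K0 !w0.
- by move=> x; rewrite inE => /predU1P[->//|/mapP[k]]; rewrite mem_enum => kA ->; apply: fk.
Qed.

Lemma sum_kern_1 a (A : {set T}) (G : {set T} -> F) :
  (forall j, j \in A -> th (a * q * w j) != 0) ->
  \sum_(I : {set T} | I \subset A) kern a A I * numer a 1 A I * G I =
  \prod_(j in A) th (a / w j) * G set0.
Proof.
move=> ta; rewrite (bigD1 set0) ?sub0set //= big1 ?addr0; last first.
  move=> I /andP[_ /set0Pn[j jI]]; rewrite /numer (cardsD1 j) jI add1n pochSl th1.
  by rewrite !mul0r mulr0 mul0r.
congr (_ * _); rewrite /kern /numer cards0 /poch big_geq // !big_set0 setD0.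
rewrite bin0n expr0 divr1 !mul1r mulr1 /pair_prod big1 ?mul1r.
  rewrite -big_split /=; apply: eq_bigr => j jA.
  by rewrite expr0 expr1 mulr1 divr1 divfK // ta.
by move=> j _; rewrite big1 // => k _; rewrite !inE andbF.
Qed.

(** For fixed [K = b c] the balancing condition fixes [d = a^2 q / K], so both sides are functions
    of [b] of degree [#|A|]. At [b = 1] only the empty set survives; at [b = a q w_k] the induction
    hypothesis applies with [b] kept and [a], [c], [d] multiplied by q. *)
Theorem Psi_eval a b c d A : a != 0 -> b != 0 -> c != 0 -> d != 0 ->
  b * c * d = a ^+ 2 * q -> separated A -> nondegenerate a (b * c) A ->
  Psi a b c d A =
  \prod_(j in A) (- (a / w j) * th (w j * b / a) * th (w j * c / a) * th (w j * d / a)).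
Proof.
move: {2}#|A| (erefl #|A|) => n.
elim: n A a b c d => [|n IH] A a b c d cA a0 b0 c0 d0 bal sA nd.
  have -> : A = set0 by apply/eqP; rewrite -cards_eq0 cA.
  rewrite /Psi big_set0 (big_pred1 set0); last by move=> I; rewrite subset0.
  rewrite /kern /numer cards0 !set0D !big_set0 /pair_prod big_set0 /poch !big_geq //.
  by rewrite bin0n expr0 divr1 !mulr1.
set K := b * c in nd.
have K0 : K != 0 by rewrite mulf_neq0.
have [H1 H2 H3] := nd.
pose rhs x := \prod_(j in A)
  (- (a / w j) * th (w j * x / a) * th (w j * (K / x) / a) * th (w j * d / a)).
suff main : forall x, x != 0 -> -1 * rhs x + Psi a x (K / x) d A = 0.
  have := main b b0; rewrite mulN1r addrC => /eqP; rewrite subr_eq0 /rhs /K.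
  by rewrite (mulrC b c) mulfK // => /eqP.
apply: (theta_space_vanish a0 K0 sA nd).
- apply: theta_space_lin => //.
    rewrite -[#|A|]addn0.
    apply: (@theta_space_prod _ _ T A (fun j => w j / a) (fun _ =>
       \prod_(j in A) (- (a / w j) * th (w j * d / a)))) => //.
    + by move=> j; rewrite mulf_neq0 ?invr_eq0.
    + exact: (@theta_space_const _ _ _ _ _ (fun _ _ => erefl)).
    + move=> x nx; rewrite /rhs -!big_split /=; apply: eq_bigr => j _.
      rewrite (mulrAC _ x) (mulrAC _ (K / x)); ring.
  apply: theta_space_sum => I IA.
  apply: (@theta_space_numer K a 1 A I (kern a A I * numer a d A I)) => //.
    exact: oner_neq0.
  by move=> x nx; rewrite !mul1r; ring.
- rewrite /Psi /rhs divr1.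
  under [X in _ + X]eq_bigr do rewrite -mulrA.
  rewrite (sum_kern_1 (fun I => numer a K A I * numer a d A I)); last by move=> j jA; rewrite -(expr1 q) H1.
  rewrite /numer cards0 /poch !big_geq // !mul1r setD0 -!big_split /= mulN1r.
  apply/eqP; rewrite addrC subr_eq0; apply/eqP; apply: eq_bigr => j jA.
  have -> : a / w j = (w j / a)^-1 by rewrite invf_div.
  rewrite thV ?mulf_neq0 ?invr_eq0 // !mulr1.
  have -> : a * q * w j / K = w j * d / a.
    by apply/eqP; rewrite eqr_div //; apply/eqP; rewrite -(mulrA (w j)) (mulrC d) bal; ring.
  have -> : a * q * w j / d = w j * K / a.
    by apply/eqP; rewrite eqr_div //; apply/eqP; rewrite -(mulrA (w j)) bal; ring.
  ring.
move=> k kA; set b1 := a * q * w k; set c1 := K / b1.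
have b10 : b1 != 0 by rewrite !mulf_neq0.
have c10 : c1 != 0 by rewrite mulf_neq0 ?invr_eq0.
have bal1 : b1 * c1 * d = a ^+ 2 * q by rewrite /c1 (mulrC b1) divfK.
(* Balancing at this node; it turns [w_k c1 / a] and [w_k d / a] into the inverses of [d] and
   [c1]. *)
have cdw : c1 * d * w k = a.
  apply: (mulfI (mulf_neq0 a0 q0)); rewrite -[RHS]mulrAC -expr2 -bal1 /b1; ring.
have cardD1 : #|A :\ k| = n by apply: succn_inj; rewrite -cA [RHS](cardsD1 k) kA.
have PsiE : Psi a b1 c1 d A =
    - (q ^+ n)^-1 * th (q * (w k * w k)) * \prod_(j in A :\ k) pair_ratio j k
    * (th c1 * th d * Psi (a * q) b1 (c1 * q) (d * q) (A :\ k)).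
  rewrite /Psi; under [LHS]eq_bigr do rewrite -mulrA.
  rewrite (sum_kern_step kA (fun I => numer a c1 A I * numer a d A I)) //; last first.
  - by move=> i; apply: H1.
  - by move=> l lA lk; have [] := sA _ _ kA lA (contra_neq (fun e => esym e) lk).
  rewrite cA; congr (_ * _); rewrite mulr_sumr; apply: eq_bigr => I IA.
  by rewrite !numer_setU1 //; ring.
rewrite PsiE IH ?mulf_neq0 ?invr_eq0 //; first last.
- rewrite (_ : b1 * _ = K * q); first exact: nondegenerateD1.
  by rewrite mulrA (mulrC b1) divfK.
- exact: separatedD1.
- by transitivity (b1 * c1 * d * (q * q)); [ring | rewrite bal1; ring].
have -> : (q ^+ n)^-1 = \prod_(j in A :\ k) q^-1 by rewrite prodr_const cardD1 exprVn.
rewrite /rhs (big_setD1 k kA) /= -/b1 -/c1.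
(* For [j != k], [w_j b1 / (a q) = w_j w_k] and [w_j b1 / a = q w_j w_k], so [pair_ratio] converts
   the factor of the induction hypothesis into that of the claim. What remains is an identity in
   [w_k] alone. *)
transitivity ((\prod_(j in A :\ k)
    (- (a / w j) * th (w j * b1 / a) * th (w j * c1 / a) * th (w j * d / a)))
  * (- th (q * (w k * w k)) * th c1 * th d
     - (- (a / w k) * th (w k * b1 / a) * th (w k * c1 / a) * th (w k * d / a)))).
  rewrite mulrBr addrC; congr (_ + _); last by ring.
  transitivity (- th (q * (w k * w k)) * th c1 * th d * \prod_(j in A :\ k) (q^-1 * pair_ratio j k *
    (- (a * q / w j) * th (w j * b1 / (a * q)) * th (w j * (c1 * q) / (a * q)) *
      th (w j * (d * q) / (a * q))))).
    by rewrite [in RHS]big_split [X in _ = _ * (X * _)]big_split /=; ring.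
  rewrite [RHS]mulrC; congr (_ * _); apply: eq_bigr => j /setD1P[jk jA].
  have [_ wjk] := sA _ _ jA kA jk.
  have shift x : w j * (x * q) / (a * q) = w j * x / a.
    by rewrite mulrA -mulf_div divff ?mulr1.
  rewrite !shift /pair_ratio.
  have -> : w j * b1 / (a * q) = w j * w k by rewrite /b1; field; rewrite a0 q0.
  have -> : w j * b1 / a = q * (w j * w k) by rewrite /b1; field; rewrite a0.
  by field; rewrite w0 wjk q0.
apply/eqP; rewrite mulf_eq0; apply/orP; right; rewrite subr_eq0; apply/eqP.
have -> : w k * b1 / a = q * (w k * w k) by rewrite /b1; field; rewrite a0.
have -> : w k * c1 / a = d^-1.
  by rewrite -cdw; field; rewrite c10 d0 w0.
have -> : w k * d / a = c1^-1.
  by rewrite -cdw; field; rewrite c10 d0 w0.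
have -> : a / w k = c1 * d by rewrite -cdw mulfK.
by rewrite !thV //; field; rewrite c10 d0.
Qed.

(** The parameters [b = a q w_k] and [f] are kept while [a], [c], [d], [e] are multiplied by q. This
    preserves the balancing condition and multiplies [la] by q. *)
Lemma Phi_step a c d e f (A : {set T}) k : k \in A -> a != 0 -> separated A ->
  (forall i, th (a * q ^+ i * w k) != 0) ->
  Phi a (a * q * w k) c d e f A =
  - (q ^+ #|A|.-1)^-1 * th (q * (w k * w k)) * \prod_(j in A :\ k) pair_ratio j k
  * (th c * th d * th e * th (f * w k)
     * Phi (a * q) (a * q * w k) (c * q) (d * q) (e * q) f (A :\ k)).
Proof.
move=> kA a0 sA tk; rewrite /Phi; under [LHS]eq_bigr do rewrite -3!mulrA.
rewrite (sum_kern_step kA (fun I => numer a c A I * (numer a d A I * (numer a e A I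
   * denom a f A I)))) //; last first.
  by move=> l lA lk; have [] := sA _ _ kA lA (contra_neq (fun e => esym e) lk).
congr (_ * _); rewrite mulr_sumr; apply: eq_bigr => I IA.
by rewrite !numer_setU1 // denom_setU1 //; ring.
Qed.

Lemma pochD b m n : poch b (m + n) = poch b m * poch (b * q ^+ m) n.
Proof.
elim: n => [|n IH]; first by rewrite addn0 {3}/poch big_geq ?mulr1.
by rewrite addnS !pochS IH -!mulrA -exprD.
Qed.

(** If [e f = a q], then [(e)_|I|] is continued by the symbol of [denom] up to [(e)_|A|], and
    [th (a q w_j / e) = th (f w_j)] supplies the indices outside I. The product is thus independent
    of I. *)
Lemma numer_denom_cancel a e f (A I : {set T}) : e != 0 -> f != 0 ->
  e * f = a * q -> I \subset A ->
  numer a e A I * denom a f A I = poch e #|A| * \prod_(j in A) th (f * w j).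
Proof.
move=> e0 f0 ef IA; rewrite /numer /denom.
have -> : a * q ^+ #|I|.+1 / f = e * q ^+ #|I| by rewrite exprS mulrA -ef; field.
rewrite [in RHS](big_setID I) /= (setIidPr IA).
rewrite (eq_bigr (fun j => th (f * w j))); last first.
  by move=> j _; congr th; rewrite -ef; field.
rewrite -{2}(subnKC (subset_leq_card IA)) pochD; ring.
Qed.

Theorem Phi_transform a b c d e f la (A : {set T}) :
  a != 0 -> b != 0 -> c != 0 -> d != 0 -> e != 0 -> f != 0 -> la != 0 ->
  a ^+ 3 * q ^+ 2 = b * c * d * e * f -> la * (b * c * f) = a ^+ 2 * q ->
  separated A -> nondegenerate a (b * c) A ->
  (forall j i, j \in A -> th (a * q ^+ i / w j) != 0) ->
  (forall j i, j \in A -> th (la * q ^+ i * w j) != 0) ->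
  (forall j k i, j \in A -> k \in A -> j != k ->
     th (la * q ^+ i * (w j * w k) / a) != 0) ->
  Phi a b c d e f A =
  (a / la) ^+ #|A| * Phi la (la / a * b) (la / a * c) d e (la / a * f) A.
Proof.
move: {2}#|A| (erefl #|A|) => n.
elim: n A a b c d e la => [|n IH] A a b c d e la cA a0 b0 c0 d0 e0 f0 la0 bal laE sA nd
  Haw Hlw Hlww.
  have -> : A = set0 by apply/eqP; rewrite -cards_eq0 cA.
  rewrite /Phi !(big_pred1 set0); try by move=> I; rewrite subset0.
  rewrite /kern /numer /denom cards0 !set0D !big_set0 /pair_prod big_set0 /poch !big_geq //.
  by rewrite bin0n expr0 divr1 !mulr1.
set K := b * c in nd.
have K0 : K != 0 by rewrite mulf_neq0.
have [H1 H2 H3] := nd.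
have deE : d * e = la * a * q.
  apply: (mulfI (mulf_neq0 K0 f0)).
  transitivity (a ^+ 3 * q ^+ 2); first by rewrite bal /K; ring.
  transitivity (la * (b * c * f) * (a * q)); last by rewrite /K; ring.
  by rewrite laE; ring.
have laKf : la * K * f = a ^+ 2 * q by rewrite -laE /K; ring.
have laK : la / a * f = a * q / K.
  by apply/eqP; rewrite mulrAC eqr_div //; apply/eqP; rewrite mulrAC laKf; ring.
pose rhs x := Phi la (la / a * x) (la / a * (K / x)) d e (la / a * f) A.
suff main : forall x, x != 0 -> - (a / la) ^+ #|A| * rhs x + Phi a x (K / x) d e f A = 0.
  have := main b b0; rewrite mulNr addrC => /eqP; rewrite subr_eq0 /rhs /K.
  by rewrite (mulrC b c) mulfK // => /eqP.
apply: (theta_space_vanish a0 K0 sA nd).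
- apply: theta_space_lin => //.
    apply: theta_space_sum => I IA.
    apply: (@theta_space_numer K la (la / a) A I (kern la A I * numer la d A I
        * numer la e A I * denom la (la / a * f) A I)) => //.
      by rewrite mulf_neq0 ?invr_eq0.
    by move=> x nx; ring.
  apply: theta_space_sum => I IA.
  apply: (@theta_space_numer K a 1 A I (kern a A I * numer a d A I * numer a e A I
     * denom a f A I)) => //.
    exact: oner_neq0.
  by move=> x nx; rewrite !mul1r; ring.
- rewrite /rhs divr1 mulr1 mulNr addrC; apply/eqP; rewrite subr_eq0; apply/eqP.
  have cE : la / a * K = a * q / f.
    by apply/eqP; rewrite mulrAC eqr_div //; apply/eqP; rewrite laKf; ring.
  (* The third parameter and the last one multiply to [la q], so their factors leave the sum. The
     other three satisfy [d e (la / a) = la^2 q], the condition of [Psi_eval]. *)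
  have -> : Phi la (la / a) (la / a * K) d e (la / a * f) A =
     poch (a * q / f) #|A| * (\prod_(j in A) th (a * q / K * w j)) * Psi la d e (la / a) A.
    rewrite /Phi /Psi mulr_sumr; apply: eq_bigr => I IA.
    have efE : la / a * K * (la / a * f) = la * q.
      rewrite cE laK; transitivity (a ^+ 2 * q * q / (K * f)); first by field; rewrite K0 f0.
      by rewrite -laKf; field; rewrite K0 f0.
    have cut := numer_denom_cancel _ _ efE IA.
    rewrite -cE -laK -cut ?mulf_neq0 ?invr_eq0 //; ring.
  rewrite (Psi_eval la0 d0 e0 _ _ sA) ?mulf_neq0 ?invr_eq0 //; first last.
  + rewrite deE; split=> [j i jA|j jA|j k i jA kA jk].
    * exact: Hlw.
    (* For this application the role of [K] is played by [d e = la a q], so the condition concerns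
       [w_j / a]. *)
    * rewrite (_ : _ / _ = (a * q ^+ 0 / w j)^-1) ?(thV_neq0 thV) ?Haw ?mulf_neq0 ?invr_eq0 ?expf_neq0 //.
      by rewrite expr0; field; rewrite a0 la0 q0 w0.
    * rewrite (_ : _ / _ = la * q ^+ i * (w j * w k) / a) ?Hlww //.
      by rewrite [q ^+ i.+1]exprS; field; rewrite a0 la0 q0.
  + by rewrite deE; field.
  rewrite /Phi; under [LHS]eq_bigr do rewrite -3!mulrA.
  rewrite (sum_kern_1 (fun I => numer a K A I * (numer a d A I * (numer a e A I
     * denom a f A I)))); last by move=> j jA; rewrite -(expr1 q) H1.
  rewrite /numer /denom cards0 {1 2 3}/poch !big_geq // !mul1r setD0 big_set0 subn0 mulr1.
  rewrite expr1 -prodr_const.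
  transitivity (poch (a * q / f) #|A| * \prod_(j in A)
     (th (a / w j) * th (a * q * w j / K) * th (a * q * w j / d) * th (a * q * w j / e))).
    by rewrite !big_split /=; ring.
  rewrite -[X in _ = _ * X]mulrA [RHS]mulrCA; congr (_ * _).
  rewrite -!big_split /=; apply: eq_bigr => j jA.
  have -> : a / w j = (w j / a)^-1 by rewrite invf_div.
  have -> : w j * (la / a) / la = w j / a by field; rewrite a0 la0.
  have -> : w j * d / la = a * q * w j / e.
    by apply/eqP; rewrite eqr_div //; apply/eqP; rewrite -mulrA deE; ring.
  have -> : w j * e / la = a * q * w j / d.
    by apply/eqP; rewrite eqr_div //; apply/eqP; rewrite -mulrA (mulrC e) deE; ring.
  have -> : a * q / K * w j = a * q * w j / K by rewrite mulrAC.
  rewrite thV ?mulf_neq0 ?invr_eq0 //; field.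
  by rewrite la0 w0 a0.
move=> k kA; rewrite /rhs; set b1 := a * q * w k; set c1 := K / b1.
have b10 : b1 != 0 by rewrite !mulf_neq0.
have c10 : c1 != 0 by rewrite mulf_neq0 ?invr_eq0.
have bc1 : b1 * c1 = K by rewrite mulrC divfK.
have cardD1 : #|A :\ k| = n by apply: succn_inj; rewrite -cA [RHS](cardsD1 k) kA.
have lb1 : la / a * b1 = la * q * w k by rewrite /b1; field.
have H1k i : th (a * q ^+ i * w k) != 0 by apply: H1.
have Hlk i : th (la * q ^+ i * w k) != 0 by apply: Hlw.
rewrite (Phi_step _ _ _ _ kA a0 sA H1k) -/b1 lb1 (Phi_step _ _ _ _ kA la0 sA Hlk).
rewrite (IH (A :\ k) (a * q) b1 (c1 * q) (d * q) (e * q) (la * q)) ?(mulf_neq0 _ q0) //; first last.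
- move=> j l i /setD1P[_ jA] /setD1P[_ lA] jl.
  by rewrite (mulrAC la) (mulrAC _ q) -mulf_div divff // mulr1 Hlww.
- by move=> j i /setD1P[_ jA]; rewrite -(mulrA la) -exprS Hlw.
- by move=> j i /setD1P[_ jA]; rewrite -(mulrA a) -exprS Haw.
- by rewrite mulrA bc1; apply: nondegenerateD1.
- exact: separatedD1.
- transitivity (la * (b1 * c1) * f * (q * q)); first ring.
  by rewrite bc1 laKf; ring.
- transitivity (a ^+ 3 * q ^+ 2 * (q ^+ 3)); first ring.
  by rewrite bal -/K -bc1; ring.
have laqE : la * q / (a * q) = la / a by rewrite -mulf_div divff // mulr1.
have alqE : a * q / (la * q) = a / la by rewrite -mulf_div divff // mulr1.
rewrite laqE alqE cardD1 cA /= lb1 -[la / a * c1 * q]mulrA.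
(* By this relation the scalars split off on the two sides are thetas of mutually inverse arguments:
   [la c1 / a] against [f w_k], and [la f w_k / a] against [c1]. The two inversions produce
   [c1 f w_k = a / la], the power by which the prefactors for [A] and [A :\ k] differ. *)
have fc : f * w k * (la / a * c1) = 1.
  apply: (mulfI (mulf_neq0 (expf_neq0 2 a0) q0)).
  rewrite mulr1 -[RHS]laKf -bc1 /b1; field.
  by rewrite a0.
have -> : la / a * c1 = (f * w k)^-1.
  by apply: (mulfI (mulf_neq0 f0 (w0 k))); rewrite fc mulfV // mulf_neq0.
have -> : la / a * f * w k = c1^-1.
  by apply: (mulIf c10); rewrite mulVf // -fc; ring.
have alE : a / la = c1 * (f * w k).
  by apply: (mulIf la0); rewrite divfK // -[LHS]mulr1 -fc; field.
rewrite !thV ?mulf_neq0 ?invr_eq0 // exprS {1}alE.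
field.
by rewrite ?c10 ?f0 ?w0 ?la0 ?expf_neq0.
Qed.

End SubsetSums.

(** * Principal specialization *)

Lemma prod_telescope (F : fieldType) m n (f u : nat -> F) : (m <= n)%N ->
  (forall i, (m <= i <= n)%N -> f i != 0) ->
  (forall i, (m <= i < n)%N -> u i = f i.+1 / f i) ->
  \prod_(m <= i < n) u i = f n / f m.
Proof.
rewrite leq_eqVlt => /predU1P[<-{n}|mn] f0 uE.
  by rewrite big_geq // divff // f0 // leqnn.
by apply: telescope_prodf_eq => // i /andP[/ltnW mi /ltnW im]; rewrite f0 ?mi.
Qed.

Lemma big_offdiag (R : Type) (idx : R) (op : Monoid.com_law idx) n
    (f : 'I_n -> 'I_n -> R) :
  \big[op/idx]_(j < n) \big[op/idx]_(k < n) f j k =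
  op (\big[op/idx]_(j < n) f j j)
     (\big[op/idx]_(j < n) \big[op/idx]_(k < n | (j < k)%N) op (f j k) (f k j)).
Proof.
transitivity (\big[op/idx]_(j < n) (op (f j j)
    (op (\big[op/idx]_(k < n | (j < k)%N) f j k)
        (\big[op/idx]_(k < n | (k < j)%N) f j k)))).
  apply: eq_bigr => j _; rewrite (bigD1 j) //=; congr (op _ _).
  rewrite (bigID (fun k : 'I_n => (j < k)%N)) /=; congr (op _ _); apply: eq_bigl => k;
    by rewrite -val_eqE /=; lia.
rewrite !big_split /=; congr (op _ _).
rewrite [X in op _ X](exchange_big_dep predT) //= -big_split /=.
by apply: eq_bigr => j _; rewrite -big_split.
Qed.

Section Box.
Variables (F : fieldType) (th : F -> F).
Hypothesis th1 : th 1 = 0.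
Hypothesis thV : forall x : F, x != 0 -> th x^-1 = - th x / x.

Variables (q : F) (n : nat) (m : 'I_n -> nat) (z : 'I_n -> F).
Hypothesis q0 : q != 0.
Hypothesis z0 : forall j, z j != 0.

Notation poch := (poch th q).

(* The box variables z_j are replaced by the geometric progressions
   z_j, z_j q, ..., z_j q^(m_j - 1). *)
Definition cell : finType := {j : 'I_n & 'I_(m j)}.
Definition cellw (p : cell) : F := z (tag p) * q ^+ tagged p.
Definition celllt (p p' : cell) : bool :=
  (tag p < tag p')%N || (tag p == tag p') && (tagged p < tagged p')%N.

Lemma celllt_irr : irreflexive celllt.
Proof. by move=> p; rewrite /celllt !ltnn andbF. Qed.

Lemma cell_eq (p p' : cell) :
  (p == p') = (tag p == tag p') && (tagged p == tagged p' :> nat).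
Proof.
apply/eqP/andP => [<- //|]; case: p p' => [j i] [k l] /= [/eqP jk].
by subst k => /eqP il; congr existT; apply: val_inj.
Qed.

Lemma celllt_tot p p' : p != p' -> celllt p p' = ~~ celllt p' p.
Proof.
rewrite cell_eq /celllt -!val_eqE /=; move: (tagged p : nat) (tagged p' : nat) => *; lia.
Qed.

Lemma cellw_neq0 p : cellw p != 0.
Proof. by rewrite mulf_neq0 ?expf_neq0. Qed.

Lemma prod_cell (f : 'I_n -> nat -> F) :
  \prod_(p : cell) f (tag p) (tagged p) = \prod_(j < n) \prod_(0 <= i < m j) f j i.
Proof.
under [RHS]eq_bigr do rewrite big_mkord.
by rewrite sig_big_dep.
Qed.

(** Reversing the order of the factors makes their arguments the inverses of those of [(x)_k]; then
    [thV] applies to each. *)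
Lemma poch_reflect x k : x != 0 ->
  poch (q / (q ^+ k * x)) k = (-1) ^+ k / (x ^+ k * q ^+ 'C(k, 2)) * poch x k.
Proof.
move=> x0; rewrite /poch big_nat_rev /= add0n.
elim: k => [|k IH]; first by rewrite !big_geq // bin0n /= !expr0 !mulr1 divr1.
have shift i : (i < k)%N -> q / (q ^+ k.+1 * x) * q ^+ (k.+1 - i.+1) = q / (q ^+ k * x) * q ^+ (k - i.+1).
  move=> ik; have -> : (k.+1 - i.+1 = (k - i.+1).+1)%N by lia.
  by rewrite !exprS; field; rewrite q0 x0 !expf_neq0.
rewrite !big_nat_recr //= (eq_big_nat _ _ (F2 := fun i => th (q / (q ^+ k * x) * q ^+ (k - i.+1)))); last first.
  by move=> i /andP[_ ik]; rewrite shift.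
rewrite IH subnn expr0 mulr1.
have -> : q / (q ^+ k.+1 * x) = (x * q ^+ k)^-1.
  by rewrite exprS; field; rewrite q0 x0 expf_neq0.
rewrite thV ?mulf_neq0 ?expf_neq0 // binS bin1 exprD !exprS.
by field; rewrite x0 !expf_neq0.
Qed.

(** With [u = z_k / z_j], [A = y_j], [B = y_k], the left side is the share of a pair j < k in the
    Vandermonde quotient and in the symbols with base [q z_k / z_j]. The right side has the symbols
    that [kern_cross] leaves in the denominator. *)
Lemma Delta_pair u A B : u != 0 ->
  (forall i j, th (u * q ^+ i / q ^+ j) != 0) ->
  q ^+ A * th (u * q ^+ B / q ^+ A) / th u / (poch (q * u) B * poch (q / u) A) =
  (q ^+ (A * B))^-1 / (poch (q ^- A * u) B * poch (q ^- B / u) A).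
Proof.
move=> u0 tu.
have tu0 : th u != 0 by have := tu 0%N 0%N; rewrite mulr1 divr1.
have poch0 j i k : poch (q ^- j * u * q ^+ i) k != 0.
  apply: poch_neq0 => l _; have := tu (i + l)%N j.
  by congr (th _ != 0); rewrite exprD; ring.
have E1 : poch (q / u) A = (-1) ^+ A / ((q ^- A * u) ^+ A * q ^+ 'C(A, 2)) * poch (q ^- A * u) A.
  rewrite -poch_reflect ?mulf_neq0 ?invr_eq0 ?expf_neq0 //; congr (poch _ _).
  by field; rewrite u0 expf_neq0.
have E2 : poch (q ^- B / u) A = (-1) ^+ A / ((q ^- A * u * q ^+ B.+1) ^+ A * q ^+ 'C(A, 2))
    * poch (q ^- A * u * q ^+ B.+1) A.
  rewrite -poch_reflect ?mulf_neq0 ?invr_eq0 ?expf_neq0 //; congr (poch _ _).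
  by rewrite exprS; field; rewrite q0 u0 !expf_neq0.
(* Both sides are [poch (q^-A u) (A + B + 1)], cut in two ways. *)
have E3 : poch (q ^- A * u) B * th (u * q ^+ B / q ^+ A) * poch (q ^- A * u * q ^+ B.+1) A =
   poch (q ^- A * u) A * th u * poch (q * u) B.
  have -> : th (u * q ^+ B / q ^+ A) = th (q ^- A * u * q ^+ B) by congr th; ring.
  rewrite -pochS -pochD.
  have -> : th u = th (q ^- A * u * q ^+ A) by congr th; field; rewrite expf_neq0.
  have -> : q * u = q ^- A * u * q ^+ A.+1 by rewrite exprS; field; rewrite expf_neq0.
  by rewrite -pochS -pochD addSnnS addnC.
have P0 : poch (q * u) B != 0.
  by have := poch0 0%N 1%N B; rewrite expr0 invr1 mul1r expr1 mulrC.
have X0 : poch (q ^- A * u) A != 0 by have := poch0 A 0%N A; rewrite mulr1.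
have W0 : poch (q ^- A * u) B != 0 by have := poch0 A 0%N B; rewrite mulr1.
have V0 := poch0 A B.+1 A.
have -> : th (u * q ^+ B / q ^+ A) = poch (q ^- A * u) A * th u * poch (q * u) B
    / (poch (q ^- A * u) B * poch (q ^- A * u * q ^+ B.+1) A).
  by rewrite -E3; field; rewrite W0 V0.
rewrite E1 E2 [(_ * q ^+ B.+1) ^+ A]exprMn -exprM mulSn exprD (mulnC B).
have s0 : (-1) ^+ A != 0 :> F by rewrite expf_neq0 // oppr_eq0 oner_eq0.
have x0 : (q ^- A * u) ^+ A != 0 by rewrite expf_neq0 // mulf_neq0 ?invr_eq0 ?expf_neq0.
move: (_ ^+ A) ((_ * _) ^+ A) s0 x0 => s x s0 x0.
by field; rewrite W0 V0 P0 X0 s0 x0 tu0 !expf_neq0.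
Qed.

(** Both sides are the binomial coefficient of [r + 1] over 2, where [r] is the sum of the [Y j].
    The right side collects the exponents of q from the diagonal ([poch_q]) and from the pairs
    ([Delta_pair]). *)
Lemma bin2_sum (Y : 'I_n -> nat) :
  ('C(\sum_(j < n) Y j, 2) + \sum_(j < n) Y j =
   \sum_(j < n) 'C((Y j).+1, 2) + \sum_(j < n) \sum_(k < n | (j < k)%N) Y j * Y k)%N.
Proof.
apply/eqP; rewrite -(eqn_pmul2l (isT : (0 < 2)%N)) !mulnDr; apply/eqP.
have bin2E k : (2 * 'C(k, 2) + k = k * k)%N.
  by elim: k => // k IH; rewrite binS bin1; lia.
transitivity ((\sum_(j < n) Y j) * (\sum_(j < n) Y j) + \sum_(j < n) Y j)%N.
  by have := bin2E (\sum_(j < n) Y j)%N; lia.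
rewrite big_distrlr /= big_offdiag /= addnAC; congr (_ + _)%N.
  rewrite big_distrr -big_split; apply: eq_bigr => j _ /=.
  by rewrite binS bin1 -bin2E; lia.
rewrite big_distrr; apply: eq_bigr => j _ /=; rewrite big_distrr.
by apply: eq_bigr => k _ /=; rewrite mulnC; lia.
Qed.

(** * Products over initial segments of the progressions *)

Section Staircase.
Variable Y : 'I_n -> nat.
Hypothesis Ym : forall j, (Y j <= m j)%N.

Definition stair : {set cell} := [set p : cell | (tagged p < Y (tag p))%N].
Let r := (\sum_(j < n) Y j)%N.

Lemma prod_stair (f : 'I_n -> nat -> F) :
  \prod_(p in stair) f (tag p) (tagged p) = \prod_(j < n) \prod_(0 <= i < Y j) f j i.
Proof.
under eq_bigl do rewrite inE.
rewrite big_mkcond /= (prod_cell (fun j i => if (i < Y j)%N then f j i else 1)).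
apply: eq_bigr => j _; rewrite (big_nat_widen _ _ _ _ _ (Ym j)).
by rewrite [RHS]big_mkcond.
Qed.

Lemma prod_stairC (f : 'I_n -> nat -> F) :
  \prod_(p in [set: cell] :\: stair) f (tag p) (tagged p) =
  \prod_(j < n) \prod_(Y j <= i < m j) f j i.
Proof.
under eq_bigl do rewrite !inE andbT -leqNgt.
rewrite big_mkcond /= (prod_cell (fun j i => if (Y j <= i)%N then f j i else 1)).
apply: eq_bigr => j _; rewrite [RHS](@big_nat_widenl _ _ _ _ 0) //.
by rewrite [RHS]big_mkcond.
Qed.

Lemma card_cell : #|[set: cell]| = (\sum_(j < n) m j)%N.
Proof.
rewrite cardsT card_tagged sumnE big_map big_enum /=.
by apply: eq_bigr => j _; rewrite card_ord.
Qed.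

Lemma card_stair : #|stair| = r.
Proof.
rewrite -sum1_card; under eq_bigl do rewrite inE.
transitivity (\sum_(j < n) \sum_(i < m j | (i < Y j)%N) 1)%N.
  by rewrite sig_big_dep.
apply: eq_bigr => j _; rewrite -(big_mkord (fun i => (i < Y j)%N) (fun _ => 1%N)).
by rewrite -(big_nat_widen 0 (Y j) (m j) predT) // sum_nat_const_nat subn0 muln1.
Qed.

(** The exponents are not restricted to cells: telescoping reaches [z_j q^(m_j)], one step past the
    progression. *)
Definition cell_separated := forall j k i l,
  ((j, i) != (k, l)) -> th (z j * q ^+ i / (z k * q ^+ l)) != 0.
Definition cell_coseparated := forall j k i l,
  th (z j * q ^+ i * (z k * q ^+ l)) != 0.

(** Dividing the argument by q moves the second cell one step along its row, so the quotients
    telescope along the complement of the segment, from [Y j] to [m j]. The upper end is the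
    terminating symbol of the summand. *)
Lemma kern_cross : cell_separated ->
  \prod_(p in stair) \prod_(p' in [set: cell] :\: stair)
     (th (q^-1 * (cellw p / cellw p')) / th (cellw p / cellw p')) =
  \prod_(j < n) \prod_(k < n)
    (poch (q ^- m j * z k / z j) (Y k) / poch (q ^- Y j * z k / z j) (Y k)).
Proof.
move=> sep.
pose h k i j l := th (z k * q ^+ i / (z j * q ^+ l)).
transitivity (\prod_(k < n) \prod_(0 <= i < Y k)
   \prod_(j < n) (h k i j (m j) / h k i j (Y j))).
  rewrite -prod_stair; apply: eq_bigr => p; rewrite inE => pY.
  transitivity (\prod_(p' in [set: cell] :\: stair)
     (h (tag p) (tagged p) (tag p') (tagged p').+1
      / h (tag p) (tagged p) (tag p') (tagged p'))).
    apply: eq_bigr => p' _; rewrite /h /cellw exprS; congr (th _ / _).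
    by field; rewrite q0 z0 !expf_neq0.
  rewrite (prod_stairC (fun j l => h (tag p) (tagged p) j l.+1 / h (tag p) (tagged p) j l)).
  apply: eq_bigr => j _; apply: prod_telescope => // l /andP[Yl lm].
  apply: sep; apply/eqP; move: pY; move: (tag p) (nat_of_ord (tagged p)) => k i iY.
  by move=> [ej el]; rewrite el ej ltnNge Yl in iY.
rewrite [RHS]exchange_big /=; apply: eq_bigr => k _.
rewrite exchange_big /=; apply: eq_bigr => j _.
rewrite prodf_div; congr (_ / _); apply: eq_bigr => i _; congr th;
  by field; rewrite z0 !expf_neq0.
Qed.

(** Every pair factor is a quotient of [h] at neighbouring cells and telescopes in one of the two
    rows. Pairs in different rows give the off-diagonal symbols; pairs in one row, together with the
    product of [th (q w^2)], give the diagonal ones. *)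
Lemma kern_pairs : cell_coseparated ->
  pair_prod th q cellw celllt [set: cell] stair
  * \prod_(p in stair) th (q * (cellw p * cellw p)) =
  (\prod_(j < n) \prod_(k < n | (j < k)%N) (1 / poch (z j * z k) (Y j + Y k)))
  * \prod_(j < n) \prod_(k < n) poch (q ^+ m j * z j * z k) (Y k).
Proof.
move=> cosep.
pose h j i k l := th (z j * q ^+ i * (z k * q ^+ l)).
pose G (j : 'I_n) i (k : 'I_n) l := if ((j < k)%N || (j == k) && (i < l)%N) && ((i < Y j)%N || (l < Y k)%N)
   then h j i k l.+1 / h j i k l else 1.
have h0 j i k l : h j i k l != 0 by apply: cosep.
have -> : pair_prod th q cellw celllt [set: cell] stair =
    \prod_(j < n) \prod_(k < n) \prod_(0 <= i < m j) \prod_(0 <= l < m k) G j i k l.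
  rewrite /pair_prod.
  transitivity (\prod_(p : cell) \prod_(p' : cell) G (tag p) (tagged p) (tag p') (tagged p')).
    apply: eq_big => [p|p _]; first by rewrite inE.
    apply: eq_big => [p'|p' _]; first by rewrite inE.
    rewrite /celllt !inE /G; case: ifP => // _.
    congr (th _ / _); rewrite /cellw exprS; ring.
  rewrite (prod_cell (fun j i => \prod_(p' : cell) G j i (tag p') (tagged p'))).
  apply: eq_bigr => j _; rewrite [RHS]exchange_big /=.
  apply: eq_bigr => i _; exact: (prod_cell (fun k l => G j i k l)).
(* In a single row the telescoping starts just after cell [i]. The lower end [h j i j i.+1] is
   [th (q w^2)] for that cell and cancels against the other product. *)
transitivity ((\prod_(j < n) \prod_(k < n | (j < k)%N)
     ((poch (q ^+ m k * z k * z j) (Y j) * poch (q ^+ m j * z j * z k) (Y k))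
      / poch (z j * z k) (Y j + Y k))) *
   \prod_(j < n) \prod_(0 <= i < Y j) (h j i j (m j) / h j i j i.+1)
   * \prod_(p in stair) th (q * (cellw p * cellw p))); last first.
  have diag : \prod_(j < n) \prod_(0 <= i < Y j) (h j i j (m j) / h j i j i.+1)
      * \prod_(p in stair) th (q * (cellw p * cellw p)) =
      \prod_(j < n) poch (q ^+ m j * z j * z j) (Y j).
    rewrite (prod_stair (fun j i => th (q * ((z j * q ^+ i) * (z j * q ^+ i))))).
    rewrite -big_split; apply: eq_bigr => j _; rewrite -big_split; apply: eq_bigr => i _.
    rewrite /= [q * _](_ : _ = z j * q ^+ i * (z j * q ^+ i.+1)); last by rewrite exprS; ring.
    by rewrite divfK ?h0 //; congr th; ring.
  rewrite -mulrA diag big_offdiag [RHS]mulrCA [LHS]mulrC; congr (_ * _).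
  rewrite -big_split; apply: eq_bigr => j _; rewrite -big_split; apply: eq_bigr => k _.
  by rewrite /= mul1r [RHS]mulrC [poch _ (Y j) * _]mulrC.
congr (_ * _).
transitivity (\prod_(j < n) ((\prod_(k < n | (j < k)%N)
  \prod_(0 <= i < m j) \prod_(0 <= l < m k) G j i k l)
   * \prod_(0 <= i < m j) \prod_(0 <= l < m j) G j i j l)).
  apply: eq_bigr => j _; rewrite (bigID (fun k : 'I_n => (j < k)%N)) /=.
  congr (_ * _); rewrite (bigD1 j) ?ltnn //= [X in _ * X]big1 ?mulr1 // => k kj.
  rewrite big1 // => i _; rewrite big1 // => l _; rewrite /G.
  by case: ifP => //; move: kj; rewrite -!val_eqE /=; lia.
rewrite big_split /=; congr (_ * _).
  apply: eq_bigr => j _; apply: eq_bigr => k jk.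
  rewrite (@big_cat_nat _ _ _ (Y j)) //= pochD.
  (* For [i < Y j] every [l] contributes and the product telescopes in [l]; for [i >= Y j] only
     [l < Y k] does, and it telescopes in [i]. *)
  have -> : \prod_(0 <= i < Y j) \prod_(0 <= l < m k) G j i k l =
      poch (q ^+ m k * z k * z j) (Y j) / poch (z j * z k) (Y j).
    rewrite -prodf_div; apply: eq_big_nat => i /andP[_ iY].
    rewrite (@prod_telescope _ 0 (m k) (h j i k)) //.
      by rewrite /h; congr (th _ / th _); rewrite ?expr0; ring.
    by move=> l _; rewrite /G jk iY.
  have -> : \prod_(Y j <= i < m j) \prod_(0 <= l < m k) G j i k l =
      poch (q ^+ m j * z j * z k) (Y k) / poch (z j * z k * q ^+ Y j) (Y k).
    transitivity (\prod_(Y j <= i < m j) \prod_(0 <= l < Y k) (h j i.+1 k l / h j i k l)).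
      apply: eq_big_nat => i /andP[Yi _]; rewrite (@big_cat_nat _ _ _ (Y k)) //=.
      rewrite [X in _ * X]big1_seq ?mulr1; last first.
        move=> l /=; rewrite mem_index_iota /G => /andP[Yl _].
        by rewrite !ltnNge Yi Yl andbF.
      apply: eq_big_nat => l /andP[_ lY]; rewrite /G jk lY orbT /h; congr (th _ / _).
      by rewrite !exprS; ring.
    rewrite exchange_big -prodf_div; apply: eq_bigr => l _ /=.
    rewrite (@prod_telescope _ _ _ (fun i => h j i k l)) //.
    by rewrite /h; congr (th _ / th _); ring.
  by rewrite mulf_div.
apply: eq_bigr => j _; rewrite (@big_cat_nat _ _ _ (Y j)) //=.
rewrite [X in _ * X]big1_seq ?mulr1; last first.
  move=> i /=; rewrite mem_index_iota => /andP[Yi _]; rewrite big1 // => l _.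
  by rewrite /G; case: ifP => //; rewrite ltnn eqxx /=; lia.
apply: eq_big_nat => i /andP[_ iY]; have im := leq_trans iY (Ym j).
rewrite (@big_cat_nat _ _ _ i.+1) //= big1_seq ?mul1r; last first.
  by move=> l /=; rewrite mem_index_iota /G ltnn eqxx /=; case: ifP => //; lia.
apply: prod_telescope => // l /andP[il _].
by rewrite /G ltnn eqxx /= il iY.
Qed.

Lemma poch_q k : poch q k = (-1) ^+ k * q ^+ 'C(k.+1, 2) * poch (q ^- k) k.
Proof.
have qk := expf_neq0 k q0.
have -> : poch q k = poch (q / (q ^+ k * q ^- k)) k by rewrite mulfV // divr1.
rewrite poch_reflect ?invr_eq0 //; congr (_ * _ * _).
rewrite exprVn -exprM binS bin1.
have -> : (k * k = 'C(k, 2) + 'C(k, 2) + k)%N.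
  by elim: k {qk} => // k IH; rewrite binS bin1; lia.
by rewrite !exprD; field; rewrite oner_neq0 !expf_neq0.
Qed.

Definition vandermonde (x : 'I_n -> F) :=
  \prod_(j < n) \prod_(k < n | (j < k)%N) (x j * th (x k / x j)).

(** Off the diagonal this is [Delta_pair], on it [poch_q], and [bin2_sum] adds up the powers of q.
    The result carries exactly the sign and power of q that open the definition of [kern]. *)
Lemma kern_vandermonde : cell_separated -> (forall i, th (q ^+ i.+1) != 0) ->
  vandermonde (fun k => z k * q ^+ Y k) / vandermonde z
  * (\prod_(j < n) \prod_(k < n) (poch (q * z k / z j) (Y k))^-1) * q ^+ r =
  (-1) ^+ r / q ^+ 'C(r, 2) *
  \prod_(j < n) \prod_(k < n) (poch (q ^- Y j * z k / z j) (Y k))^-1.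
Proof.
move=> sep tq.
have -> : vandermonde (fun k => z k * q ^+ Y k) / vandermonde z =
   \prod_(j < n) \prod_(k < n | (j < k)%N)
      (q ^+ Y j * th (z k / z j * q ^+ Y k / q ^+ Y j) / th (z k / z j)).
  rewrite -prodf_div; apply: eq_bigr => j _; rewrite -prodf_div; apply: eq_bigr => k _.
  have -> : z k * q ^+ Y k / (z j * q ^+ Y j) = z k / z j * q ^+ Y k / q ^+ Y j.
    by field; rewrite z0 expf_neq0.
  by rewrite -(mulrA (z j)) -mulf_div divff // mul1r.
rewrite !big_offdiag /= mulrCA -big_split /=.
under [X in _ * X * _ = _]eq_bigr => j _.
  rewrite -big_split /=.
  under eq_bigr => k jk.
    rewrite -invfM (_ : q * z j / z k = q / (z k / z j)); last by field; rewrite !z0.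
    rewrite -[q * z k / z j]mulrA Delta_pair; first last.
    - move=> i l; have /sep : (k, i) != (j, l).
        by apply/eqP => -[kj _]; rewrite kj ltnn in jk.
      by congr (th _ != 0); field; rewrite z0 expf_neq0.
    - by rewrite mulf_neq0 ?invr_eq0.
    rewrite (_ : q ^- Y k / (z k / z j) = q ^- Y k * z j / z k); last first.
      by field; rewrite !z0 expf_neq0.
    rewrite [q ^- Y j * (_ / _)]mulrA.
    over.
  rewrite big_split /=. over.
rewrite [X in _ * X * _ = _]big_split /=.
have -> : \prod_(j < n) (poch (q * z j / z j) (Y j))^-1 =
   (-1) ^+ r / q ^+ (\sum_(j < n) 'C((Y j).+1, 2))%N *
   \prod_(j < n) (poch (q ^- Y j * z j / z j) (Y j))^-1.
  rewrite /r -!prodrXr -prodfV -!big_split; apply: eq_bigr => j _ /=.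
  by rewrite !mulfK // poch_q !invfM invr_sign.
have -> : \prod_(j < n) \prod_(k < n | (j < k)%N) (q ^+ (Y j * Y k))^-1 =
   (q ^+ (\sum_(j < n) \sum_(k < n | (j < k)%N) Y j * Y k)%N)^-1.
  by rewrite -prodrXr -prodfV; apply: eq_bigr => j _; rewrite -prodrXr -prodfV.
have -> : q ^- 'C(r, 2) = q ^+ r * (q ^- (\sum_(j < n) 'C((Y j).+1, 2)) *
   q ^- (\sum_(j < n) \sum_(k < n | (j < k)%N) Y j * Y k)).
  by rewrite -invfM -exprD -bin2_sum exprD; field; rewrite !expf_neq0.
under [X in _ = _ * (_ * X)]eq_bigr do under eq_bigr do rewrite -invfM.
ring.
Qed.

Lemma kern_axis a j : (Y j <= r)%N ->
  (forall i, th (a * z j * q ^+ i) != 0) ->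
  (forall i l, th (a * q ^+ i / (z j * q ^+ l)) != 0) ->
  th (a * z j * q ^+ (Y j + r)) / th (a * z j) *
  (poch (a * z j) r * poch (a * q / z j) (r - Y j)
   / (poch (a * q ^+ (1 + m j) * z j) r * poch (a * (q / q ^+ m j) / z j) r)) =
  (\prod_(0 <= i < m j) (th (a * q * (z j * q ^+ i)) / th (a / (z j * q ^+ i)))) *
  (\prod_(0 <= i < Y j) (th (a * q ^+ r * (z j * q ^+ i)))^-1) *
  \prod_(Y j <= i < m j)
     (th (a * q ^+ r / (z j * q ^+ i)) / th (a * q ^+ r.+1 * (z j * q ^+ i))).
Proof.
move=> Yr taz ta.
(* Both sides are [poch (a z_j) (m_j + r + 1)]. *)
have E1 : th (a * z j * q ^+ (Y j + r)) * poch (a * z j) r * poch (a * q ^+ r * z j) (Y j)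
    * poch (a * q ^+ r.+1 * z j * q ^+ Y j) (m j - Y j) =
    th (a * z j) * poch (a * q * z j) (m j) * poch (a * q ^+ (1 + m j) * z j) r.
  transitivity (poch (a * z j) (r + Y j + 1 + (m j - Y j))).
    rewrite pochD addn1 pochS pochD (addnC _ r) [q ^+ (r + _).+1]exprS.
    rewrite [a * q ^+ r * _]mulrAC (_ : a * q ^+ r.+1 * z j * q ^+ Y j = a * z j * (q * q ^+ (r + Y j))); last first.
      by rewrite exprS exprD; ring.
    ring.
  have -> : (r + Y j + 1 + (m j - Y j) = (m j + r).+1)%N by have := Ym j; lia.
  rewrite pochSl pochD mulrA [a * z j * q]mulrAC; congr (_ * poch _ _).
  by rewrite add1n exprS; ring.
(* Both sides are [poch x (m_j + r - Y_j)] with [x = a q^(1 - m_j) / z_j]. *)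
have E2 : poch (a * q / z j) (r - Y j) * \prod_(0 <= i < m j) th (a / (z j * q ^+ i)) =
    poch (a * (q / q ^+ m j) / z j) r * \prod_(Y j <= i < m j) th (a * q ^+ r / (z j * q ^+ i)).
  set x := a * (q / q ^+ m j) / z j.
  have -> : \prod_(0 <= i < m j) th (a / (z j * q ^+ i)) = poch x (m j).
    rewrite big_nat_rev add0n /=; apply: eq_big_nat => i /andP[_ im]; congr th.
    have -> : x = a * (q / (q ^+ i * q * q ^+ (m j - i.+1))) / z j.
      by rewrite -exprSr -exprD subnKC.
    by field; rewrite q0 z0 !expf_neq0.
  have -> : \prod_(Y j <= i < m j) th (a * q ^+ r / (z j * q ^+ i)) = poch (x * q ^+ r) (m j - Y j).
    rewrite big_nat_rev -{1}[Y j]add0n big_addn; apply: eq_big_nat => i /andP[_ im]; congr th.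
    have -> : (Y j + m j - (i + Y j).+1 = m j - i.+1)%N by lia.
    have im' : (i < m j)%N by lia.
    have -> : x = a * (q / (q ^+ i * q * q ^+ (m j - i.+1))) / z j.
      by rewrite -exprSr -exprD subnKC.
    by field; rewrite q0 z0 !expf_neq0.
  have -> : a * q / z j = x * q ^+ m j by rewrite /x; field; rewrite z0 expf_neq0.
  by rewrite mulrC -!pochD; congr (poch _ _); have := Ym j; lia.
have D1 : th (a * z j) != 0 by have := taz 0%N; rewrite mulr1.
have D2 : poch (a * q ^+ (1 + m j) * z j) r != 0.
  apply: poch_neq0 => i _; have := taz (1 + m j + i)%N.
  by congr (th _ != 0); rewrite exprD; ring.
have D3 : poch (a * q ^+ r * z j) (Y j) != 0.
  apply: poch_neq0 => i _; have := taz (r + i)%N.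
  by congr (th _ != 0); rewrite exprD; ring.
have D4 : poch (a * q ^+ r.+1 * z j * q ^+ Y j) (m j - Y j) != 0.
  apply: poch_neq0 => i _; have := taz (r.+1 + Y j + i)%N.
  by congr (th _ != 0); rewrite !exprD; ring.
have D5 : poch (a * (q / q ^+ m j) / z j) r != 0.
  apply: poch_neq0 => i _; have := ta i.+1 (m j).
  by congr (th _ != 0); rewrite exprS; field; rewrite z0 expf_neq0.
have D6 : \prod_(0 <= i < m j) th (a / (z j * q ^+ i)) != 0.
  rewrite prodf_seq_neq0; apply/allP => i _; apply/implyP => _.
  by have := ta 0%N i; rewrite mulr1.
rewrite prodfV !prodf_div.
have -> : \prod_(0 <= i < m j) th (a * q * (z j * q ^+ i)) = poch (a * q * z j) (m j).
  by apply: eq_bigr => i _; rewrite mulrA.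
have -> : \prod_(0 <= i < Y j) th (a * q ^+ r * (z j * q ^+ i)) = poch (a * q ^+ r * z j) (Y j).
  by apply: eq_bigr => i _; rewrite mulrA.
have -> : \prod_(Y j <= i < m j) th (a * q ^+ r.+1 * (z j * q ^+ i)) =
    poch (a * q ^+ r.+1 * z j * q ^+ Y j) (m j - Y j).
  rewrite -{1}[Y j]add0n big_addn; apply: eq_bigr => i _; congr th.
  by rewrite exprD; ring.
have A20 : poch (a * z j) r != 0 by apply: poch_neq0 => i _; apply: taz.
set A1 := th _ in E1 *; set A2 := poch (a * z j) r in E1 A20 *.
set B1 := poch (a * q / z j) _ in E2 *.
have -> : A1 = th (a * z j) * poch (a * q * z j) (m j) * poch (a * q ^+ (1 + m j) * z j) r
   / (A2 * poch (a * q ^+ r * z j) (Y j) * poch (a * q ^+ r.+1 * z j * q ^+ Y j) (m j - Y j)).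
  by rewrite -E1; field; rewrite A20 D3 D4.
have -> : B1 = poch (a * (q / q ^+ m j) / z j) r
   * \prod_(Y j <= i < m j) th (a * q ^+ r / (z j * q ^+ i))
   / \prod_(0 <= i < m j) th (a / (z j * q ^+ i)) by rewrite -E2 mulfK.
by field; rewrite A20 D1 D2 D3 D4 D5 D6.
Qed.

Definition box_kern a :=
  vandermonde (fun k => z k * q ^+ Y k) / vandermonde z
  * (\prod_(k < n) (th (a * z k * q ^+ (Y k + r)) / th (a * z k)))
  * (\prod_(j < n) \prod_(k < n | (j < k)%N) (1 / poch (z j * z k) (Y j + Y k)))
  * (\prod_(j < n) \prod_(k < n)
      (poch (q ^- m j * z k / z j) (Y k) * poch (q ^+ m j * z j * z k) (Y k)
       / poch (q * z k / z j) (Y k)))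
  * (\prod_(j < n)
      (poch (a * z j) r * poch (a * q / z j) (r - Y j)
       / (poch (a * q ^+ (1 + m j) * z j) r * poch (a * (q / q ^+ m j) / z j) r))).

Lemma box_kernE a : cell_separated -> cell_coseparated ->
  (forall i, th (q ^+ i.+1) != 0) ->
  (forall j i, th (a * z j * q ^+ i) != 0) ->
  (forall j i l, th (a * q ^+ i / (z j * q ^+ l)) != 0) ->
  box_kern a * q ^+ r =
  (\prod_(p : cell) (th (a * q * cellw p) / th (a / cellw p)))
  * kern th q cellw celllt a [set: cell] stair.
Proof.
move=> sep cosep tq taz ta.
have kv := kern_vandermonde sep tq.
have kc := kern_cross sep.
have kp := kern_pairs cosep.
have Yr j : (Y j <= r)%N by rewrite /r (bigD1 j) //= leq_addr.
have ka : (\prod_(k < n) (th (a * z k * q ^+ (Y k + r)) / th (a * z k))) *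
   (\prod_(j < n)
      (poch (a * z j) r * poch (a * q / z j) (r - Y j)
       / (poch (a * q ^+ (1 + m j) * z j) r * poch (a * (q / q ^+ m j) / z j) r))) =
  (\prod_(p : cell) (th (a * q * cellw p) / th (a / cellw p)))
  * (\prod_(p in stair) (th (a * q ^+ r * cellw p))^-1)
  * \prod_(p in [set: cell] :\: stair)
       (th (a * q ^+ r / cellw p) / th (a * q ^+ r.+1 * cellw p)).
  rewrite /cellw (prod_cell (fun j i => th (a * q * (z j * q ^+ i)) / th (a / (z j * q ^+ i)))).
  rewrite (prod_stair (fun j i => (th (a * q ^+ r * (z j * q ^+ i)))^-1)).
  rewrite (prod_stairC (fun j i => th (a * q ^+ r / (z j * q ^+ i)) / th (a * q ^+ r.+1 * (z j * q ^+ i)))).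
  rewrite -[LHS]big_split -[X in _ = X * _]big_split -[RHS]big_split.
  by apply: eq_bigr => j _; apply: kern_axis.
have split2 (f g : 'I_n -> 'I_n -> F) : \prod_(j < n) \prod_(k < n) (f j k * g j k) =
    (\prod_(j < n) \prod_(k < n) f j k) * \prod_(j < n) \prod_(k < n) g j k.
  by rewrite -big_split; apply: eq_bigr => j _; rewrite -big_split.
rewrite /kern card_stair -/r kc /box_kern.
have -> : \prod_(j < n) \prod_(k < n)
    (poch (q ^- m j * z k / z j) (Y k) * poch (q ^+ m j * z j * z k) (Y k)
       / poch (q * z k / z j) (Y k)) =
    (\prod_(j < n) \prod_(k < n) poch (q ^- m j * z k / z j) (Y k)) *
    (\prod_(j < n) \prod_(k < n) poch (q ^+ m j * z j * z k) (Y k)) *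
    (\prod_(j < n) \prod_(k < n) (poch (q * z k / z j) (Y k))^-1).
  by rewrite split2 (split2 (fun j k => poch (q ^- m j * z k / z j) (Y k))).
have -> : \prod_(j < n) \prod_(k < n)
    (poch (q ^- m j * z k / z j) (Y k) / poch (q ^- Y j * z k / z j) (Y k)) =
    (\prod_(j < n) \prod_(k < n) poch (q ^- m j * z k / z j) (Y k)) *
    (\prod_(j < n) \prod_(k < n) (poch (q ^- Y j * z k / z j) (Y k))^-1).
  by rewrite split2.
have -> : \prod_(p in stair) (th (q * (cellw p * cellw p)) / th (a * q ^+ r * cellw p)) =
    (\prod_(p in stair) th (q * (cellw p * cellw p))) *
    \prod_(p in stair) (th (a * q ^+ r * cellw p))^-1 by rewrite -[RHS]big_split.
move: kv kp ka.
move: (vandermonde _ / _) (\prod_j \prod_k (poch (q * _ / _) _)^-1).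
move: (\prod_j \prod_k (poch (q ^- Y _ * _ / _) _)^-1).
move: (\prod_j \prod_k (poch (q ^- m _ * _ / _) _)).
move: (\prod_j \prod_k (poch (q ^+ m _ * _ * _) _)).
move: (\prod_(j < n) \prod_(k < n | (j < k)%N) _) (\prod_(j < n) (_ / _)) (\prod_(j < n) (_ / _)).
move: (pair_prod _ _ _ _ _ _) (\prod_(p in stair) th (q * _)) (_ / _) (\prod_p _) => x1 x2 x3 x4.
move=> x5 x6 x7 x8 x9 x10 x11 x12 kv kp ka.
transitivity (x11 * x12 * q ^+ r * (x5 * x8) * (x7 * x6) * x9); first ring.
rewrite kv -kp ka; ring.
Qed.
End Staircase.

Lemma stair_inj (Y Y' : 'I_n -> nat) : (forall j, Y j <= m j)%N ->
  (forall j, Y' j <= m j)%N -> stair Y = stair Y' -> Y =1 Y'.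
Proof.
move=> Ym Y'm E j.
have sub (U V : 'I_n -> nat) : (forall j, V j <= m j)%N -> stair U = stair V -> (V j <= U j)%N.
  move=> Vm UV; rewrite leqNgt; apply/negP => lt.
  have lt' := leq_trans lt (Vm j).
  have /setP/(_ (Tagged (fun j => 'I_(m j)) (Ordinal lt'))) := UV.
  by rewrite !inE /= ltnn lt.
by apply/eqP; rewrite eqn_leq !sub.
Qed.

Lemma lower_stair (I : {set cell}) :
  (forall p p' : cell, p \in I -> tag p = tag p' -> tagged p = (tagged p').+1 :> nat -> p' \in I) ->
  exists2 Y : 'I_n -> nat, (forall j, Y j <= m j)%N & I = stair Y.
Proof.
move=> low.
pose mem j i := [exists p in I, (tag p == j) && (tagged p == i :> nat)].
have memT p : p \in I = mem (tag p) (tagged p).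
  apply/idP/existsP => [pI|[p' /and3P[p'I t i]]]; first by exists p; rewrite pI !eqxx.
  by rewrite (_ : p = p') //; apply/eqP; rewrite eq_sym cell_eq t i.
have memS j i : mem j i.+1 -> mem j i.
  case/existsP => -[j' [l lm]] /and3P[pI /eqP /= jE /eqP lE]; subst j' l.
  have im := ltnW lm.
  have := low _ (Tagged (fun j => 'I_(m j)) (Ordinal im)) pI (erefl _) (erefl _).
  by rewrite memT.
have memD j i l : (i <= l)%N -> mem j l -> mem j i.
  by move=> /subnK <-; elim: (l - i)%N => // k IH /memS.
(* The first index missing from row [j]; [find] returns [m j] for a full row. *)
pose Y j := find (fun i => ~~ mem j i) (iota 0 (m j)).
have Ym j : (Y j <= m j)%N by rewrite -[leqRHS](size_iota 0) find_size.
exists Y => //; apply/setP => p; rewrite inE memT.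
case: ltnP => [pY|Yp].
  by have := before_find 0%N pY; rewrite nth_iota ?(leq_trans pY) // add0n => /negbFE.
apply/negbTE/negP => memp; have := memD _ _ _ Yp memp.
have Ylt : (Y (tag p) < m (tag p))%N by apply: leq_ltn_trans Yp _.
have : has (fun i => ~~ mem (tag p) i) (iota 0 (m (tag p))).
  by rewrite has_find size_iota.
by move=> /(nth_find 0%N); rewrite nth_iota // add0n => /negP.
Qed.

Lemma kern_eq0 a (I : {set cell}) :
  (forall Y : 'I_n -> nat, (forall j, Y j <= m j)%N -> I <> stair Y) ->
  kern th q cellw celllt a [set: cell] I = 0.
Proof.
move=> notstair; apply/eqP; apply: contraT => kn0.
have [Y Ym E] : exists2 Y : 'I_n -> nat, (forall j, Y j <= m j)%N & I = stair Y.
  apply: lower_stair => p p' pI tE iE; apply: contraT => p'I; case/eqP: kn0.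
  rewrite /kern (bigD1 p) //= (bigD1 p') ?inE ?p'I //=.
  (* The cross factor of a cell in I and its missing predecessor is [th (q^-1 q)]. *)
  rewrite (_ : q^-1 * _ = 1) ?th1 ?mul0r ?mulr0 ?mul0r //.
  by rewrite /cellw iE tE exprS; field; rewrite q0 z0 expf_neq0.
by case: (notstair Y Ym E).
Qed.

Lemma sum_stair (f : {set cell} -> F) :
  (forall I, (forall Y : 'I_n -> nat, (forall j, Y j <= m j)%N -> I <> stair Y) -> f I = 0) ->
  \sum_(I : {set cell} | I \subset [set: cell]) f I =
  \sum_(y : {dffun forall j : 'I_n, 'I_(m j).+1}) f (stair (fun j => y j)).
Proof.
move=> f0; pose h (y : {dffun forall j : 'I_n, 'I_(m j).+1}) := stair (fun j => y j).
have hinj : injective h.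
  move=> y y' /stair_inj E; apply/ffunP => j; apply: val_inj.
  by apply: E => k; rewrite -ltnS.
rewrite -(big_imset (h := h) (A := predT)) /=; last by move=> y y' _ _ /hinj.
rewrite [RHS]big_mkcond /=; apply: eq_big => [I|I _]; first by rewrite subsetT.
case: ifPn => // /imsetP nI; apply: f0 => Y Ym E; apply: nI.
exists [ffun j => Ordinal (Ym j : (Y j < (m j).+1)%N)] => //.
by rewrite /h E; apply/setP => p; rewrite !inE ffunE.
Qed.

Definition size1 (Y : 'I_n -> nat) := (\sum_(j < n) Y j)%N.

Definition box_term a b c d e f (Y : 'I_n -> nat) :=
  box_kern Y a
  * (poch b (size1 Y) * poch c (size1 Y) * poch d (size1 Y) * poch e (size1 Y)
     / poch (a * q / f) (size1 Y))
  * (\prod_(k < n) (poch (f * z k) (Y k)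
       / (poch (a * q / b * z k) (Y k) * poch (a * q / c * z k) (Y k)
          * poch (a * q / d * z k) (Y k) * poch (a * q / e * z k) (Y k))))
  * q ^+ size1 Y.

Definition cleared a b :=
  forall j i, th (a * q * (z j * q ^+ i) / b) != 0.

Lemma numer_stair a b (Y : 'I_n -> nat) : (forall j, Y j <= m j)%N -> cleared a b ->
  numer th q cellw a b [set: cell] (stair Y) =
  poch b (size1 Y) * (\prod_(p : cell) th (a * q * cellw p / b))
  / \prod_(k < n) poch (a * q / b * z k) (Y k).
Proof.
move=> Ym tab; rewrite /numer card_stair //.
rewrite -[RHS]mulrA; congr (_ * _).
have -> : \prod_(k < n) poch (a * q / b * z k) (Y k) =
    \prod_(p in stair Y) th (a * q * cellw p / b).
  rewrite /cellw (prod_stair Ym (fun j i => th (a * q * (z j * q ^+ i) / b))).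
  by apply: eq_bigr => k _; apply: eq_bigr => i _; congr th; ring.
have -> : \prod_(p : cell) th (a * q * cellw p / b) =
   \prod_(p in [set: cell]) th (a * q * cellw p / b).
  by apply: eq_bigl => p; rewrite inE.
rewrite [in RHS](big_setID (stair Y)) /= setTI [RHS]mulrC mulKf //.
by apply/prodf_neq0 => p _; apply: tab.
Qed.

Lemma denom_stair a f (Y : 'I_n -> nat) : (forall j, Y j <= m j)%N ->
  (forall i, th (a * q ^+ i.+1 / f) != 0) ->
  denom th q cellw a f [set: cell] (stair Y) =
  poch (a * q / f) (size1 m) / poch (a * q / f) (size1 Y)
  * \prod_(k < n) poch (f * z k) (Y k).
Proof.
move=> Ym taf; rewrite /denom card_stair // card_cell.
rewrite (_ : \prod_(p in stair Y) _ = \prod_(k < n) poch (f * z k) (Y k)); last first.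
  rewrite /cellw (prod_stair Ym (fun j i => th (f * (z j * q ^+ i)))).
  by apply: eq_bigr => k _; apply: eq_bigr => i _; rewrite mulrA.
congr (_ * _); have YM : (size1 Y <= size1 m)%N by apply: leq_sum => j _.
rewrite -{1}(subnKC YM) pochD [RHS]mulrC mulKf.
  by congr (poch _ _); rewrite exprS; ring.
apply: poch_neq0 => i _; have := taf i.
by congr (th _ != 0); rewrite exprS; ring.
Qed.

(** The constant between the box sum and [Phi]: the prefactor of [box_kernE] over the denominators
    cleared in [numer] and [denom]. *)
Definition box_factor a b c d e f :=
  (\prod_(p : cell) (th (a * q * cellw p) / th (a / cellw p)))
  / (poch (a * q / f) (size1 m)
     * (\prod_(p : cell) th (a * q * cellw p / b))
     * (\prod_(p : cell) th (a * q * cellw p / c))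
     * (\prod_(p : cell) th (a * q * cellw p / d))
     * (\prod_(p : cell) th (a * q * cellw p / e))).

Definition axis_regular a :=
  (forall j i, th (a * z j * q ^+ i) != 0) /\
  (forall j i l, th (a * q ^+ i / (z j * q ^+ l)) != 0).

Hypothesis sep : cell_separated.
Hypothesis cosep : cell_coseparated.
Hypothesis tq : forall i, th (q ^+ i.+1) != 0.

Theorem sum_box_term a b c d e f : axis_regular a ->
  cleared a b -> cleared a c -> cleared a d -> cleared a e ->
  (forall i, th (a * q ^+ i.+1 / f) != 0) ->
  \sum_(y : {dffun forall j : 'I_n, 'I_(m j).+1}) box_term a b c d e f (fun j => y j) =
  box_factor a b c d e f * Phi th q cellw celllt a b c d e f [set: cell].
Proof.
move=> [taz ta] tb tc td te tf.
rewrite /Phi sum_stair; last by move=> I nI; rewrite kern_eq0 // !mul0r.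
rewrite mulr_sumr; apply: eq_bigr => y _.
have Ym j : (y j <= m j)%N by rewrite -ltnS.
rewrite !numer_stair // denom_stair // /box_term.
have q1 := expf_neq0 (size1 (fun j => y j)) q0.
have bkE := box_kernE Ym sep cosep tq taz ta.
rewrite -/(size1 (fun j => y j)) in bkE.
rewrite -[box_kern _ _](mulfK q1) bkE /box_factor.
have poch0 x k i : cleared a x -> poch (a * q / x * z k) i != 0.
  by move=> tx; apply: poch_neq0 => l _; have := tx k l; congr (th _ != 0); ring.
have prod0 x : cleared a x -> \prod_(p : cell) th (a * q * cellw p / x) != 0.
  by move=> tx; apply/prodf_neq0 => p _; apply: tx.
have af0 k : poch (a * q / f) k != 0.
  apply: poch_neq0 => i _; have := tf i.
  by congr (th _ != 0); rewrite exprS; ring.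
have -> : \prod_(k < n) (poch (f * z k) (y k)
       / (poch (a * q / b * z k) (y k) * poch (a * q / c * z k) (y k)
          * poch (a * q / d * z k) (y k) * poch (a * q / e * z k) (y k))) =
   \prod_(k < n) poch (f * z k) (y k) / (\prod_(k < n) poch (a * q / b * z k) (y k)
     * \prod_(k < n) poch (a * q / c * z k) (y k)
     * \prod_(k < n) poch (a * q / d * z k) (y k)
     * \prod_(k < n) poch (a * q / e * z k) (y k)) by rewrite -!big_split -prodf_div.
have P0 x : cleared a x -> \prod_(k < n) poch (a * q / x * z k) (y k) != 0.
  by move=> tx; apply/prodf_neq0 => k _; apply: poch0.
move: (P0 b tb) (P0 c tc) (P0 d td) (P0 e te) (prod0 b tb) (prod0 c tc) (prod0 d td) (prod0 e te).
move: (\prod_k poch (a * q / b * _) _) (\prod_k poch (a * q / c * _) _)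
  (\prod_k poch (a * q / d * _) _) (\prod_k poch (a * q / e * _) _)
  (\prod_p th (a * q * _ / b)) (\prod_p th (a * q * _ / c))
  (\prod_p th (a * q * _ / d)) (\prod_p th (a * q * _ / e)).
move=> p1 p2 p3 p4 s1 s2 s3 s4 n1 n2 n3 n4 n5 n6 n7 n8.
move: (\prod_p _) (\prod_k poch (f * _) _) (kern _ _ _ _ _ _ _) (af0 (size1 m))
  (af0 (size1 (fun j => y j))) => C Pf kn M1 M2.
by field; rewrite q1 n1 n2 n3 n4 n5 n6 n7 n8 M1 M2.
Qed.

Hypothesis th3 : weierstrass_identity th.

Theorem box_transform a b c d e f la :
  a != 0 -> b != 0 -> c != 0 -> d != 0 -> e != 0 -> f != 0 -> la != 0 ->
  a ^+ 3 * q ^+ 2 = b * c * d * e * f -> la * (b * c * f) = a ^+ 2 * q ->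
  axis_regular a -> axis_regular la ->
  cleared a b -> cleared a c -> cleared a d -> cleared a e ->
  cleared la d -> cleared la e -> cleared a (b * c) ->
  (forall i, th (a * q ^+ i.+1 / f) != 0) ->
  (forall j k i l s, th (a ^+ 2 * q ^+ s * (z j * q ^+ i * (z k * q ^+ l)) / (b * c)) != 0) ->
  (forall j k i l s, th (la * q ^+ s * (z j * q ^+ i * (z k * q ^+ l)) / a) != 0) ->
  \sum_(y : {dffun forall j : 'I_n, 'I_(m j).+1}) box_term a b c d e f (fun j => y j) =
  (\prod_(k < n)
     (poch (a * q * z k) (m k) * poch (z k / la) (m k)
      * poch (la * q * z k / d) (m k) * poch (la * q * z k / e) (m k)
      / (poch (la * q * z k) (m k) * poch (z k / a) (m k)
         * poch (a * q * z k / d) (m k) * poch (a * q * z k / e) (m k))))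
  * \sum_(y : {dffun forall j : 'I_n, 'I_(m j).+1})
      box_term la (la * b / a) (la * c / a) d e (la * f / a) (fun j => y j).
Proof.
move=> a0 b0 c0 d0 e0 f0 la0 bal laE ra rla tb tc td te tld tle tbc tf taa tla.
have lab x : x != 0 -> la * q / (la * x / a) = a * q / x.
  by move=> x0; field; rewrite a0 la0 x0.
have clab x : x != 0 -> cleared a x -> cleared la (la * x / a).
  move=> x0 tx j i; have := tx j i.
  by congr (th _ != 0); field; rewrite a0 la0 x0.
have tlf i : th (la * q ^+ i.+1 / (la * f / a)) != 0.
  by have := tf i; congr (th _ != 0); field; rewrite a0 la0 f0.
rewrite !sum_box_term //; [|exact: clab|exact: clab].
have nd : nondegenerate th q cellw a (b * c) [set: cell].
  split=> [p i _|p _|p p' i _ _ _].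
  - by have := (ra.1 (tag p) (i + tagged p)%N); congr (th _ != 0); rewrite exprD /cellw; ring.
  - exact: tbc.
  - exact: taa.
rewrite (@Phi_transform _ th th1 thV th3 q _ cellw celllt q0 cellw_neq0 celllt_irr
   celllt_tot a b c d e f la) //; first last.
- by move=> p p' i _ _ _; apply: tla.
- move=> p i _; have := (rla.1 (tag p) (i + tagged p)%N).
  by congr (th _ != 0); rewrite exprD /cellw; ring.
- by move=> p i _; have [_] := ra; apply.
- move=> p p' _ _ pp'; split; [apply: sep | apply: cosep].
  apply: contraNneq pp' => -[tE iE]; rewrite cell_eq; apply/andP; split; apply/eqP => //.
rewrite !(mulrAC la a^-1) [LHS]mulrA [RHS]mulrA; congr (_ * _).
rewrite /box_factor !lab // cardsT -prodr_const.
have tpoch x k : \prod_(0 <= i < m k) th (x * (z k * q ^+ i)) = poch (x * z k) (m k).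
  by apply: eq_bigr => i _; rewrite mulrA.
have tpochV x y k : \prod_(0 <= i < m k) th (x * (z k * q ^+ i) / y) = poch (x * z k / y) (m k).
  by apply: eq_bigr => i _; congr th; ring.
have -> : \prod_(k < n)
     (poch (a * q * z k) (m k) * poch (z k / la) (m k)
      * poch (la * q * z k / d) (m k) * poch (la * q * z k / e) (m k)
      / (poch (la * q * z k) (m k) * poch (z k / a) (m k)
         * poch (a * q * z k / d) (m k) * poch (a * q * z k / e) (m k))) =
  \prod_(p : cell) (th (a * q * cellw p) * th (cellw p / la) * th (la * q * cellw p / d)
     * th (la * q * cellw p / e) / (th (la * q * cellw p) * th (cellw p / a)
     * th (a * q * cellw p / d) * th (a * q * cellw p / e))).
  rewrite /cellw (prod_cell (fun j i => th (a * q * (z j * q ^+ i)) * th (z j * q ^+ i / la)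
     * th (la * q * (z j * q ^+ i) / d)
     * th (la * q * (z j * q ^+ i) / e) / (th (la * q * (z j * q ^+ i)) * th (z j * q ^+ i / a)
     * th (a * q * (z j * q ^+ i) / d) * th (a * q * (z j * q ^+ i) / e)))).
  apply: eq_bigr => k _; rewrite prodf_div !big_split /= !tpoch !tpochV.
  have tpochW y : \prod_(0 <= i < m k) th (z k * q ^+ i / y) = poch (z k / y) (m k).
    by apply: eq_bigr => i _; congr th; ring.
  by rewrite !tpochW.
have pf0 : poch (a * q / f) (size1 m) != 0.
  apply: poch_neq0 => i _; have := tf i.
  by congr (th _ != 0); rewrite exprS; ring.
have pb0 x y : cleared x y -> \prod_(p : cell) th (x * q * cellw p / y) != 0.
  by move=> tx; apply/prodf_neq0 => p _; apply: tx.
(* Holds cell by cell: inverting [a / w] and [la / w] by [thV] costs the factor [la / a], which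
   cancels the power [(a / la)^#|A|] of [Phi_transform]. *)
have key : \prod_(p : cell) (th (a * q * cellw p) / th (a / cellw p))
    * \prod_(p : cell) (a / la) * \prod_(p : cell) th (la * q * cellw p / d)
    * \prod_(p : cell) th (la * q * cellw p / e) =
  \prod_(p : cell) (th (a * q * cellw p) * th (cellw p / la) * th (la * q * cellw p / d)
     * th (la * q * cellw p / e) / (th (la * q * cellw p) * th (cellw p / a)
     * th (a * q * cellw p / d) * th (a * q * cellw p / e)))
  * \prod_(p : cell) (th (la * q * cellw p) / th (la / cellw p))
  * \prod_(p : cell) th (a * q * cellw p / d) * \prod_(p : cell) th (a * q * cellw p / e).
  rewrite -!big_split; apply: eq_bigr => p _ /=.
  have w0 := cellw_neq0 p.
  have n1 : th (la * q * cellw p) != 0.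
    have := rla.1 (tag p) (tagged p).+1; congr (th _ != 0).
    by rewrite exprS /cellw; ring.
  have inv x : x != 0 -> axis_regular x ->
      th (x / cellw p) = - th (cellw p / x) / (cellw p / x) /\ th (cellw p / x) != 0.
    move=> x0 [_ rx]; have n2 := rx (tag p) 0%N (tagged p).
    rewrite mulr1 -/(cellw p) in n2.
    have wx : cellw p / x != 0 by rewrite mulf_neq0 ?invr_eq0.
    have E : th (x / cellw p) = - th (cellw p / x) / (cellw p / x).
      by rewrite -(thV wx) invf_div.
    by split=> //; apply: contraNneq n2; rewrite E => ->; rewrite oppr0 mul0r.
  have [-> n2] := inv a a0 ra; have [-> n3] := inv la la0 rla.
  have n4 : th (a * q * cellw p / d) != 0 by apply: td.
  have n5 : th (a * q * cellw p / e) != 0 by apply: te.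
  by field; rewrite !oppr_eq0 n1 n2 n3 n4 n5 w0 a0 la0.
have := pb0 _ _ tb; have := pb0 _ _ tc; have := pb0 _ _ td; have := pb0 _ _ te.
have := pb0 _ _ tld; have := pb0 _ _ tle; move: key pf0.
have slab x : x != 0 -> \prod_(p : cell) th (la * q * cellw p / (la * x / a)) =
    \prod_(p : cell) th (a * q * cellw p / x).
  move=> x0; apply: eq_bigr => p _; congr th.
  by field; rewrite a0 la0 x0.
rewrite !slab //.
move: (\prod_(p : cell) th (la * q * _ / d)) (\prod_(p : cell) th (la * q * _ / e))
  (\prod_(p : cell) th (a * q * _ / b)) (\prod_(p : cell) th (a * q * _ / c))
  (\prod_(p : cell) th (a * q * _ / d)) (\prod_(p : cell) th (a * q * _ / e)) (poch _ _).
move: (\prod_(p : cell) (_ / _)) (\prod_(p : cell) (a / la))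
  (\prod_(p : cell) (th (a * q * _) / th (a / _)))
  (\prod_(p : cell) (th (la * q * _) / th (la / _))).
move=> x3 x1 x2 x4 x5 x6 x7 x8 x9 x10 x11 key n0 n6 n5 n10 n9 n8 n7.
have -> : x2 / (x11 * x7 * x8 * x9 * x10) * x1
    = x2 * x1 * x5 * x6 / (x11 * x7 * x8 * x9 * x10 * x5 * x6).
  by field; rewrite n0 n5 n6 n7 n8 n9 n10.
by rewrite key; field; rewrite n0 n5 n6 n7 n8 n9 n10.
Qed.
End Box.

Local Open Scope classical_set_scope.
Local Open Scope ring_scope.

(** * Limits of complex sequences *)

Section ComplexSequences.
Variable R : realType.
Implicit Types (x y z l : R[i]) (u v : nat -> R[i]) (f g : nat -> R).

(** The norm of [R[i]] has values in [R[i]]; taking its real part brings estimates into the ordered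
    field [R], within reach of [lra] and [nra]. *)
Definition cabs x : R := complex.Re `|x|.

Lemma cabsE x : `|x| = (cabs x)%:C%C. Proof. by []. Qed.
Lemma cabs_ge0 x : 0 <= cabs x. Proof. by rewrite -ler0c -cabsE. Qed.
Lemma cabs0 : cabs 0 = 0. Proof. by rewrite /cabs normr0. Qed.
Lemma cabs1 : cabs 1 = 1. Proof. by rewrite /cabs normr1. Qed.
Lemma cabs_eq0 x : (cabs x == 0) = (x == 0).
Proof. by rewrite -[RHS]normr_eq0 cabsE -(inj_eq (@complexI R)). Qed.
Lemma cabsM x y : cabs (x * y) = cabs x * cabs y.
Proof. by apply: complexI; rewrite rmorphM -!cabsE normrM. Qed.
Lemma cabsN x : cabs (- x) = cabs x. Proof. by rewrite /cabs normrN. Qed.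
Lemma cabsB x y : cabs (x - y) = cabs (y - x). Proof. by rewrite /cabs distrC. Qed.
Lemma cabsV x : cabs x^-1 = (cabs x)^-1.
Proof. by apply: complexI; rewrite fmorphV -!cabsE normfV. Qed.
Lemma cabsX x n : cabs (x ^+ n) = cabs x ^+ n.
Proof. by apply: complexI; rewrite rmorphXn -!cabsE normrX. Qed.
Lemma cabsXz x (n : int) : cabs (x ^ n) = cabs x ^ n.
Proof. by case: n => n; rewrite ?NegzE -?invr_expz ?cabsV -?exprnP ?cabsX. Qed.
Lemma cabsD x y : cabs (x + y) <= cabs x + cabs y.
Proof. by rewrite -lecR rmorphD -!cabsE ler_normD. Qed.
Lemma cabs_gt0 x : (0 < cabs x) = (x != 0).
Proof. by rewrite lt_neqAle cabs_ge0 andbT eq_sym cabs_eq0. Qed.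
Lemma cabs_ReIm x : cabs x <= `|complex.Re x| + `|complex.Im x|.
Proof.
rewrite {1}(complexE x); apply: le_trans (cabsD _ _) _.
have creal (t : R) : cabs t%:C%C = `|t| by rewrite /cabs normc_def /= expr0n /= addr0 sqrtr_sqr.
rewrite cabsM !creal lerD2l; suff -> : cabs 'i%C = 1 by rewrite mul1r.
by rewrite /cabs normc_def /= expr0n /= expr1n add0r sqrtr1.
Qed.

Lemma Re_le_cabs x : `|complex.Re x| <= cabs x.
Proof.
rewrite /cabs normc_def /= -[leLHS]sqrtr_sqr ler_wsqrtr //.
by rewrite lerDl sqr_ge0.
Qed.

Lemma Im_le_cabs x : `|complex.Im x| <= cabs x.
Proof.
rewrite /cabs normc_def /= -[leLHS]sqrtr_sqr ler_wsqrtr //.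
by rewrite lerDr sqr_ge0.
Qed.

(** One-sided, since it is applied to moduli and to upper bounds for them. *)
Definition null_seq f := forall e, 0 < e -> exists N, forall n, (N <= n)%N -> f n < e.

Lemma null_seq_le f g N : (forall n, (N <= n)%N -> f n <= g n) -> null_seq g -> null_seq f.
Proof.
move=> fg g0 e /g0[M gM]; exists (maxn N M) => n; rewrite geq_max => /andP[Nn Mn].
exact: le_lt_trans (fg _ Nn) (gM _ Mn).
Qed.

Lemma null_seqD f g : null_seq f -> null_seq g -> null_seq (fun n => f n + g n).
Proof.
move=> f0 g0 e e0; have e2 : 0 < e / 2 by lra.
have [[N fN] [M gM]] := (f0 _ e2, g0 _ e2).
exists (maxn N M) => n; rewrite geq_max => /andP[/fN ? /gM ?]; lra.
Qed.

Lemma null_seqZ c f : 0 <= c -> null_seq f -> null_seq (fun n => c * f n).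
Proof.
move=> c0 f0 e e0; have c1 : 0 < c + 1 by lra.
have [N fN] := f0 _ (divr_gt0 e0 c1).
exists N => n /fN; rewrite ltr_pdivlMr // => fe.
have [f0'|fpos] := leP (f n) 0; first by apply: le_lt_trans e0; rewrite mulr_ge0_le0.
nra.
Qed.

Lemma null_seq_geometric c r : 0 <= r < 1 -> null_seq (fun n => c * r ^+ n).
Proof.
move=> /andP[r0 r1] e e0.
have : (fun n : nat => c * r ^+ n) @ \oo --> (0 : R).
  by apply: (@cvg_geometric _ c r); rewrite ger0_norm.
move=> /cvgrPdist_lt/(_ _ e0)[N _ HN]; exists N => n Nn.
by have := HN n Nn; rewrite /= sub0r normrN; apply: le_lt_trans; rewrite ler_norm.
Qed.

Lemma null_seq_const c : null_seq (fun=> c) -> c <= 0.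
Proof.
move=> c0; rewrite leNgt; apply/negP => /c0[N /(_ N (leqnn N))].
by rewrite ltxx.
Qed.

Definition clim u l := null_seq (fun n => cabs (u n - l)).

Lemma clim_unique u l l' : clim u l -> clim u l' -> l = l'.
Proof.
move=> ul ul'; apply/eqP; rewrite -subr_eq0 -cabs_eq0 eq_le cabs_ge0 andbT.
apply: null_seq_const; apply: (null_seq_le (N := 0)) (null_seqD ul ul') => n _.
by rewrite (cabsB (u n) l) (le_trans _ (cabsD _ _)) // addrA subrK.
Qed.

Lemma clim_ext u v l N : (forall n, (N <= n)%N -> u n = v n) -> clim u l -> clim v l.
Proof. by move=> uv; apply: null_seq_le => n /uv ->; exact: lexx. Qed.

Lemma clim_cst l : clim (fun=> l) l.
Proof. by move=> e e0; exists 0%N => n _; rewrite subrr cabs0. Qed.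

Lemma climD u v l m : clim u l -> clim v m -> clim (fun n => u n + v n) (l + m).
Proof.
move=> ul vm; apply: (null_seq_le (N := 0)) (null_seqD ul vm) => n _.
by rewrite opprD addrACA cabsD.
Qed.

Lemma climN u l : clim u l -> clim (fun n => - u n) (- l).
Proof.
by move=> ul; apply: (null_seq_le (N := 0)) ul => n _; rewrite -opprD cabsN.
Qed.

Lemma clim_bounded u l : clim u l ->
  exists N, forall n, (N <= n)%N -> cabs (u n) <= cabs l + 1.
Proof.
move=> /(_ 1 ltr01)[N uN]; exists N => n /uN ul.
by rewrite -(subrK l (u n)) (le_trans (cabsD _ _)) // addrC lerD2l ltW.
Qed.

Lemma climM u v l m : clim u l -> clim v m -> clim (fun n => u n * v n) (l * m).
Proof.
move=> ul vm; have [N vN] := clim_bounded vm.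
have c1 : 0 <= cabs m + 1 by rewrite addr_ge0 ?cabs_ge0.
apply: (null_seq_le (N := N)) (null_seqD (null_seqZ c1 ul) (null_seqZ (cabs_ge0 l) vm)).
move=> n /vN vn; rewrite (_ : _ - _ = (u n - l) * v n + l * (v n - m)); last ring.
rewrite (le_trans (cabsD _ _)) // !cabsM lerD2r mulrC ler_wpM2r ?cabs_ge0 //.
Qed.

Lemma climV u l : l != 0 -> clim u l -> clim (fun n => (u n)^-1) l^-1.
Proof.
move=> l0 ul; have l1 : 0 < cabs l by rewrite cabs_gt0.
have [N uN] := ul _ (divr_gt0 l1 (ltr0n R 2 : 0 < 2%:R)).
have c0 : 0 <= 2 / (cabs l * cabs l) by rewrite divr_ge0 ?mulr_ge0 ?cabs_ge0.
apply: (null_seq_le (N := N)) (null_seqZ c0 ul) => n /uN un.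
have un2 : cabs l / 2 <= cabs (u n).
  have := cabsD (u n) (l - u n); rewrite addrCA subrr addr0 cabsB; lra.
have un0 : 0 < cabs (u n) by lra.
have u0 : u n != 0 by rewrite -cabs_gt0.
rewrite (_ : _ - _ = (l - u n) / (u n * l)); last by field; rewrite u0 l0.
rewrite !cabsM cabsV !cabsM cabsB mulrC ler_wpM2r ?cabs_ge0 //.
rewrite ler_pdivlMr ?mulr_gt0 // mulrC ler_pdivrMr ?mulr_gt0 //.
nra.
Qed.

Lemma clim_sum (I : Type) (s : seq I) (P : pred I) (u : I -> nat -> R[i]) (l : I -> R[i]) :
  (forall i, P i -> clim (u i) (l i)) ->
  clim (fun n => \sum_(i <- s | P i) u i n) (\sum_(i <- s | P i) l i).
Proof.
move=> ul; elim: s => [|i s IH].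
  by rewrite big_nil; apply: (clim_ext (N := 0) _ (clim_cst 0)) => n _; rewrite big_nil.
rewrite big_cons; case: ifPn => Pi.
  by apply: (clim_ext (N := 0) _ (climD (ul i Pi) IH)) => n _; rewrite big_cons Pi.
by apply: (clim_ext (N := 0) _ IH) => n _; rewrite big_cons (negPf Pi).
Qed.

Lemma clim_prod (I : Type) (s : seq I) (P : pred I) (u : I -> nat -> R[i]) (l : I -> R[i]) :
  (forall i, P i -> clim (u i) (l i)) ->
  clim (fun n => \prod_(i <- s | P i) u i n) (\prod_(i <- s | P i) l i).
Proof.
move=> ul; elim: s => [|i s IH].
  by rewrite big_nil; apply: (clim_ext (N := 0) _ (clim_cst 1)) => n _; rewrite big_nil.
rewrite big_cons; case: ifPn => Pi.
  by apply: (clim_ext (N := 0) _ (climM (ul i Pi) IH)) => n _; rewrite big_cons Pi.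
by apply: (clim_ext (N := 0) _ IH) => n _; rewrite big_cons (negPf Pi).
Qed.

Lemma climX u l k : clim u l -> clim (fun n => u n ^+ k) (l ^+ k).
Proof.
move=> ul; elim: k => [|k IH]; first exact: clim_cst.
by rewrite exprS; apply: (clim_ext (N := 0) _ (climM ul IH)) => n _; rewrite exprS.
Qed.

Lemma clim_le u l c : (exists N, forall n, (N <= n)%N -> cabs (u n) <= c) -> clim u l -> cabs l <= c.
Proof.
move=> [N uc] ul; rewrite -subr_le0; apply: null_seq_const.
apply: (null_seq_le (N := N)) ul => n /uc un.
by have := cabsD (u n) (l - u n); rewrite addrCA subrr addr0 cabsB; lra.
Qed.

Lemma clim_limn u l : clim u l -> limn (fun n => (u n : R[i]^o)) = l.
Proof.
move=> ul; apply: cvg_lim => //.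
apply/cvgrPdist_lt => e e0; have e1 : 0 < complex.Re e by move: e0; rewrite ltcE => /andP[].
have [N uN] := ul _ e1; exists N => // n /= Nn.
by rewrite cabsE cabsB; move: e0 (uN n Nn); rewrite !ltcE /= => /andP[/eqP -> _] ->; rewrite eqxx.
Qed.

(** The intervals with centre [f n] and radius [d n], the tail of the geometric series, are nested;
    the limit is the supremum of their left ends. The explicit rate later gives uniform
    convergence. *)
Lemma real_geometric_limit f D r : 0 <= r < 1 ->
  (forall n, `|f n.+1 - f n| <= D * r ^+ n) ->
  exists l : R, forall n, `|f n - l| <= D * r ^+ n / (1 - r).
Proof.
move=> /andP[r0 r1] fD; have r2 : 0 < 1 - r by lra.
pose d n := D * r ^+ n / (1 - r).
have dE n : d n - d n.+1 = D * r ^+ n by rewrite /d exprS; field; rewrite gt_eqF.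
have incr n k : f n - d n <= f (n + k)%N - d (n + k)%N.
  elim: k => [|k IH]; first by rewrite addn0.
  apply: le_trans IH _; rewrite addnS.
  by have := fD (n + k)%N; rewrite ler_norml => /andP[]; have := dE (n + k)%N; lra.
have decr n k : f (n + k)%N + d (n + k)%N <= f n + d n.
  elim: k => [|k IH]; first by rewrite addn0.
  apply: le_trans _ IH; rewrite addnS.
  by have := fD (n + k)%N; rewrite ler_norml => /andP[]; have := dE (n + k)%N; lra.
have D0 : 0 <= D by have := fD 0%N; rewrite expr0 mulr1; apply: le_trans.
have d0 n : 0 <= d n by rewrite /d divr_ge0 ?mulr_ge0 ?exprn_ge0 // ltW.
pose A := [set f n - d n | n in [set: nat]]%classic.
have ubA n : ubound A (f n + d n).
  move=> _ [k _ <-]; have := incr k n; have := decr n k; have := d0 (n + k)%N.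
  by rewrite (addnC k n); lra.
have nA : A !=set0 by exists (f 0%N - d 0%N), 0%N.
have hA : has_sup A by split=> //; exists (f 0%N + d 0%N).
exists (sup A) => n; rewrite -/(d n) ler_norml; apply/andP; split.
  by have := ge_sup nA (ubA n); lra.
have An : A (f n - d n) by exists n.
by have := sup_upper_bound hA An; lra.
Qed.

Lemma complex_geometric_limit u D r : 0 <= r < 1 ->
  (forall n, cabs (u n.+1 - u n) <= D * r ^+ n) ->
  exists l, forall n, cabs (u n - l) <= 2 * (D * r ^+ n / (1 - r)).
Proof.
move=> r01 uD.
have [|lr Hr] := @real_geometric_limit (fun n => complex.Re (u n)) D r r01.
  move=> n; apply: le_trans (uD n); apply: le_trans (Re_le_cabs _).
  by case: (u n.+1) (u n) => [? ?] [? ?].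
have [|li Hi] := @real_geometric_limit (fun n => complex.Im (u n)) D r r01.
  move=> n; apply: le_trans (uD n); apply: le_trans (Im_le_cabs _).
  by case: (u n.+1) (u n) => [? ?] [? ?].
exists (lr +i* li)%C => n; apply: le_trans (cabs_ReIm _) _.
by have := Hr n; have := Hi n; case: (u n) => a b /=; lra.
Qed.

End ComplexSequences.

(** * The infinite product *)

Section InfiniteProduct.
Variables (R : realType) (r : R).
Hypothesis r01 : 0 <= r < 1.

Definition partial_prod (F : nat -> R[i]) N := \prod_(0 <= j < N) F j.

Lemma prod_geometric_bound D N : 0 <= D ->
  \prod_(0 <= j < N) (1 + D * r ^+ j) <= expR (D / (1 - r)).
Proof.
move=> D0; have [r0 r1] := andP r01.
apply: (@le_trans _ _ (expR (\sum_(0 <= j < N) D * r ^+ j))).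
  elim: N => [|N IH]; first by rewrite !big_geq // expR0.
  rewrite !big_nat_recr //= expRD ler_pM ?expR_ge1Dx //.
    by apply: prodr_ge0 => j _; rewrite addr_ge0 ?mulr_ge0 ?exprn_ge0.
  by rewrite addr_ge0 ?mulr_ge0 ?exprn_ge0.
rewrite ler_expR.
have -> : \sum_(0 <= j < N) D * r ^+ j = D * (1 - r ^+ N) / (1 - r).
  elim: N => [|N IH]; first by rewrite big_geq // expr0 subrr mulr0 mul0r.
  by rewrite big_nat_recr //= IH exprS; field; rewrite subr_eq0 gt_eqF.
rewrite ler_wpM2r //; first by rewrite invr_ge0 subr_ge0 ltW.
by rewrite -[leRHS]mulr1 ler_wpM2l // gerBl exprn_ge0.
Qed.

(** The factor 2 comes from treating real and imaginary parts separately, the exponential bounds the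
    partial products. Only [D] enters, so the approximation is uniform over all products with this
    bound. *)
Definition prod_radius D := 2 * (expR (D / (1 - r)) * D / (1 - r)).

Section Bounds.
Variables (F : nat -> R[i]) (D : R).
Hypothesis FD : forall j, cabs (F j - 1) <= D * r ^+ j.

Let D0 : 0 <= D.
Proof. by have := FD 0; rewrite expr0 mulr1; apply: le_trans (cabs_ge0 _). Qed.

Lemma partial_prod_bound N : cabs (partial_prod F N) <= expR (D / (1 - r)).
Proof.
apply: le_trans (prod_geometric_bound N D0).
elim: N => [|N IH]; first by rewrite /partial_prod !big_geq // cabs1.
rewrite /partial_prod !big_nat_recr //= cabsM ler_pM ?cabs_ge0 //.
rewrite -(subrK 1 (F N)) addrC; apply: le_trans (cabsD _ _) _.
by rewrite cabs1 lerD2l FD.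
Qed.

Lemma partial_prod_limit : exists l, forall N,
  cabs (partial_prod F N - l) <= prod_radius D * r ^+ N.
Proof.
have step N : cabs (partial_prod F N.+1 - partial_prod F N)
    <= expR (D / (1 - r)) * D * r ^+ N.
  rewrite /partial_prod big_nat_recr //= -/(partial_prod F N).
  rewrite -{2}[partial_prod F N]mulr1 -mulrBr cabsM -mulrA ler_pM ?cabs_ge0 ?FD //.
  exact: partial_prod_bound.
have [l Hl] := complex_geometric_limit r01 step.
exists l => N; apply: le_trans (Hl N) _.
by rewrite le_eqVlt; apply/orP; left; apply/eqP; rewrite /prod_radius; ring.
Qed.

(** Past an index [J] with tail sum [T = D r^J / (1 - r) < 1/2], the inequality
    [(1 - x)(1 - y) >= 1 - x - y] keeps the partial products above half the modulus of the [J]-th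
    one, which is nonzero. *)
Lemma partial_prod_limit_neq0 l : (forall j, F j != 0) ->
  clim (partial_prod F) l -> l != 0.
Proof.
move=> fne Fl; have [r0 r1] := andP r01.
have [J HJ] := null_seq_geometric (D / (1 - r)) r01 (ltac:(lra) : 0 < 1 / 2 :> R).
have {HJ} HJ := HJ J (leqnn J).
have PJ : partial_prod F J != 0.
  by rewrite /partial_prod prodf_seq_neq0; apply/allP => j _; rewrite fne.
have r2 : 0 < 1 - r by lra.
pose T := D / (1 - r) * r ^+ J.
have T0 : 0 <= T by rewrite mulr_ge0 ?exprn_ge0 // divr_ge0 // ltW.
have T1 : T < 1 / 2 by [].
have TE : D * r ^+ J = T * (1 - r) by rewrite /T; field; rewrite gt_eqF.
clearbody T; clear HJ.
have low n : cabs (partial_prod F J) * (1 - T * (1 - r ^+ n)) <= cabs (partial_prod F (J + n)).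
  elim: n => [|n IH]; first by rewrite expr0 subrr mulr0 subr0 mulr1 addn0.
  rewrite addnS /partial_prod big_nat_recr //= -!/(partial_prod _ _) cabsM.
  have fb : 1 - D * r ^+ (J + n) <= cabs (F (J + n)).
    have := FD (J + n); have := cabsD (F (J + n)) (1 - F (J + n)).
    by rewrite addrCA subrr addr0 cabs1 (cabsB 1); lra.
  have dE : D * r ^+ (J + n) = T * r ^+ n * (1 - r).
    by rewrite exprD mulrA TE; ring.
  have rn : 0 <= r ^+ n <= 1 by rewrite exprn_ge0 // exprn_ile1 // ltW.
  apply: le_trans (ler_wpM2l (cabs_ge0 _) fb); rewrite dE exprS.
  have A0 := cabs_ge0 (partial_prod F J).
  have d0 : 0 <= T * r ^+ n <= 1 by apply/andP; split; nra.
  have d1 : 0 <= T * r ^+ n * (1 - r) <= 1 by apply/andP; split; nra.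
  apply: (@le_trans _ _ (cabs (partial_prod F J) * (1 - T * (1 - r ^+ n))
                         * (1 - T * r ^+ n * (1 - r)))).
    rewrite -mulrA ler_wpM2l //.
    have : 0 <= T * (1 - r ^+ n) * (T * r ^+ n * (1 - r)) by rewrite !mulr_ge0 //; lra.
    lra.
  by rewrite ler_wpM2r //; lra.
have half : cabs (partial_prod F J) / 2 <= cabs l.
  rewrite leNgt; apply/negP => lt.
  have e0 : 0 < cabs (partial_prod F J) / 2 - cabs l by rewrite subr_gt0.
  have [N /(_ (J + N)%N (leq_addl _ _))] := Fl _ e0.
  have := low N; have := cabsD (partial_prod F (J + N) - l) l.
  rewrite subrK; have rn : 0 <= r ^+ N <= 1 by rewrite exprn_ge0 // exprn_ile1 // ltW.
  have A0 := cabs_ge0 (partial_prod F J).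
  have : cabs (partial_prod F J) / 2 <= cabs (partial_prod F J) * (1 - T * (1 - r ^+ N)).
    by rewrite ler_wpM2l //; nra.
  lra.
by rewrite -cabs_gt0; have := PJ; rewrite -cabs_gt0; lra.
Qed.

End Bounds.
End InfiniteProduct.

(** * The theta function: inversion, continuity, zeros *)

Section Theta.
Variables (R : realType) (p : R[i]).
Hypothesis hp : `|p| < 1.

Let r := cabs p.

Lemma nome_range : 0 <= cabs p < 1.
Proof. by rewrite cabs_ge0; move: hp; rewrite cabsE ltcR. Qed.

Definition theta_factor (x : R[i]) j := (1 - p ^+ j * x) * (1 - p ^+ j.+1 / x).

Lemma theta_factor_bound x X j : cabs x + cabs x^-1 <= X ->
  cabs (theta_factor x j - 1) <= (X + 1) * r ^+ j.
Proof.
move=> xX; have [r0 r1] := andP nome_range; rewrite -/r in r0 r1.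
(* At 0 the inverse is 0 by convention and the factor equals 1. *)
have [x0|x0] := eqVneq x 0.
  rewrite /theta_factor x0 invr0 !mulr0 subr0 mulr1 subrr cabs0.
  rewrite mulr_ge0 ?exprn_ge0 // addr_ge0 //; apply: le_trans xX.
  by rewrite addr_ge0 ?cabs_ge0.
have -> : theta_factor x j - 1 = - (p ^+ j * x) - p ^+ j * (p * x^-1) + p ^+ j * p ^+ j.+1.
  by rewrite /theta_factor exprS; field.
have rj0 : 0 <= r ^+ j by rewrite exprn_ge0.
have rj1 : r ^+ j.+1 <= 1 by rewrite exprn_ile1 // ltW.
apply: le_trans (cabsD _ _) _; rewrite mulrDl mul1r; apply: lerD; last first.
  by rewrite cabsM !cabsX -/r -[leRHS]mulr1 ler_wpM2l.
apply: le_trans (cabsD _ _) _; rewrite !cabsN !cabsM cabsX -/r -mulrDr mulrC ler_wpM2r //.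
apply: le_trans xX; rewrite lerD2l -[leRHS]mul1r ler_wpM2r ?cabs_ge0 // ltW //.
Qed.

Lemma theta_approx x X N : cabs x + cabs x^-1 <= X ->
  cabs (partial_prod (theta_factor x) N - theta p x) <= prod_radius r (X + 1) * r ^+ N.
Proof.
move=> xX; have fX j := theta_factor_bound j xX.
have [l Hl] := partial_prod_limit nome_range fX.
suff -> : theta p x = l by [].
apply: clim_limn; have := null_seq_geometric (prod_radius r (X + 1)) nome_range.
by apply: (null_seq_le (N := 0%N)) => n _; apply: Hl.
Qed.

Lemma theta_clim x : clim (partial_prod (theta_factor x)) (theta p x).
Proof.
have := null_seq_geometric (prod_radius r (cabs x + cabs x^-1 + 1)) nome_range.
by apply: (null_seq_le (N := 0%N)) => n _; apply: theta_approx.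
Qed.

Lemma theta_1 : theta p 1 = 0.
Proof.
apply: (clim_unique (theta_clim 1)); apply: (clim_ext (N := 1) _ (clim_cst 0)) => -[//|n] _.
by rewrite /partial_prod big_nat_recl //= /theta_factor expr0 mulr1 subrr !mul0r.
Qed.

Lemma clim_nome_pow x : clim (fun N => 1 - p ^+ N * x) 1.
Proof.
have := null_seq_geometric (cabs x) nome_range; apply: (null_seq_le (N := 0%N)) => n _.
by rewrite addrC addKr cabsN cabsM cabsX mulrC.
Qed.

(** The partial products at [x] and at its inverse differ only in their first factors and in one
    boundary factor each, which tends to 1. *)
Lemma theta_inv x : x != 0 -> theta p x^-1 = - theta p x / x.
Proof.
move=> x0.
have E N : partial_prod (theta_factor x^-1) N * (1 - p ^+ N * x^-1) * x =
    - partial_prod (theta_factor x) N * (1 - p ^+ N * x).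
  rewrite /partial_prod; elim: N => [|N IH]; first by rewrite !big_geq // !expr0; field.
  rewrite !big_nat_recr //=; set u := \prod_(0 <= _ < N) _ in IH *.
  set v := \prod_(0 <= _ < N) _ in IH *.
  rewrite /theta_factor invrK.
  transitivity (u * (1 - p ^+ N * x^-1) * x * (1 - p ^+ N.+1 * x) * (1 - p ^+ N.+1 * x^-1)).
    by ring.
  by rewrite IH; ring.
have H1 := climM (climM (theta_clim x^-1) (clim_nome_pow x^-1)) (clim_cst x).
have H2 := climM (climN (theta_clim x)) (clim_nome_pow x).
have := clim_unique (clim_ext (N := 0%N) (fun n _ => E n) H1) H2.
by rewrite !mulr1 => <-; rewrite mulfK.
Qed.

(** Near [x] the quantity [|u| + |1/u|] stays below a fixed [X], so a single partial product
    approximates theta within [e / 3] at all the points concerned; that finite product is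
    continuous. *)
Lemma theta_continuous (u : nat -> R[i]) x : x != 0 -> clim u x ->
  clim (fun n => theta p (u n)) (theta p x).
Proof.
move=> x0 ux; have uVx := climV x0 ux.
pose X := (cabs x + 1) + (cabs x^-1 + 1).
have [[N1 b1] [N2 b2]] := (clim_bounded ux, clim_bounded uVx).
have xX : cabs x + cabs x^-1 <= X by rewrite /X; lra.
have uX n : (maxn N1 N2 <= n)%N -> cabs (u n) + cabs (u n)^-1 <= X.
  by rewrite geq_max => /andP[/b1 ? /b2 ?]; rewrite lerD.
move=> e e0; have e3 : 0 < e / 3 by lra.
have [M HM] := null_seq_geometric (prod_radius r (X + 1)) nome_range e3.
have {}HM := HM M (leqnn M).
have part : clim (fun n => partial_prod (theta_factor (u n)) M) (partial_prod (theta_factor x) M).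
  apply: clim_prod => j _; apply: climM; (apply: climD; first exact: clim_cst);
    apply: climN; apply: climM => //; exact: clim_cst.
have [N3 b3] := part _ e3.
exists (maxn (maxn N1 N2) N3) => n; rewrite geq_max => /andP[/uX un /b3 pn].
have A1 := theta_approx M un; have A2 := theta_approx M xX.
rewrite -/r in HM.
set P := partial_prod (theta_factor (u n)) M in pn A1.
set Q := partial_prod (theta_factor x) M in pn A2.
rewrite (_ : _ - _ = (theta p (u n) - P) + (P - Q) + (Q - theta p x)); last ring.
have := cabsD (theta p (u n) - P + (P - Q)) (Q - theta p x).
have := cabsD (theta p (u n) - P) (P - Q).
rewrite (cabsB (theta p (u n))); lra.
Qed.

(** A zero of the product must be a zero of a factor, by [partial_prod_limit_neq0], hence [p^-j] or
    [p^(j+1)]. *)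
Lemma theta_zero x : x != 0 -> theta p x = 0 -> exists k : int, x = p ^ k.
Proof.
move=> x0 tx0.
have [[j fj]|nz] := pselect (exists j, theta_factor x j = 0).
  move/eqP: fj; rewrite /theta_factor mulf_eq0 !subr_eq0 => /orP[] /eqP E.
    exists (- j%:Z); rewrite -invr_expz -exprnP.
    have pj : p ^+ j != 0 by apply: contra_eq_neq E => ->; rewrite mul0r oner_neq0.
    by apply: (mulfI pj); rewrite mulfV.
  by exists j.+1; rewrite -exprnP -[LHS]mul1r E divfK.
have fne j : theta_factor x j != 0 by apply/eqP => fj; apply: nz; exists j.
have := partial_prod_limit_neq0 nome_range (fun j => theta_factor_bound j (lexx _)) fne (theta_clim x).
by rewrite tx0 eqxx.
Qed.
End Theta.

(** * Bilateral sums *)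

Section BilateralSums.
Variable R : realType.
Implicit Types (f h : int -> R[i]) (D : R).

Definition zsum f N := \sum_(0 <= i < (N + N).+1) f (i%:Z - N%:Z).
Definition zlim f := limn (fun N => (zsum f N : R[i]^o)).
(** The ratio 1/2 is a convenient choice: the series below have Gaussian decay, which beats any
    geometric one ([gaussian_dominated]). *)
Definition dominated f D := forall k, cabs (f k) <= D * (1 / 2) ^+ `|k|%N.

Lemma zsumS f N : zsum f N.+1 = f (- N.+1%:Z) + zsum f N + f N.+1%:Z.
Proof.
rewrite /zsum addnS big_nat_recr //= big_nat_recl //= sub0r.
congr (_ + _ + f _); last by lia.
by apply: eq_bigr => i _; congr f; lia.
Qed.

Lemma zsum0 f : zsum f 0 = f 0.
Proof. by rewrite /zsum big_nat1 subr0. Qed.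

Lemma eq_zsum f h N : (forall k : int, (`|k| <= N)%N -> f k = h k) -> zsum f N = zsum h N.
Proof.
by move=> fh; apply: eq_big_nat => i /andP[_ iN]; apply: fh; lia.
Qed.

Lemma zsumZ c f N : zsum (fun k => c * f k) N = c * zsum f N.
Proof. by rewrite /zsum mulr_sumr. Qed.

Lemma zsumD f h N : zsum (fun k => f k + h k) N = zsum f N + zsum h N.
Proof. by rewrite /zsum big_split. Qed.

Lemma exchange_zsum (f : int -> int -> R[i]) M N :
  zsum (fun k => zsum (f k) N) M = zsum (fun l => zsum (f^~ l) M) N.
Proof. by rewrite /zsum exchange_big. Qed.

Lemma zsum_shift f N m : (`|m| <= N)%N ->
  (forall k : int, (N < `|k|)%N -> f k = 0) ->
  zsum (fun k => f (k - m)) (N + N) = zsum f N.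
Proof.
move=> mN f0; rewrite /zsum.
have [a aE] : exists a : nat, a%:Z = N%:Z + m by exists (absz (N%:Z + m)); lia.
rewrite (@big_cat_nat _ _ _ a) //=; last by lia.
rewrite big1_seq ?add0r; last first.
  by move=> i /=; rewrite mem_index_iota => /andP[_ ia]; apply: f0; lia.
rewrite (@big_cat_nat _ _ _ (a + (N + N).+1)%N) //=; [|lia|lia].
rewrite [X in _ + X]big1_seq ?addr0; last first.
  by move=> i /=; rewrite mem_index_iota => /andP[ai _]; apply: f0; lia.
rewrite (addnC a) -{1}[a]add0n big_addn addnK; apply: eq_bigr => i _; congr f; lia.
Qed.

Lemma zsum_pred f N : zsum (fun k => f (k - 1)) N = zsum f N + f (- N.+1%:Z) - f N%:Z.
Proof.
elim: N => [|N IH]; first by rewrite !zsum0; ring.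
rewrite !zsumS IH.
have -> : - N.+1%:Z - 1 = - N.+2%:Z by lia.
have -> : N.+1%:Z - 1 = N%:Z by lia.
ring.
Qed.

Lemma dominated_ge0 f D : dominated f D -> 0 <= D.
Proof. by move=> /(_ 0); rewrite expr0 mulr1; apply: le_trans (cabs_ge0 _). Qed.

Lemma zsum_tail f D M N : dominated f D -> (M <= N)%N ->
  cabs (zsum f N - zsum f M) <= 2 * D * ((1 / 2) ^+ M - (1 / 2) ^+ N).
Proof.
move=> fD /subnKC <-; elim: (N - M)%N => [|k IH].
  by rewrite addn0 !subrr cabs0 mulr0.
rewrite addnS zsumS (_ : _ - _ = (zsum f (M + k) - zsum f M) + (f (- (M + k).+1%:Z) + f (M + k).+1%:Z)); last ring.
apply: le_trans (cabsD _ _) _.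
have := cabsD (f (- (M + k).+1%:Z)) (f (M + k).+1%:Z).
have := fD (- (M + k).+1%:Z); have := fD (M + k).+1%:Z.
have -> : `|- (M + k).+1%:Z|%N = (M + k).+1 by lia.
have -> : `|(M + k).+1%:Z|%N = (M + k).+1 by lia.
by rewrite exprS; lra.
Qed.

Lemma zsum_bound f D N : dominated f D -> cabs (zsum f N) <= 3 * D.
Proof.
move=> fD; have := zsum_tail fD (leq0n N); have := fD 0.
have := cabsD (zsum f N - zsum f 0) (zsum f 0); rewrite subrK zsum0 !expr0.
have : 0 <= (1 / 2 : R) ^+ N by rewrite exprn_ge0 //; lra.
have D0 := dominated_ge0 fD; nra.
Qed.

Let half01 : 0 <= (1 / 2 : R) < 1. Proof. by apply/andP; split; lra. Qed.

Lemma zlim_bound f D N : dominated f D -> cabs (zsum f N - zlim f) <= 4 * D * (1 / 2) ^+ N.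
Proof.
move=> fD; have step k : cabs (zsum f k.+1 - zsum f k) <= D * (1 / 2) ^+ k.
  by have := zsum_tail fD (leqnSn k); rewrite exprS; lra.
have [l Hl] := complex_geometric_limit half01 step.
have lE k : cabs (zsum f k - l) <= 4 * D * (1 / 2) ^+ k.
  apply: le_trans (Hl k) _; rewrite le_eqVlt; apply/orP; left; apply/eqP.
  by field.
suff -> : zlim f = l by [].
apply: clim_limn; have := null_seq_geometric (4 * D) half01.
by apply: (null_seq_le (N := 0%N)) => k _; apply: lE.
Qed.

Lemma zlimP f D : dominated f D -> clim (zsum f) (zlim f).
Proof.
move=> fD; have := null_seq_geometric (4 * D) half01.
by apply: (null_seq_le (N := 0%N)) => k _; apply: zlim_bound.
Qed.

Lemma dominated_lim (f : nat -> int -> R[i]) h D :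
  (forall N, dominated (f N) D) -> (forall k, clim (f^~ k) (h k)) -> dominated h D.
Proof. by move=> fD fh k; apply: clim_le (fh k); exists 0%N => N _; apply: fD. Qed.

(** Tannery's theorem, with a range of summation that may grow with N: beyond a fixed cut-off M all
    tails are uniformly small, and below it the sum is finite. *)
Lemma zsum_dominated_convergence (f : nat -> int -> R[i]) h D (K : nat -> nat) :
  (forall N, (N <= K N)%N) -> (forall N, dominated (f N) D) ->
  (forall k, clim (f^~ k) (h k)) ->
  clim (fun N => zsum (f N) (K N)) (zlim h).
Proof.
move=> NK fD fh e e0; have hD := dominated_lim fD fh.
have e3 : 0 < e / 3 by lra.
have [M HM] := null_seq_geometric (4 * D) half01 e3; have {}HM := HM M (leqnn M).
have part : clim (fun N => zsum (f N) M) (zsum h M) by apply: clim_sum.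
have [N1 HN] := part _ e3; exists (maxn M N1) => N; rewrite geq_max => /andP[MN /HN fhM].
have := zsum_tail (fD N) (leq_trans MN (NK N)); have := zlim_bound M hD.
have : 0 <= (1 / 2 : R) ^+ K N by rewrite exprn_ge0 //; lra.
have : 0 <= (1 / 2 : R) ^+ M by rewrite exprn_ge0 //; lra.
have D0 := dominated_ge0 hD.
set A := zsum (f N) (K N); set B := zsum (f N) M in fhM *; set C := zsum h M in fhM *.
have := cabsD (A - B + (B - C)) (C - zlim h); have := cabsD (A - B) (B - C).
rewrite (_ : A - B + (B - C) + (C - zlim h) = A - zlim h); last ring.
nra.
Qed.

Lemma gaussian_dominated (rho Y d : R) : 0 <= rho < 1 -> 0 <= Y -> 0 < d ->
  exists D, forall k : nat, rho ^+ (k * k) * Y ^+ k <= D * d ^+ k.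
Proof.
move=> rho01 Y0 d0; have [r0 r1] := andP rho01.
have Yd0 : 0 <= Y / d by rewrite divr_ge0 // ltW.
have [k0 Hk0] := null_seq_geometric (Y / d) rho01 ltr01.
(* After division by [d^k] the left side is [(rho^k Y / d)^k], at most 1 once [k >= k0] and at most
   [(1 + Y / d)^k] before. *)
exists ((1 + Y / d) ^+ k0) => k.
have -> : Y ^+ k = (Y / d) ^+ k * d ^+ k by rewrite -exprMn divfK // gt_eqF.
rewrite mulrA ler_wpM2r //; first by rewrite exprn_ge0 // ltW.
rewrite exprM -exprMn.
have [kk|kk] := leqP k0 k.
  apply: (@le_trans _ _ 1); last by rewrite exprn_ege1 // lerDl.
  have x1 : rho ^+ k * (Y / d) <= 1 by rewrite mulrC ltW // Hk0.
  have x0 : 0 <= rho ^+ k * (Y / d) by rewrite mulr_ge0 // exprn_ge0.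
  exact: exprn_ile1.
apply: (@le_trans _ _ ((1 + Y / d) ^+ k)); last by rewrite ler_weXn2l ?lerDl // ltnW.
have rk : rho ^+ k <= 1 by rewrite exprn_ile1 // ltW.
have rk0 : 0 <= rho ^+ k by rewrite exprn_ge0.
by apply: lerXn2r; rewrite ?nnegrE; nra.
Qed.

End BilateralSums.

(** * The q-binomial theorem *)

Section GaussianBinomial.
Variables (R : realType) (p : R[i]).
Hypothesis hp : `|p| < 1.

Definition qfact n := partial_prod (fun j => 1 - p ^+ j.+1) n.

Lemma qfact_factor_neq0 j : 1 - p ^+ j.+1 != 0.
Proof.
have /andP[r0 r1] := nome_range hp.
rewrite subr_eq0; apply/eqP => E.
have : cabs p ^+ j.+1 < 1 by rewrite exprn_ilt1.
by rewrite -cabsX -E cabs1 ltxx.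
Qed.

Lemma qfactS n : qfact n.+1 = qfact n * (1 - p ^+ n.+1).
Proof. by rewrite /qfact /partial_prod big_nat_recr. Qed.

Lemma qfact0 : qfact 0 = 1. Proof. by rewrite /qfact /partial_prod big_geq. Qed.

Lemma qfact_neq0 n : qfact n != 0.
Proof.
by elim: n => [|n IH]; rewrite ?qfact0 ?oner_neq0 // qfactS mulf_neq0 ?qfact_factor_neq0.
Qed.

Definition qbinom n i := if (i <= n)%N then qfact n / (qfact i * qfact (n - i)) else 0.

Lemma qbinomS n i : (i <= n)%N ->
  qbinom n.+1 i.+1 = qbinom n i.+1 + p ^+ (n - i) * qbinom n i.
Proof.
move=> i_n; rewrite /qbinom ltnS i_n subSS.
have [n_i|i_n'] := leqP n i.
  have -> : i = n by apply/eqP; rewrite eqn_leq i_n n_i.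
  rewrite subnn qfact0 expr0 !mulr1 mul1r add0r !divff ?mulf_neq0 ?qfact_neq0 //.
have [b ->] : exists b, n = (i + b.+1)%N by exists (n - i.+1)%N; lia.
have -> : (i + b.+1 - i = b.+1)%N by lia.
have -> : (i + b.+1 - i.+1 = b)%N by lia.
rewrite !qfactS.
have -> : p ^+ (i + b.+1).+1 = p ^+ i.+1 * p ^+ b.+1 by rewrite -exprD addSn.
have := qfact_factor_neq0 i; have := qfact_factor_neq0 b.
move: (p ^+ i.+1) (p ^+ b.+1) => x y y0 x0.
by field; rewrite !qfact_neq0 x0 y0.
Qed.

Lemma qbinom0 n : qbinom n 0 = 1.
Proof. by rewrite /qbinom subn0 qfact0 mul1r divff // qfact_neq0. Qed.

Lemma qbinom_gt n i : (n < i)%N -> qbinom n i = 0.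
Proof. by rewrite ltnNge /qbinom => /negPf ->. Qed.

Lemma q_binomial_theorem n x :
  \prod_(0 <= j < n) (1 + p ^+ j * x) =
  \sum_(0 <= i < n.+1) p ^+ 'C(i, 2) * qbinom n i * x ^+ i.
Proof.
elim: n => [|n IH]; first by rewrite big_geq // big_nat1 bin0n qbinom0 !expr0 !mulr1.
rewrite big_nat_recr //= IH mulrDr mulr1.
rewrite [RHS]big_nat_recl // bin0n qbinom0 [X in X + _ = _]big_nat_recl // bin0n qbinom0.
rewrite -addrA; congr (_ + _).
have -> : \sum_(0 <= i < n) p ^+ 'C(i.+1, 2) * qbinom n i.+1 * x ^+ i.+1 =
   \sum_(0 <= i < n.+1) p ^+ 'C(i.+1, 2) * qbinom n i.+1 * x ^+ i.+1.
  by rewrite [RHS]big_nat_recr //= qbinom_gt // mulr0 mul0r addr0.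
rewrite mulr_suml -big_split; apply: eq_big_nat => i /andP[_ iN] /=.
rewrite qbinomS // binS bin1 (_ : p ^+ n = p ^+ i * p ^+ (n - i)); last by rewrite -exprD subnKC.
by rewrite exprD exprS; ring.
Qed.

Lemma qfact_limit : exists2 l, l != 0 & clim qfact l.
Proof.
have rr := nome_range hp.
have FD j : cabs ((1 - p ^+ j.+1) - 1) <= 1 * cabs p ^+ j.
  rewrite addrC addKr cabsN cabsX exprS ler_wpM2r ?exprn_ge0 ?cabs_ge0 //.
  by case/andP: rr => _ /ltW.
have [l Hl] := partial_prod_limit rr FD.
have Fl : clim qfact l.
  have := null_seq_geometric (prod_radius (cabs p) 1) rr.
  by apply: (null_seq_le (N := 0%N)) => n _; apply: Hl.
exists l => //; apply: (partial_prod_limit_neq0 rr FD _ Fl); exact: qfact_factor_neq0.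
Qed.

Definition cbinom N (k : int) := if (`|k| <= N)%N then qbinom (N + N) (absz (N%:Z + k)%R) else 0.

Lemma clim_subseq (u : nat -> R[i]) l (K : nat -> nat) :
  (forall M, exists N, forall n, (N <= n)%N -> (M <= K n)%N) -> clim u l -> clim (u \o K) l.
Proof.
move=> KM ul e /ul[M uM]; have [N NK] := KM M.
by exists N => n /NK /uM.
Qed.

(** The limit is [1 / (p; p)_oo] for every [k], so in the limit the central binomials become a
    common factor of all the Jacobi terms. *)
Lemma cbinom_limit : exists2 g, g != 0 & forall k, clim (cbinom^~ k) g.
Proof.
have [l l0 ql] := qfact_limit.
exists (l / (l * l)); first by rewrite !mulf_neq0 ?invr_neq0 ?mulf_neq0.
move=> k; pose u N := qfact (N + N) / (qfact (absz (N%:Z + k)%R) * qfact (N + N - (absz (N%:Z + k)%R))%N).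
apply: (clim_ext (u := u) (N := `|k|%N)).
  move=> N kN; rewrite /cbinom kN /qbinom /u; case: ifPn => //; lia.
apply: climM; first by apply: (clim_subseq (K := fun N => (N + N)%N)) ql => M; exists M => n; lia.
apply: climV; first by rewrite mulf_neq0.
apply: climM.
  by apply: (clim_subseq (K := fun N => (absz (N%:Z + k)%R))) ql => M; exists (M + `|k|)%N => n; lia.
by apply: (clim_subseq (K := fun N => (N + N - absz (N%:Z + k)%R)%N)) ql => M; exists (M + `|k|)%N => n; lia.
Qed.

Lemma clim_bounded_all (u : nat -> R[i]) l : clim u l -> exists B, forall n, cabs (u n) <= B.
Proof.
move=> /clim_bounded[N uN]; exists (\sum_(0 <= i < N) cabs (u i) + (cabs l + 1)) => n.
have S0 (r : seq nat) : 0 <= \sum_(i <- r) cabs (u i) by apply: sumr_ge0 => i _; apply: cabs_ge0.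
have [Nn|nN] := leqP N n; first by apply: le_trans (uN _ Nn) _; rewrite lerDr.
rewrite (bigD1_seq n) ?iota_uniq ?mem_index_iota //= -addrA lerDl.
by rewrite addr_ge0 ?sumr_ge0 ?addr_ge0 ?cabs_ge0 // => i _; apply: cabs_ge0.
Qed.

Lemma cbinom_bounded : exists B, forall N k, cabs (cbinom N k) <= B.
Proof.
have [l l0 ql] := qfact_limit.
have [B1 HB1] := clim_bounded_all ql; have [B2 HB2] := clim_bounded_all (climV l0 ql).
have B10 : 0 <= B1 by apply: le_trans (cabs_ge0 _) (HB1 0).
have B20 : 0 <= B2 by apply: le_trans (cabs_ge0 _) (HB2 0).
exists (B1 * (B2 * B2)) => N k; rewrite /cbinom /qbinom.
have pos : 0 <= B1 * (B2 * B2) by rewrite !mulr_ge0.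
case: ifP => _; last by rewrite cabs0.
case: ifP => _; last by rewrite cabs0.
by rewrite invfM !cabsM ler_pM ?mulr_ge0 ?cabs_ge0 // ler_pM ?cabs_ge0.
Qed.

End GaussianBinomial.

(** * The three-term identity *)

Lemma absz_double_sub (m s : int) : (`|m| <= absz (2 * m - s)%R + `|s|)%N.
Proof. lia. Qed.

Lemma int_parity_ge0 (s : int) : 0 <= s ->
  s = (if odd `|s|%N then 1 else 0) + 2 * (`|s|./2)%:Z.
Proof. case: ifP => os; lia. Qed.

Lemma int_parity_lt0 (s : int) : s < 0 ->
  s + 2 * (uphalf `|s|)%:Z = if odd `|s|%N then 1 else 0.
Proof. case: ifP => os; lia. Qed.

Lemma absz_sqr (k : int) : k * k = (`|k| * `|k|)%N :> int.
Proof. lia. Qed.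

Section RankTwo.
Variables (R : realType) (t : R[i]).
Hypothesis t0 : t != 0.
Let p := t ^+ 4.
Hypothesis hp : `|p| < 1.

Let p0 : p != 0. Proof. by rewrite expf_neq0. Qed.

(** The term [(-1)^k p^(k(k-1)/2) x^k] of the triple product. The fourth root [t] of [p] keeps the
    exponents integral when the quadratic form is split in [jacobi_term_mul]. *)
Definition jacobi_term (x : R[i]) (k : int) : R[i] :=
  (-1) ^ k * t ^ (2 * (k * k)) * (x / t ^+ 2) ^ k.

Let m10 : (-1 : R[i]) != 0. Proof. by rewrite oppr_eq0 oner_eq0. Qed.

Lemma jacobi_termS x k : x != 0 ->
  jacobi_term x (k + 1) = - (p ^ k * x) * jacobi_term x k.
Proof.
move=> x0; have xt : x / t ^+ 2 != 0 by rewrite mulf_neq0 ?invr_eq0 ?expf_neq0.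
rewrite /jacobi_term !expfzDr // !expr1z.
have -> : 2 * ((k + 1) * (k + 1)) = 2 * (k * k) + 4%:Z * k + 2%:Z :> int by ring.
have -> : p ^ k = t ^ (4%:Z * k) by rewrite /p exprnP exprz_exp.
rewrite !expfzDr // -[t ^ 2%:Z]exprnP.
by field.
Qed.

(** A finite form of the Jacobi triple product: the q-binomial theorem for [2 N] factors at
    [- x / p^N], recentred at [N]. The constant [c N] arises from inverting the first [N]
    factors. *)
Lemma theta_partial_expansion x N : x != 0 ->
  partial_prod (theta_factor p x) N = zsum (fun k => cbinom p N k * jacobi_term x k) N.
Proof.
move=> x0; pose c M := \prod_(0 <= j < M) (- (x / p ^+ j.+1)).
have c0 : c N != 0.
  rewrite /c prodf_seq_neq0; apply/allP => j _.
  by rewrite oppr_eq0 mulf_neq0 ?invr_eq0 ?expf_neq0.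
have cE : c N * jacobi_term x (- N%:Z) = 1.
  rewrite /c; elim: (N) => [|M IH]; first by rewrite big_geq // /jacobi_term oppr0 !expr0z !mul1r.
  rewrite big_nat_recr //= -[RHS]IH -mulrA; congr (_ * _).
  have -> : - M%:Z = - M.+1%:Z + 1 :> int by lia.
  by rewrite jacobi_termS // -exprnN; field; rewrite expf_neq0.
have termE i : p ^+ 'C(i, 2) * (- (x / p ^+ N)) ^+ i = c N * jacobi_term x (i%:Z - N%:Z).
  elim: i => [|i IH]; first by rewrite bin0n !expr0 mulr1 sub0r cE.
  rewrite binS bin1 exprD exprS [RHS](_ : _ = - (p ^ (i%:Z - N%:Z) * x) * (c N * jacobi_term x (i%:Z - N%:Z))).
    by rewrite -IH expfzDr // -exprnP -exprnN; field; rewrite expf_neq0.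
  have -> : i.+1%:Z - N%:Z = i%:Z - N%:Z + 1 :> int by lia.
  by rewrite jacobi_termS //; ring.
apply: (mulfI c0).
have -> : c N * partial_prod (theta_factor p x) N =
    \prod_(0 <= j < N + N) (1 + p ^+ j * (- (x / p ^+ N))).
  have shift (F : nat -> R[i]) : \prod_(N <= j < N + N) F j = \prod_(0 <= j < N) F (j + N)%N.
    by rewrite -{1}[N]add0n big_addn addnK.
  rewrite (@big_cat_nat _ _ _ N) //= ?leq_addr // shift.
  rewrite [X in _ = X * _]big_nat_rev add0n /= /c /partial_prod -!big_split.
  apply: eq_big_nat => j /andP[_ jN] /=.
  have -> : p ^+ N = p ^+ j.+1 * p ^+ (N - j.+1) by rewrite -exprD subnKC.
  rewrite /theta_factor exprD (_ : p ^+ N = p ^+ j.+1 * p ^+ (N - j.+1)); last by rewrite -exprD subnKC.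
  by rewrite exprS; field; rewrite p0 x0 !expf_neq0.
rewrite q_binomial_theorem // /zsum mulr_sumr; apply: eq_big_nat => i /andP[_ iN].
rewrite mulrAC termE /cbinom; case: ifPn => [_|]; last by lia.
have -> : (absz (N%:Z + (i%:Z - N%:Z))%R) = i by lia.
by ring.
Qed.

Definition rank_row x (s : int) : R[i] := (-1) ^ s * t ^ (s * s) * (x / t ^+ 2) ^ s.
Definition rank_col y (d : int) : R[i] := t ^ (d * d) * y ^ d.

(** With [n = s - m], the identity [2 m^2 + 2 n^2 = (m + n)^2 + (m - n)^2] separates the variables:
    [x] goes with [m + n = s] and [y] with [m - n = 2 m - s]. *)
Lemma jacobi_term_mul x y m s : x != 0 -> y != 0 ->
  jacobi_term (x * y) m * jacobi_term (x / y) (s - m) =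
  rank_row x s * rank_col y (2 * m - s).
Proof.
move=> x0 y0; rewrite /jacobi_term /rank_row /rank_col.
have xt : x / t ^+ 2 != 0 by rewrite mulf_neq0 ?invr_eq0 ?expf_neq0.
have -> : x * y / t ^+ 2 = (x / t ^+ 2) * y by rewrite mulrAC.
have -> : x / y / t ^+ 2 = (x / t ^+ 2) * y^-1 by rewrite mulrAC.
transitivity (((-1) ^ m * (-1) ^ (s - m)) * (t ^ (2 * (m * m)) * t ^ (2 * ((s - m) * (s - m))))
  * ((x / t ^+ 2) ^ m * (x / t ^+ 2) ^ (s - m)) * (y ^ m * y^-1 ^ (s - m))).
  by rewrite (expfzMl (x / t ^+ 2) y) (expfzMl (x / t ^+ 2) y^-1); ring.
rewrite (exprz_inv y) -(expfzDr m (s - m) m10) -(expfzDr (2 * (m * m)) _ t0).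
rewrite -(expfzDr m (s - m) xt) -(expfzDr m _ y0).
have -> : 2 * (m * m) + 2 * ((s - m) * (s - m)) = s * s + (2 * m - s) * (2 * m - s) :> int by ring.
have -> : m + (s - m) = s :> int by ring.
have -> : m + - (s - m) = 2 * m - s :> int by ring.
by rewrite (expfzDr _ _ t0) !mulrA [X in X * _ = _]mulrAC.
Qed.

Lemma theta_product_expansion x y N : x != 0 -> y != 0 ->
  partial_prod (theta_factor p (x * y)) N * partial_prod (theta_factor p (x / y)) N =
  zsum (fun s => rank_row x s * zsum (fun m =>
     cbinom p N m * cbinom p N (s - m) * rank_col y (2 * m - s)) N) (N + N).
Proof.
move=> x0 y0; rewrite !theta_partial_expansion ?mulf_neq0 ?invr_eq0 //.
pose f m n := cbinom p N m * jacobi_term (x * y) m * (cbinom p N n * jacobi_term (x / y) n).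
transitivity (zsum (fun m => zsum (f m) N) N).
  by rewrite mulrC -zsumZ; apply: eq_zsum => m _; rewrite /f zsumZ mulrC.
transitivity (zsum (fun m => zsum (fun s => f m (s - m)) (N + N)) N).
  apply: eq_zsum => m mN; rewrite zsum_shift // => k Nk.
  by rewrite /f {2}/cbinom leqNgt Nk mul0r mulr0.
rewrite exchange_zsum; apply: eq_zsum => s _; rewrite -zsumZ; apply: eq_zsum => m _.
rewrite /f; transitivity (cbinom p N m * cbinom p N (s - m)
   * (jacobi_term (x * y) m * jacobi_term (x / y) (s - m))); first by ring.
by rewrite jacobi_term_mul //; ring.
Qed.

Let rho01 : 0 <= cabs t < 1.
Proof.
rewrite cabs_ge0 ltNge; apply/negP => t1.
by have := nome_range hp; rewrite cabsX ltNge exprn_ege1 ?andbF.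
Qed.

Lemma exprz_le_sum (v : R) (k : int) : 0 < v -> v ^ k <= (v + v^-1) ^+ `|k|%N.
Proof.
move=> v0; have iv : 0 < v^-1 by rewrite invr_gt0.
case: k => k; first by rewrite -exprnP absz_nat; apply: lerXn2r; rewrite ?nnegrE; lra.
by rewrite NegzE abszN absz_nat -exprnN -exprVn; apply: lerXn2r; rewrite ?nnegrE; lra.
Qed.

Lemma rank_dominated (y : R[i]) (d : R) : y != 0 -> 0 < d -> exists D, forall k : int,
  cabs (t ^ (k * k) * y ^ k) <= D * d ^+ `|k|%N.
Proof.
move=> y0 d0; have v0 : 0 < cabs y by rewrite cabs_gt0.
have Y0 : 0 <= cabs y + (cabs y)^-1 by rewrite addr_ge0 ?invr_ge0 // ltW.
have [D HD] := gaussian_dominated rho01 Y0 d0.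
exists D => k; apply: le_trans (HD `|k|%N).
rewrite cabsM !cabsXz absz_sqr.
rewrite -exprnP ler_wpM2l ?exprn_ge0 ?cabs_ge0 //.
exact: exprz_le_sum.
Qed.

(** Summing first over [m] leaves [h y s], a series in [2 m - s], whose value depends only on the
    parity of [s]. The double series therefore splits into two products, one for each parity. *)
Lemma jacobi_rank2 : exists f1 f2 g1 g2 : R[i] -> R[i], forall x y, x != 0 -> y != 0 ->
  theta p (x * y) * theta p (x / y) = f1 x * g1 y + f2 x * g2 y.
Proof.
have [g gn0 glim] := cbinom_limit hp; have [B HB] := cbinom_bounded hp.
have B0 : 0 <= B by apply: le_trans (cabs_ge0 _) (HB 0%N 0).
pose h y s m := g * g * rank_col y (2 * m - s).
pose row (e : bool) x s := if odd `|s|%N == e then rank_row x s else 0.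
exists (fun x => zlim (row false x)), (fun x => zlim (row true x)),
  (fun y => zlim (h y 0)), (fun y => zlim (h y 1)) => x y x0 y0.
have h2 : 0 < 1 / 2 :> R by lra.
(* The bound for the inner sum grows like [2^|s|], because [|m| <= |2 m - s| + |s|]; rows decaying
   like [4^-|s|] leave the ratio 1/2 required by [dominated]. *)
have h4 : 0 < 1 / 4 :> R by lra.
have [Db HDb] := rank_dominated y0 h2.
have xt : x / t ^+ 2 != 0 by rewrite mulf_neq0 ?invr_eq0 ?expf_neq0.
have [Da HDa] := rank_dominated xt h4.
have Db0 : 0 <= Db by have := HDb 0; rewrite expr0 mulr1; apply: le_trans (cabs_ge0 _).
have Da0 : 0 <= Da by have := HDa 0; rewrite expr0 mulr1; apply: le_trans (cabs_ge0 _).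
have rowE s : cabs (rank_row x s) <= Da * (1 / 4) ^+ `|s|%N.
  apply: le_trans (HDa s); rewrite /rank_row -mulrA cabsM cabsXz cabsN cabs1 exp1rz mul1r.
  exact: lexx.
have colE s m : cabs (rank_col y (2 * m - s)) <= Db * 2 ^+ `|s|%N * (1 / 2) ^+ `|m|%N.
  apply: le_trans (HDb _) _; rewrite -mulrA ler_wpM2l //.
  have ms := absz_double_sub m s.
  have -> : (2 : R) ^+ `|s|%N = ((1 / 2) ^+ `|s|%N)^-1 by rewrite -exprVn invf_div divr1.
  rewrite ler_pdivlMl ?exprn_gt0 // -exprD addnC.
  by apply: ler_wiXn2l => //; lra.
pose inner N s m := cbinom p N m * cbinom p N (s - m) * rank_col y (2 * m - s).
have innerD s N : dominated (inner N s) (B * B * Db * 2 ^+ `|s|%N).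
  move=> m; rewrite /inner cabsM [cabs (_ * cbinom _ _ _)]cabsM.
  have bb : cabs (cbinom p N m) * cabs (cbinom p N (s - m)) <= B * B.
    by apply: ler_pM; rewrite ?cabs_ge0.
  apply: le_trans (ler_pM _ (cabs_ge0 _) bb (colE s m)) _.
    by rewrite mulr_ge0 ?cabs_ge0.
  by rewrite !mulrA.
have innerL s : clim (fun N => zsum (inner N s) N) (zlim (h y s)).
  apply: (zsum_dominated_convergence (K := id) _ (innerD s)) => // m.
  by apply: climM (clim_cst _); apply: climM; apply: glim.
have hD s : dominated (h y s) (B * B * Db * 2 ^+ `|s|%N).
  apply: (dominated_lim (innerD s)) => m.
  by apply: climM (clim_cst _); apply: climM; apply: glim.
(* Replacing [s] by [s + 2] shifts [m] by one, which changes symmetric partial sums only by boundary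
   terms. *)
have hper s : zlim (h y (s + 2)) = zlim (h y s).
  have H1 := zlimP (hD (s + 2)).
  have H2 : clim (zsum (h y (s + 2))) (zlim (h y s)).
    have small : clim (fun N => h y s (- N.+1%:Z) - h y s N%:Z) 0.
      have rr : 0 <= (1 / 2 : R) < 1 by apply/andP; split; lra.
      have := null_seq_geometric (2 * (B * B * Db * 2 ^+ `|s|%N)) rr.
      apply: (null_seq_le (N := 0%N)) => N _; rewrite subr0.
      have := hD s (- N.+1%:Z); have := hD s N%:Z; rewrite abszN !absz_nat exprS.
      have := cabsD (h y s (- N.+1%:Z)) (- h y s N%:Z); rewrite cabsN.
      have : 0 <= B * B * Db * 2 ^+ `|s|%N * (1 / 2) ^+ N by rewrite !mulr_ge0 ?exprn_ge0.
      lra.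
    have := climD (zlimP (hD s)) small; rewrite addr0; apply: (clim_ext (N := 0%N)) => N _.
    rewrite addrA -zsum_pred; apply: eq_zsum => m _; rewrite /h; congr (_ * rank_col _ _); ring.
  exact: clim_unique H1 H2.
have hpar s : zlim (h y s) = zlim (h y (if odd `|s|%N then 1 else 0)).
  have up (k : nat) u : zlim (h y (u + 2 * k%:Z)) = zlim (h y u).
    elim: k => [|k IH]; first by rewrite mulr0 addr0.
    rewrite -[RHS]IH -[RHS]hper; congr (zlim (h y _)).
    by rewrite intS; ring.
  set e : int := if _ then _ else _.
  have [s0|s0] := leP 0 s.
    by rewrite [in LHS](int_parity_ge0 s0); apply: up.
  by rewrite -(up (uphalf `|s|) s); congr (zlim (h y _)); apply: int_parity_lt0.
have lim1 : clim (fun N => partial_prod (theta_factor p (x * y)) N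
     * partial_prod (theta_factor p (x / y)) N)
   (zlim (fun s => rank_row x s * zlim (h y s))).
  apply: (clim_ext (N := 0%N) (fun N _ => esym (theta_product_expansion N x0 y0))).
  apply: (zsum_dominated_convergence (K := fun N => (N + N)%N)
     (D := 3 * (B * B * Db) * Da)) => [N|N s|s]; first exact: leq_addr.
    rewrite cabsM; have := zsum_bound N (innerD s N) => zb.
    apply: le_trans (ler_pM (cabs_ge0 _) (cabs_ge0 _) (rowE s) zb) _.
    have -> : (1 / 2 : R) ^+ `|s|%N = (1 / 4) ^+ `|s|%N * 2 ^+ `|s|%N.
      by rewrite -exprMn; congr (_ ^+ _); lra.
    by rewrite le_eqVlt; apply/orP; left; apply/eqP; ring.
  by apply: climM (clim_cst _) (innerL s).
have lim2 := climM (theta_clim hp (x * y)) (theta_clim hp (x / y)).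
rewrite (clim_unique lim2 lim1).
have rowD e : dominated (row e x) Da.
  move=> s; rewrite /row; have q4 : (1 / 4 : R) ^+ `|s|%N <= (1 / 2) ^+ `|s|%N.
    by apply: lerXn2r; rewrite ?nnegrE; lra.
  have : Da * (1 / 4) ^+ `|s|%N <= Da * (1 / 2) ^+ `|s|%N by rewrite ler_wpM2l.
  case: ifP => _; first by apply: le_trans (rowE s).
  by rewrite cabs0 => _; rewrite mulr_ge0 ?exprn_ge0 //; lra.
have lim3 := climD (climM (zlimP (rowD false)) (clim_cst (zlim (h y 0))))
   (climM (zlimP (rowD true)) (clim_cst (zlim (h y 1)))).
apply: clim_limn; apply: (clim_ext (N := 0%N)) lim3 => N _.
rewrite ![zsum (row _ _) N * _]mulrC -!zsumZ -zsumD; apply: eq_zsum => s _.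
by rewrite (hpar s) /row; case: (odd _) => /=; ring.
Qed.

End RankTwo.

Section Weierstrass.
Variables (R : realType) (p : R[i]).
Hypothesis hp : `|p| < 1.

(** For [p = 0] there is no nonzero fourth root, but [(1 - x y)(1 - x / y) = 1 + x^2 - x (y + 1 /
    y)] shows the rank directly. *)
Lemma theta_rank2 : exists f1 f2 g1 g2 : R[i] -> R[i], forall x y, x != 0 -> y != 0 ->
  theta p (x * y) * theta p (x / y) = f1 x * g1 y + f2 x * g2 y.
Proof.
have [p0|p0] := eqVneq p 0; last first.
  pose t := sqrtc (sqrtc p).
  have tE : t ^+ 4 = p by rewrite (exprM t 2 2) !sqr_sqrtc.
  have t0 : t != 0 by apply: contra_neq p0 => t0; rewrite -tE t0 expr0n.
  by rewrite -tE; apply: jacobi_rank2; rewrite ?tE.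
have thE x : theta p x = 1 - x.
  apply: (clim_unique (theta_clim hp x)); apply: (clim_ext (N := 1%N)) (clim_cst _) => -[//|n] _.
  rewrite /partial_prod big_nat_recl // big1 ?mulr1 /theta_factor p0.
    by rewrite expr0 mul1r expr1 mul0r subr0 mulr1.
  by move=> j _; rewrite !exprS !mul0r !subr0 mulr1.
exists (fun x => 1 + x ^+ 2), (fun x => - x), (fun=> 1), (fun y => y + y^-1) => x y x0 y0.
by rewrite !thE; field.
Qed.

(** With [k^2 = K], [even_theta K b z] is [theta(X Y) theta(X / Y)] at [X = b k], [Y = z / k], hence
    a matrix of rank two in [b] and [z]; its 3 by 3 minors vanish. *)
Theorem theta_weierstrass : weierstrass_identity (theta p).
Proof.
move=> K al x x0 x1 K0 al0 nx nx0 nx1 d0.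
have [f1 [f2 [g1 [g2 rk]]]] := theta_rank2.
pose k := sqrtc K; have kE : k * k = K by rewrite -expr2 sqr_sqrtc.
have k0 : k != 0 by apply: contra_neq K0 => k0; rewrite -kE k0 mul0r.
have evE b z : b != 0 -> z != 0 -> even_theta (theta p) K b z =
    f1 (b * k) * g1 (z / k) + f2 (b * k) * g2 (z / k).
  move=> b0 z0; rewrite -rk ?mulf_neq0 ?invr_eq0 // /even_theta -kE.
  by congr (theta p _ * theta p _); field; rewrite ?k0 ?z0.
have U0 : even_theta (theta p) K x0^-1 x0 = 0 by rewrite /even_theta mulVf // theta_1 // mul0r.
have V1 : even_theta (theta p) K x1^-1 x1 = 0 by rewrite /even_theta mulVf // theta_1 // mul0r.
have UV : even_theta (theta p) K x0^-1 x1 = - (x1 / x0) * even_theta (theta p) K x1^-1 x0.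
  rewrite /even_theta (_ : x0^-1 * x1 = (x1^-1 * x0)^-1); last by rewrite invfM invrK mulrC.
  rewrite theta_inv ?mulf_neq0 ?invr_eq0 // (_ : x0^-1 * (K / x1) = x1^-1 * (K / x0)).
    by field; rewrite nx0 nx1.
  by field; rewrite nx0 nx1.
have UN : even_theta (theta p) K x0^-1 x1 != 0.
  by rewrite UV mulf_neq0 // oppr_eq0 mulf_neq0 ?invr_eq0.
apply: (mulfI UN).
transitivity (even_theta (theta p) K al x0 * even_theta (theta p) K x0^-1 x1
    * even_theta (theta p) K x1^-1 x
  + even_theta (theta p) K x1^-1 x0 * even_theta (theta p) K al x1
    * even_theta (theta p) K x0^-1 x); last first.
  by rewrite UV; field; rewrite nx0 nx1.
have iv z : z != 0 -> z^-1 != 0 by rewrite invr_eq0.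
move: U0 V1; rewrite !evE ?iv //.
move: (f1 (x0^-1 * k)) (f2 (x0^-1 * k)) (f1 (x1^-1 * k)) (f2 (x1^-1 * k)).
move: (f1 (al * k)) (f2 (al * k)) (g1 (x / k)) (g2 (x / k)) (g1 (x0 / k)) (g2 (x0 / k)).
move: (g1 (x1 / k)) (g2 (x1 / k)) => G1 H1 a1 a2 G H G0 H0 u1 u2 v1 v2 U0 V1.
(* The minor with rows [alpha], [x1^-1], [x0^-1] and columns [x], [x0], [x1], expanded along the
   column of [x]. Two of the other entries vanish by [U0] and [V1]. *)
have E : (a1 * G + a2 * H) * ((v1 * G0 + v2 * H0) * (u1 * G1 + u2 * H1) - (v1 * G1 + v2 * H1) * (u1 * G0 + u2 * H0))
  - (v1 * G + v2 * H) * ((a1 * G0 + a2 * H0) * (u1 * G1 + u2 * H1) - (a1 * G1 + a2 * H1) * (u1 * G0 + u2 * H0))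
  + (u1 * G + u2 * H) * ((a1 * G0 + a2 * H0) * (v1 * G1 + v2 * H1) - (a1 * G1 + a2 * H1) * (v1 * G0 + v2 * H0)) = 0.
  by ring.
move: E; rewrite U0 V1 !mulr0 !subr0 sub0r mulrN => /eqP.
rewrite -addrA addr_eq0 => /eqP E.
transitivity ((a1 * G + a2 * H) * ((v1 * G0 + v2 * H0) * (u1 * G1 + u2 * H1))); first ring.
by rewrite E; ring.
Qed.

End Weierstrass.

(** * The transformation for generic parameters *)

Section Generic.
Variables (R : realType) (p : R[i]).
Hypothesis hp : `|p| < 1.
Variables (q : R[i]) (n : nat) (m : 'I_n -> nat) (z : 'I_n -> R[i]).
Hypothesis q0 : q != 0.
Hypothesis z0 : forall k, z k != 0.

Lemma ellpochs2 a b k : ellpochs p q [:: a; b] k = ellpoch p q a k * ellpoch p q b k.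
Proof. by rewrite /ellpochs !big_cons big_nil mulr1. Qed.

Lemma ellpochs4 a b c d k : ellpochs p q [:: a; b; c; d] k =
  ellpoch p q a k * ellpoch p q b k * ellpoch p q c k * ellpoch p q d k.
Proof. by rewrite /ellpochs !big_cons big_nil mulr1 !mulrA. Qed.

Lemma summand_box_term a b c d e f (y : box m) :
  summand p q z a [:: b; c; d; e] (a * q / f) f
    [:: a * q / b; a * q / c; a * q / d; a * q / e] y =
  box_term (theta p) q m z a b c d e f (fun j => y j).
Proof.
rewrite /summand /box_term /box_kern ellpochs4.
congr (_ * _ * _ * _).
- congr (_ * _ * _ * _ * _).
  + by apply: eq_bigr => j _; apply: eq_bigr => k _; rewrite ellpochs2.
  + apply: eq_bigr => j _; rewrite ellpochs2.
    by rewrite (expfzDr 1 (- (m j)%:Z) q0) expr1z -(exprnN q).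
- by apply: eq_bigr => k _; rewrite ellpochs4.
Qed.

Lemma corollary_generic a b c d e f lambda :
  a != 0 -> b != 0 -> c != 0 -> d != 0 -> e != 0 -> f != 0 ->
  a ^+ 3 * q ^+ 2 = b * c * d * e * f -> lambda = a ^+ 2 * q / (b * c * f) ->
  cell_separated (theta p) q z -> cell_coseparated (theta p) q z ->
  (forall i, theta p (q ^+ i.+1) != 0) ->
  axis_regular (theta p) q z a -> axis_regular (theta p) q z lambda ->
  cleared (theta p) q z a b -> cleared (theta p) q z a c ->
  cleared (theta p) q z a d -> cleared (theta p) q z a e ->
  cleared (theta p) q z lambda d -> cleared (theta p) q z lambda e ->
  cleared (theta p) q z a (b * c) ->
  (forall i, theta p (a * q ^+ i.+1 / f) != 0) ->
  (forall j k i l s, theta p (a ^+ 2 * q ^+ s * (z j * q ^+ i * (z k * q ^+ l)) / (b * c)) != 0) ->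
  (forall j k i l s, theta p (lambda * q ^+ s * (z j * q ^+ i * (z k * q ^+ l)) / a) != 0) ->
  \sum_(y : box m)
     summand p q z a [:: b; c; d; e] (a * q / f) f
       [:: a * q / b; a * q / c; a * q / d; a * q / e] y
  = (\prod_(k < n)
       (ellpochs p q [:: a * q * z k; z k / lambda;
                         lambda * q * z k / d; lambda * q * z k / e] (m k)
        / ellpochs p q [:: lambda * q * z k; z k / a;
                           a * q * z k / d; a * q * z k / e] (m k)))
    * \sum_(y : box m)
        summand p q z lambda [:: lambda * b / a; lambda * c / a; d; e]
          (a * q / f) (lambda * f / a)
          [:: a * q / b; a * q / c; lambda * q / d; lambda * q / e] y.
Proof.
move=> a0 b0 c0 d0 e0 f0 bal laE sep cosep tq ra rla tb tc td te tld tle tbc tf taa tla.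
have la0 : lambda != 0 by rewrite laE !mulf_neq0 ?invr_eq0 ?mulf_neq0 ?expf_neq0.
have laE' : lambda * (b * c * f) = a ^+ 2 * q by rewrite laE divfK ?mulf_neq0.
under eq_bigr do rewrite summand_box_term.
have lab x : x != 0 -> a * q / x = lambda * q / (lambda * x / a).
  by move=> x0; field; rewrite a0 la0 x0.
under [X in _ = _ * X]eq_bigr do rewrite (lab b) // (lab c) // (lab f) // summand_box_term.
rewrite (box_transform (theta_1 hp) (theta_inv hp) m q0 z0 sep cosep tq
  (theta_weierstrass hp) a0 b0 c0 d0 e0 f0 la0) //.
congr (_ * _); apply: eq_bigr => k _.
by rewrite !ellpochs4.
Qed.
End Generic.

(** * Perturbation to generic parameters *)

Section MultiplicativeSpan.
Variables (R : realType) (I : finType) (g : I -> R[i]).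
Hypothesis g0 : forall i, g i != 0.

Definition mspan (u : R[i]) := exists e : {ffun I -> int}, u = \prod_i g i ^ e i.

Lemma mspan_neq0 u : mspan u -> u != 0.
Proof. by move=> [e ->]; apply/prodf_neq0 => i _; rewrite expfz_neq0. Qed.

Lemma mspan1 : mspan 1.
Proof. by exists [ffun=> 0]; rewrite big1 // => i _; rewrite ffunE expr0z. Qed.

Lemma mspan_gen i : mspan (g i).
Proof.
exists [ffun j => if j == i then 1 else 0]; rewrite (bigD1 i) //= ffunE eqxx expr1z.
by rewrite big1 ?mulr1 // => j /negPf ji; rewrite ffunE ji expr0z.
Qed.

Lemma mspanM u v : mspan u -> mspan v -> mspan (u * v).
Proof.
move=> [e ->] [f ->]; exists [ffun i => e i + f i]; rewrite -big_split /=.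
by apply: eq_bigr => i _; rewrite ffunE (expfzDr (e i) (f i) (g0 i)).
Qed.

Lemma mspanV u : mspan u -> mspan u^-1.
Proof.
move=> [e ->]; exists [ffun i => - e i]; rewrite -prodfV.
by apply: eq_bigr => i _; rewrite ffunE invr_expz.
Qed.

Lemma mspanX u k : mspan u -> mspan (u ^+ k).
Proof. by move=> su; elim: k => [|k IH]; rewrite ?expr0 ?exprS; [exact: mspan1 | exact: mspanM]. Qed.

Lemma mspanXz u (k : int) : mspan u -> mspan (u ^ k).
Proof. by move=> su; case: k => k; [exact: mspanX | exact/mspanV/mspanX]. Qed.

(* The span is countable, hence its real roots do not fill an interval. *)
Lemma exists_generic_scale (eps : R) : 0 < eps -> exists2 s : R, 1 < s < 1 + eps &
  forall D : int, D != 0 -> ~ mspan (s%:C%C ^ D).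
Proof.
move=> eps0; apply: contrapT => none.
have bad (s : R) : exists De : int * {ffun I -> int}, 1 < s < 1 + eps ->
    De.1 != 0 /\ s%:C%C ^ De.1 = \prod_i g i ^ De.2 i.
  have [sI|sI] := boolP (1 < s < 1 + eps); last by exists (0, [ffun=> 0]).
  apply: contrapT => nDe; apply: none; exists s => // D D0 [e sD].
  by apply: nDe; exists (D, e).
have [phi Hphi] := choice bad.
have : countable `]1, 1 + eps[.
  apply/countable_injP; exists (fun s => pickle (phi s)) => s s' sI sI' /(pcan_inj pickleK) E.
  have {}sI : 1 < s < 1 + eps by move: (set_mem sI); rewrite /= in_itv.
  have {}sI' : 1 < s' < 1 + eps by move: (set_mem sI'); rewrite /= in_itv.
  have [D0 sD] := Hphi s sI; have [_ sD'] := Hphi s' sI'.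
  have cabsR (x : R) : 0 <= x -> cabs x%:C%C = x.
    by move=> x0; rewrite /cabs normc_def /= expr0n /= addr0 sqrtr_sqr ger0_norm.
  have s0 : 0 <= s by lra. have s'0 : 0 <= s' by lra.
  have : s ^ (phi s).1 = s' ^ (phi s).1.
    by rewrite -{1}(cabsR s s0) -{1}(cabsR s' s'0) -!cabsXz sD E sD'.
  by move/(pexpIrz D0); apply; rewrite nnegrE.
move=> /countable_lebesgue_measure0; rewrite lebesgue_measure_itv /= lte_fin ltrDl eps0.
by rewrite -EFinD => -[]; lra.
Qed.
End MultiplicativeSpan.

(** * Continuity of the summands in all parameters *)

Section Continuity.
Variables (R : realType) (p : R[i]).
Hypothesis hp : `|p| < 1.

Lemma ellpoch_clim (qs us : nat -> R[i]) q u k : q != 0 -> u != 0 ->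
  clim qs q -> clim us u -> clim (fun N => ellpoch p (qs N) (us N) k) (ellpoch p q u k).
Proof.
move=> q0 u0 ql ul; apply: clim_prod => i _; apply: theta_continuous => //.
  by rewrite mulf_neq0 ?expf_neq0.
by apply: climM => //; apply: climX.
Qed.

(** Each entry of [L] pairs a sequence with its limit, so that the two parameter lists stay
    aligned. *)
Lemma ellpochs_clim (qs : nat -> R[i]) q (L : seq ((nat -> R[i]) * R[i])) k : q != 0 ->
  clim qs q -> (forall x, x \in [seq y.2 | y <- L] -> x != 0) ->
  List.Forall (fun x => clim x.1 x.2) L ->
  clim (fun N => ellpochs p (qs N) [seq x.1 N | x <- L] k) (ellpochs p q [seq x.2 | x <- L] k).
Proof.
move=> q0 ql L0 LL; rewrite /ellpochs big_map.
apply: (clim_ext (N := 0%N) (u := fun N => \prod_(x <- L) ellpoch p (qs N) (x.1 N) k)).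
  by move=> N _; rewrite big_map.
elim: L L0 LL => [|x L IH] L0 LL.
  by rewrite big_nil; apply: (clim_ext (N := 0%N)) (clim_cst 1) => N _; rewrite big_nil.
inversion LL; subst; rewrite big_cons.
have xl : clim (fun N => ellpoch p (qs N) (x.1 N) k) (ellpoch p q x.2 k).
  by apply: ellpoch_clim => //; apply: L0; rewrite /= mem_head.
have Ll := IH (fun y yL => L0 y (mem_behead (s := _ :: _) yL)) H2.
by apply: (clim_ext (N := 0%N)) (climM xl Ll) => N _; rewrite big_cons.
Qed.

Lemma ellDelta_clim n (zs : nat -> 'I_n -> R[i]) z : (forall k, z k != 0) ->
  (forall k, clim (zs^~ k) (z k)) -> clim (fun N => ellDelta p (zs N)) (ellDelta p z).
Proof.
move=> z0 zl; apply: clim_prod => j _; apply: clim_prod => k _; apply: climM => //.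
apply: theta_continuous => //; first by rewrite mulf_neq0 ?invr_eq0.
by apply: climM => //; apply: climV.
Qed.

Lemma summand_clim n (m : 'I_n -> nat) (qs as_ gs fs : nat -> R[i]) (zs : nat -> 'I_n -> R[i])
    (B V : seq ((nat -> R[i]) * R[i])) q a g f z (y : box m) :
  q != 0 -> a != 0 -> g != 0 -> f != 0 -> (forall k, z k != 0) ->
  (forall x, x \in [seq y.2 | y <- B] -> x != 0) ->
  (forall x, x \in [seq y.2 | y <- V] -> x != 0) ->
  clim qs q -> clim as_ a -> clim gs g -> clim fs f -> (forall k, clim (zs^~ k) (z k)) ->
  List.Forall (fun x => clim x.1 x.2) B -> List.Forall (fun x => clim x.1 x.2) V ->
  summand_welldef p q m z a g [seq x.2 | x <- V] ->
  clim (fun N => summand p (qs N) (zs N) (as_ N) [seq x.1 N | x <- B] (gs N) (fs N)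
                   [seq x.1 N | x <- V] y)
       (summand p q z a [seq x.2 | x <- B] g f [seq x.2 | x <- V] y).
Proof.
move=> q0 a0 g0 f0 z0 B0 V0 ql al gl fl zl Bl Vl [wD wT wy].
have [w1 w2 w3 w4 w5] := wy y.
have zql k : clim (fun N => zs N k * qs N ^+ y k) (z k * q ^+ y k) by apply: climM; [|apply: climX].
have zq0 k : z k * q ^+ y k != 0 by rewrite mulf_neq0 ?expf_neq0.
have azl k : clim (fun N => as_ N * zs N k) (a * z k) by apply: climM.
have az0 k : a * z k != 0 by rewrite mulf_neq0.
have zVl k : clim (fun N => (zs N k)^-1) (z k)^-1 by apply: climV.
have zV0 k : (z k)^-1 != 0 by rewrite invr_eq0.
have pair_clim k (u v : nat -> R[i]) (lu lv : R[i]) : lu != 0 -> lv != 0 -> clim u lu -> clim v lv ->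
    clim (fun N => ellpochs p (qs N) [:: u N; v N] k) (ellpochs p q [:: lu; lv] k).
  move=> u0 v0 ul vl; apply: (ellpochs_clim (L := [:: (u, lu); (v, lv)])) => //.
    by move=> x; rewrite !inE => /orP[] /eqP ->.
  by do 2! [apply: List.Forall_cons => //].
apply: climM; last exact: climX.
apply: climM; last first.
  apply: clim_prod => k _; apply: climM.
    by apply: ellpoch_clim; rewrite ?mulf_neq0 //; apply: climM.
  apply: climV; first exact: w5.
  have := @ellpochs_clim qs q [seq (fun N => x.1 N * zs N k, x.2 * z k) | x <- V] (y k) q0 ql.
  rewrite -map_comp -map_comp => H.
  apply: (clim_ext (N := 0%N)) (H _ _) => [N _|x|].
  - by rewrite -!map_comp.
  - by rewrite /comp /= => /mapP[v vV ->]; rewrite mulf_neq0 // V0 //; apply/mapP; exists v.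
  - elim: (V) Vl => [|v V' IH] VV; first by apply: List.Forall_nil.
    inversion VV; subst; apply: List.Forall_cons; last exact: IH.
    exact: climM.
apply: climM; last first.
  apply: climM; first exact: ellpochs_clim.
  by apply: climV; [exact: w4 | exact: ellpoch_clim].
apply: climM; last first.
  apply: clim_prod => j _; apply: climM.
    apply: climM; apply: ellpoch_clim => //; rewrite ?mulf_neq0 //.
    by apply: climM => //; apply: climM.
  apply: climV; first exact: w3.
  apply: pair_clim.
  - by rewrite !mulf_neq0 ?expf_neq0.
  - by rewrite !mulf_neq0 ?expfz_neq0.
  - by apply: climM => //; apply: climM => //; apply: climX.
  - apply: climM => //; apply: climM => //.
    rewrite (expfzDr 1 (- (m j)%:Z) q0) expr1z -(exprnN q).
    have qV : clim (fun N => qs N / qs N ^+ m j) (q / q ^+ m j).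
      by apply: climM => //; apply: climV; [rewrite expf_neq0 | apply: climX].
    (* The integer power of [qs N] splits only where [qs N != 0], that is, once [qs N] is closer to
       [q] than 0 is. *)
    have [N0 qN0] := ql (cabs q) (etrans (cabs_gt0 q) q0).
    apply: (clim_ext (N := N0)) qV => N /qN0 qN.
    have qN' : qs N != 0.
      by apply: contraTneq qN => ->; rewrite sub0r cabsN ltxx.
    by rewrite (expfzDr 1 (- (m j)%:Z) qN') expr1z -(exprnN (qs N)).
apply: climM; last first.
  apply: clim_prod => j _; apply: clim_prod => k _; apply: climM.
    apply: pair_clim.
    - by rewrite !mulf_neq0 ?invr_eq0 ?expf_neq0.
    - by rewrite !mulf_neq0 ?expf_neq0.
    - apply: climM => //; apply: climM => //; apply: climV; first by rewrite expf_neq0.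
      exact: climX.
    - by apply: climM => //; apply: climM => //; apply: climX.
  apply: climV; first exact: w2.
  apply: ellpoch_clim => //; first by rewrite !mulf_neq0.
  by apply: climM => //; apply: climM.
apply: climM; last first.
  apply: clim_prod => j _; apply: clim_prod => k jk; apply: climM; first exact: clim_cst.
  apply: climV; first exact: w1.
  by apply: ellpoch_clim => //; [rewrite mulf_neq0 | apply: climM].
apply: climM; last first.
  apply: clim_prod => k _; apply: climM.
    apply: theta_continuous => //; first by rewrite !mulf_neq0 ?expf_neq0.
    by apply: climM => //; apply: climX.
  by apply: climV; [exact: wT | apply: theta_continuous].
apply: climM; first exact: ellDelta_clim.
by apply: climV; [exact: wD | apply: ellDelta_clim].
Qed.

End Continuity.

Lemma radix_neq w r1 r2 i l : (r1 < w)%N -> (r2 < w)%N -> (r1 != r2) || (i != l) ->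
  (r1 + w * i)%N != (r2 + w * l)%N.
Proof.
move=> r1w r2w; apply: contraTneq => E; have w0 : (0 < w)%N by apply: leq_ltn_trans r1w.
have := congr1 (modn^~ w) E; rewrite ![(_ + w * _)%N]addnC ![(w * _)%N]mulnC !modnMDl !modn_small //.
move=> rE; have := congr1 (divn^~ w) E.
rewrite ![(_ + w * _)%N]addnC ![(w * _)%N]mulnC !divnMDl // !divn_small // !addn0 => ->.
by rewrite rE !eqxx.
Qed.

Section Perturbation.
Variables (R : realType) (p q : R[i]) (n : nat) (m : 'I_n -> nat) (z : 'I_n -> R[i]).
Variables (a b c d e : R[i]).
Hypothesis hp : `|p| < 1.
Hypotheses (q0 : q != 0) (a0 : a != 0) (b0 : b != 0) (c0 : c != 0) (d0 : d != 0) (e0 : e != 0).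
Hypothesis z0 : forall k, z k != 0.

(** [p] is among the generators because the zeros of theta are powers of [p], with 1 in its place
    when it vanishes; [f] is expressed in the others by balancing. *)
Definition generator (x : 'I_n + 'I_7) : R[i] :=
  match x with
  | inl j => z j
  | inr k => nth 1 [:: if p == 0 then 1 else p; q; a; b; c; d; e] k
  end.

Lemma generator_neq0 x : generator x != 0.
Proof.
case: x => [j|[k k7]] //=; have p10 : (if p == 0 then 1 else p) != 0.
  by case: ifPn => // _; apply: oner_neq0.
by do 7! [case: k k7 => [|k] k7 //].
Qed.

Let span := mspan generator.

Variable S : R[i].
Hypothesis S0 : S != 0.
Hypothesis Sgen : forall D : int, D != 0 -> ~ span (S ^ D).

(** A zero would make the argument a power of [p], and hence put the nontrivial power [S^(A - B)]
    into the span. *)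
Lemma theta_generic u A B : span u -> A != B -> theta p (u * S ^+ A / S ^+ B) != 0.
Proof.
move=> su AB; apply/eqP => t0.
have u0 := mspan_neq0 generator_neq0 su.
have SAB : S ^+ A / S ^+ B = S ^ (A%:Z - B%:Z).
  by rewrite (expfzDr A%:Z (- B%:Z) S0) -(exprnN S) -exprnP.
have x0 : u * S ^+ A / S ^+ B != 0 by rewrite !mulf_neq0 ?invr_eq0 ?expf_neq0.
have [k xk] := theta_zero hp x0 t0.
have D0 : A%:Z - B%:Z != 0 by lia.
apply: (Sgen D0); rewrite -SAB.
have -> : S ^+ A / S ^+ B = p ^ k / u by rewrite -xk; field; rewrite u0 expf_neq0.
apply: mspanM; [exact: generator_neq0| |exact: mspanV].
have [p0|p0] := eqVneq p 0.
  have [k0|k0] := eqVneq k 0; first by rewrite k0 expr0z; apply: mspan1.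
  by move: x0; rewrite xk p0 exp0rz (negPf k0) eqxx.
have := mspanXz generator_neq0 k (mspan_gen generator (inr ord0)).
by rewrite /= (negPf p0).
Qed.

(* Weights of the perturbation: a gets M, q gets w = 3 M, and z_j gets j + 1,
   so that no monomial whose theta function occurs in a denominator is constant. *)
Let M := (2 * n + 1)%N.
Let w := (3 * M)%N.

Definition pq := q * S ^+ w.
Definition pa := a * S ^+ M.
Definition pz (k : 'I_n) := z k * S ^+ k.+1.
(** [f] absorbs the perturbation, so that balancing holds exactly at every scale. *)
Definition pf := pa ^+ 3 * pq ^+ 2 / (b * c * d * e).
Definition pla := pa ^+ 2 * pq / (b * c * pf).

Lemma weight1 (j : 'I_n) : (j.+1 < M)%N.
Proof. by rewrite /M; have := ltn_ord j; lia. Qed.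

Lemma weight2 (j k : 'I_n) : (j.+1 + k.+1 < M)%N.
Proof. by rewrite /M; have := ltn_ord j; have := ltn_ord k; lia. Qed.

Lemma weight0 : (0 < M)%N.
Proof. by rewrite /M addn1. Qed.

Lemma weight_lt al s : (al < 3)%N -> (s < M)%N -> (s + M * al < w)%N.
Proof. by rewrite /w; case: al => [|[|[|//]]] _; lia. Qed.

(** The weight [s + M al + w i] has digits contributed by the [z_j], by [a] and by [q]. At most two
    of the [z_j] occur, so [s < M], and [a] occurs at most squared, so [al < 3] and [w = 3 M]. Two
    weights are different as soon as one digit is. *)
Lemma theta_weight u al s i be r l x : (al < 3)%N -> (s < M)%N -> (be < 3)%N -> (r < M)%N ->
  [|| al != be, s != r | i != l] -> span u ->
  x = u * (S ^+ s * (S ^+ M) ^+ al * (S ^+ w) ^+ i)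
      / (S ^+ r * (S ^+ M) ^+ be * (S ^+ w) ^+ l) -> theta p x != 0.
Proof.
move=> al3 sM be3 rM ne su ->; rewrite -!exprM -!exprD.
apply: theta_generic => //; apply: radix_neq; rewrite ?weight_lt //.
move: ne; rewrite orbA orbC => /orP[->|ne]; first by rewrite orbT.
by apply/orP; left; apply: radix_neq => //; rewrite orbC.
Qed.

Let sz j : span (z j). Proof. exact: (mspan_gen generator (inl j)). Qed.
Let sq : span q. Proof. by have := mspan_gen generator (inr (inord 1)); rewrite /= inordK. Qed.
Let sa : span a. Proof. by have := mspan_gen generator (inr (inord 2)); rewrite /= inordK. Qed.
Let sb : span b. Proof. by have := mspan_gen generator (inr (inord 3)); rewrite /= inordK. Qed.
Let sc : span c. Proof. by have := mspan_gen generator (inr (inord 4)); rewrite /= inordK. Qed.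
Let sd : span d. Proof. by have := mspan_gen generator (inr (inord 5)); rewrite /= inordK. Qed.
Let se : span e. Proof. by have := mspan_gen generator (inr (inord 6)); rewrite /= inordK. Qed.
Let sM u v : span u -> span v -> span (u * v). Proof. exact: mspanM generator_neq0 _ _. Qed.
Let sV u : span u -> span u^-1. Proof. exact: mspanV. Qed.
Let sX u k : span u -> span (u ^+ k). Proof. exact: (mspanX generator_neq0). Qed.

Let Sk k : S ^+ k != 0. Proof. by rewrite expf_neq0. Qed.
Let pq0 : pq != 0. Proof. by rewrite mulf_neq0. Qed.
Let pa0 : pa != 0. Proof. by rewrite mulf_neq0. Qed.
Let pz0 k : pz k != 0. Proof. by rewrite mulf_neq0. Qed.
Let pf0 : pf != 0. Proof. by rewrite !mulf_neq0 ?invr_eq0 ?mulf_neq0 ?expf_neq0. Qed.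

(** Eliminates [f], showing that [la] has weight [-(M + w)]. *)
Lemma plaE : pla = d * e / (pa * pq).
Proof. by rewrite /pla /pf; field; rewrite pa0 pq0 b0 c0 d0 e0. Qed.

Lemma cleared_a x : x != 0 -> span x -> cleared (theta p) pq pz pa x.
Proof.
move=> x0 sx j i.
apply: (@theta_weight (a * q * (z j * q ^+ i) / x) 1 j.+1 i.+1 0 0 0); rewrite ?weight1 ?weight0 //.
  by do ![apply: sM | apply: sV | apply: sX].
by rewrite /pz /pq /pa !exprMn !expr0 expr1 [(S ^+ w) ^+ i.+1]exprS; field.
Qed.

(** Meant for [d] and [e] in either order: [la q / d = e / a] and [la q / e = d / a]. *)
Lemma cleared_la x y : span x -> (forall u, pla * pq * u / y = x * u / pa) ->
  cleared (theta p) pq pz pla y.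
Proof.
move=> sx xy j i; rewrite xy.
apply: (@theta_weight (x * (z j * q ^+ i) / a) 0 j.+1 i 1 0 0); rewrite ?weight1 ?weight0 //.
  by do ![apply: sM | apply: sV | apply: sX].
by rewrite /pz /pq /pa !exprMn !expr0 expr1; field; rewrite a0 expf_neq0.
Qed.

Lemma perturbed_identity :
  \sum_(y : box m)
     summand p pq pz pa [:: b; c; d; e] (pa * pq / pf) pf
       [:: pa * pq / b; pa * pq / c; pa * pq / d; pa * pq / e] y
  = (\prod_(k < n)
       (ellpochs p pq [:: pa * pq * pz k; pz k / pla;
                         pla * pq * pz k / d; pla * pq * pz k / e] (m k)
        / ellpochs p pq [:: pla * pq * pz k; pz k / pa;
                           pa * pq * pz k / d; pa * pq * pz k / e] (m k)))
    * \sum_(y : box m)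
        summand p pq pz pla [:: pla * b / pa; pla * c / pa; d; e]
          (pa * pq / pf) (pla * pf / pa)
          [:: pa * pq / b; pa * pq / c; pla * pq / d; pla * pq / e] y.
Proof.
have bal : pa ^+ 3 * pq ^+ 2 = b * c * d * e * pf.
  by rewrite /pf; field; rewrite b0 c0 d0 e0.
apply: corollary_generic => //.
- move=> j k i l jikl.
  apply: (@theta_weight (z j / z k * q ^+ i / q ^+ l) 0 j.+1 i 0 k.+1 l); rewrite ?weight1 //.
  + by move: jikl; rewrite xpair_eqE eqSS negb_and.
  + by do ![apply: sM | apply: sV | apply: sX].
  + by rewrite /pz /pq !exprMn !expr0; field; rewrite z0 !expf_neq0.
- move=> j k i l.
  apply: (@theta_weight (z j * z k * q ^+ i * q ^+ l) 0 (j.+1 + k.+1) (i + l) 0 0 0);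
    rewrite ?weight2 ?weight0 //.
  + by do ![apply: sM | apply: sV | apply: sX].
  + by rewrite /pz /pq !exprMn !exprD !expr0; field.
- move=> i.
  apply: (@theta_weight (q ^+ i.+1) 0 0 i.+1 0 0 0); rewrite ?weight0 //.
  + exact: sX.
  + by rewrite /pq !exprMn !expr0; field.
- split=> [j i|j i l].
    apply: (@theta_weight (a * z j * q ^+ i) 1 j.+1 i 0 0 0); rewrite ?weight1 ?weight0 //.
    + by do ![apply: sM | apply: sV | apply: sX].
    + by rewrite /pz /pq /pa !exprMn !expr0 expr1; field.
  apply: (@theta_weight (a * q ^+ i / (z j * q ^+ l)) 1 0 i 0 j.+1 l); rewrite ?weight1 ?weight0 //.
    by do ![apply: sM | apply: sV | apply: sX].
  by rewrite /pz /pq /pa !exprMn !expr0 expr1; field; rewrite z0 !expf_neq0.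
- split=> [j i|j i l].
    apply: (@theta_weight (d * e / (a * q) * z j * q ^+ i) 0 j.+1 i 1 0 1); rewrite ?weight1 ?weight0 //.
    + by do ![apply: sM | apply: sV | apply: sX].
    + by rewrite plaE /pz /pq /pa !exprMn !expr0 !expr1; field; rewrite a0 q0 !expf_neq0.
  apply: (@theta_weight (d * e / (a * q) * q ^+ i / (z j * q ^+ l)) 0 0 i 1 j.+1 l.+1); rewrite ?weight1 ?weight0 //.
    by do ![apply: sM | apply: sV | apply: sX].
  by rewrite plaE /pz /pq /pa !exprMn !expr0 expr1 [(S ^+ w) ^+ l.+1]exprS; field; rewrite a0 q0 z0 !expf_neq0.
- exact: cleared_a.
- exact: cleared_a.
- exact: cleared_a.
- exact: cleared_a.
- apply: (cleared_la (x := e)) => //; rewrite plaE.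
  by move=> u; field; rewrite d0 pa0 pq0.
- apply: (cleared_la (x := d)) => //; rewrite plaE.
  by move=> u; field; rewrite e0 pa0 pq0.
- by apply: cleared_a; rewrite ?mulf_neq0 //; apply: sM.
- move=> i.
  (* By balancing, [a q / f = b c d e / (a^2 q)]; the two powers of [a] in the denominator make the
     digits differ. *)
  apply: (@theta_weight (b * c * d * e / a ^+ 2 / q ^+ 2 * q ^+ i.+1) 0 0 i.+1 2 0 2); rewrite ?weight0 //.
    by do ![apply: sM | apply: sV | apply: sX].
  rewrite /pf /pq /pa !exprMn !expr0.
  by field; rewrite a0 q0 b0 c0 d0 e0 !expf_neq0.
- move=> j k i l s.
  apply: (@theta_weight (a ^+ 2 * q ^+ s * (z j * q ^+ i * (z k * q ^+ l)) / (b * c)) 2 (j.+1 + k.+1) (s + i + l) 0 0 0);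
    rewrite ?weight2 ?weight0 //.
    by do ![apply: sM | apply: sV | apply: sX].
  by rewrite /pz /pq /pa !exprMn !exprD !expr0; field; rewrite b0 c0.
- move=> j k i l s.
  apply: (@theta_weight (d * e / (a ^+ 2 * q) * q ^+ s * (z j * q ^+ i * (z k * q ^+ l))) 0 (j.+1 + k.+1) (s + i + l) 2 0 1);
    rewrite ?weight2 ?weight0 //.
    by do ![apply: sM | apply: sV | apply: sX].
  by rewrite plaE /pz /pq /pa !exprMn !exprD !expr0 expr1; field; rewrite S0 a0 q0 !expf_neq0.
Qed.
End Perturbation.

Lemma generic_scales (R : realType) (I : finType) (g : I -> R[i]) : (forall i, g i != 0) ->
  exists2 S : nat -> R[i], clim S 1 &
    forall N, S N != 0 /\ forall D : int, D != 0 -> ~ mspan g (S N ^ D).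
Proof.
move=> g0.
have ex N : exists s : R, 1 < s < 1 + N.+1%:R^-1 /\
    forall D : int, D != 0 -> ~ mspan g (s%:C%C ^ D).
  by have [|s sN sg] := exists_generic_scale g (eps := N.+1%:R^-1);
    [rewrite invr_gt0 | exists s].
have [s Hs] := choice ex; exists (fun N => (s N)%:C%C) => [eps eps0|N]; last first.
  have [sN sg] := Hs N; split=> //; rewrite (inj_eq (@complexI R)) gt_eqF //.
  by apply: lt_trans ltr01 _; case/andP: sN.
have [N hN] : exists N, eps^-1 < N%:R.
  by exists (Num.truncn eps^-1).+1; apply: truncnS_gt.
exists N => k Nk; have [/andP[s1 sk] _] := Hs k.
rewrite -(rmorphB (real_complex R) (s k) 1) /cabs normc_def /= expr0n /= addr0 sqrtr_sqr ger0_norm ?subr_ge0 ?(ltW s1) //.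
rewrite ltrBlDl; apply: lt_trans sk _; rewrite ltrD2l.
rewrite -[ltRHS]invrK ltf_pV2 ?posrE ?invr_gt0 //.
by apply: lt_le_trans hN _; rewrite ler_nat leqW.
Qed.

Theorem corollary8p5 (R : realType) (p q : R[i]) (n : nat) (m : 'I_n -> nat)
    (a b c d e f lambda : R[i]) (z : 'I_n -> R[i])
    (hp : `|p| < 1) (hq : q != 0) (hn : (1 <= n)%N)
    (ha : a != 0) (hb : b != 0) (hc : c != 0) (hd : d != 0) (he : e != 0)
    (hf : f != 0) (hz : forall k : 'I_n, z k != 0)
    (hbal : a ^+ 3 * q ^+ 2 = b * c * d * e * f)
    (hlambda : lambda = a ^+ 2 * q / (b * c * f))
    (hleft : summand_welldef p q m z a (a * q / f)
       [:: a * q / b; a * q / c; a * q / d; a * q / e])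
    (hright : summand_welldef p q m z lambda (a * q / f)
       [:: a * q / b; a * q / c; lambda * q / d; lambda * q / e])
    (hfactor : forall k : 'I_n,
       ellpochs p q [:: lambda * q * z k; z k / a;
                        a * q * z k / d; a * q * z k / e] (m k) != 0) :
  \sum_(y : box m)
     summand p q z a [:: b; c; d; e] (a * q / f) f
       [:: a * q / b; a * q / c; a * q / d; a * q / e] y
  = (\prod_(k < n)
       (ellpochs p q [:: a * q * z k; z k / lambda;
                         lambda * q * z k / d; lambda * q * z k / e] (m k)
        / ellpochs p q [:: lambda * q * z k; z k / a;
                           a * q * z k / d; a * q * z k / e] (m k)))
    * \sum_(y : box m)
        summand p q z lambda [:: lambda * b / a; lambda * c / a; d; e]
          (a * q / f) (lambda * f / a)
          [:: a * q / b; a * q / c; lambda * q / d; lambda * q / e] y.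
Proof.
have hl : lambda != 0 by rewrite hlambda !mulf_neq0 ?invr_eq0 ?mulf_neq0 ?expf_neq0.
have [S S1 Sg] := generic_scales (generator_neq0 p hq ha hb hc hd he hz).
have SX k : clim (fun N => S N ^+ k) 1 by rewrite -(expr1n _ k); apply: climX.
have ql : clim (fun N => pq q n (S N)) q by rewrite -[X in clim _ X]mulr1; apply: climM (clim_cst q) (SX _).
have al : clim (fun N => pa n a (S N)) a by rewrite -[X in clim _ X]mulr1; apply: climM (clim_cst a) (SX _).
have zl k : clim (fun N => pz z (S N) k) (z k) by rewrite -[X in clim _ X]mulr1; apply: climM (clim_cst _) (SX _).
(* The perturbed [f] is defined by balancing, so [hbal] identifies its limit. *)
have fl : clim (fun N => pf q n a b c d e (S N)) f.
  have -> : f = a ^+ 3 * q ^+ 2 / (b * c * d * e).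
    by rewrite hbal; field; rewrite hb hc hd he.
  by apply: climM; [apply: climM; apply: climX | apply: clim_cst].
have ll : clim (fun N => pla q n a b c d e (S N)) lambda.
  rewrite hlambda; apply: climM; first by apply: climM => //; apply: climX.
  apply: climV; first by rewrite !mulf_neq0.
  by apply: climM => //; apply: clim_cst.
have cM (u v : nat -> R[i]) (x y : R[i]) : clim u x -> clim v y -> clim (fun N => u N * v N) (x * y).
  exact: climM.
have cD (u v : nat -> R[i]) (x y : R[i]) : y != 0 -> clim u x -> clim v y ->
    clim (fun N => u N / v N) (x / y).
  by move=> y0 ux vy; apply: climM => //; apply: climV.
have cc (x : R[i]) : clim (fun=> x) x by apply: clim_cst.
set A := fun N => pa n a (S N) in al *; set Q := fun N => pq q n (S N) in ql *.
set F := fun N => pf q n a b c d e (S N) in fl *; set La := fun N => pla q n a b c d e (S N) in ll *.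
have listn0 (x1 x2 x3 x4 : R[i]) : x1 != 0 -> x2 != 0 -> x3 != 0 -> x4 != 0 ->
    forall x, x \in [:: x1; x2; x3; x4] -> x != 0.
  by move=> ? ? ? ? x; rewrite !inE => /or4P[] /eqP ->.
have listl (x1 x2 x3 x4 : (nat -> R[i]) * R[i]) : clim x1.1 x1.2 -> clim x2.1 x2.2 ->
    clim x3.1 x3.2 -> clim x4.1 x4.2 -> List.Forall (fun x => clim x.1 x.2) [:: x1; x2; x3; x4].
  by move=> ? ? ? ?; do 4! [apply: List.Forall_cons => //].
have L : clim (fun N => \sum_(y : box m)
     summand p (Q N) (pz z (S N)) (A N) [:: b; c; d; e] (A N * Q N / F N) (F N)
       [:: A N * Q N / b; A N * Q N / c; A N * Q N / d; A N * Q N / e] y)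
    (\sum_(y : box m)
     summand p q z a [:: b; c; d; e] (a * q / f) f
       [:: a * q / b; a * q / c; a * q / d; a * q / e] y).
  apply: clim_sum => y _.
  apply: (summand_clim (p := p) hp (B := [:: (fun=> b, b); (fun=> c, c); (fun=> d, d); (fun=> e, e)])
    (V := [:: (fun N => A N * Q N / b, a * q / b); (fun N => A N * Q N / c, a * q / c);
              (fun N => A N * Q N / d, a * q / d); (fun N => A N * Q N / e, a * q / e)])
    (qs := Q) (as_ := A) (gs := fun N => A N * Q N / F N) (fs := F) (zs := fun N => pz z (S N))) => //.
  - by rewrite !mulf_neq0 ?invr_eq0.
  - exact: listn0.
  - by apply: listn0; rewrite !mulf_neq0 ?invr_eq0.
  - by apply: (cD) => //; apply: (cM).
  - by apply: listl; apply: clim_cst.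
  - by apply: listl; apply: (cD) => //; apply: (cM).
(* By [perturbed_identity] the sequence in [L] is also the sequence of right-hand sides; its limit
   is computed with [hright] and [hfactor] keeping the denominators away from zero. *)
apply: (clim_unique L).
apply: (clim_ext (N := 0%N) (fun N _ => esym (perturbed_identity m hp hq ha hb hc hd he hz (Sg N).1 (Sg N).2))).
apply: climM; last first.
  apply: clim_sum => y _.
  apply: (summand_clim (p := p) hp (B := [:: (fun N => La N * b / A N, lambda * b / a);
       (fun N => La N * c / A N, lambda * c / a); (fun=> d, d); (fun=> e, e)])
    (V := [:: (fun N => A N * Q N / b, a * q / b); (fun N => A N * Q N / c, a * q / c);
              (fun N => La N * Q N / d, lambda * q / d); (fun N => La N * Q N / e, lambda * q / e)])
    (qs := Q) (as_ := La) (gs := fun N => A N * Q N / F N) (fs := fun N => La N * F N / A N)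
    (zs := fun N => pz z (S N))) => //.
  - by rewrite !mulf_neq0 ?invr_eq0.
  - by rewrite !mulf_neq0 ?invr_eq0.
  - by apply: listn0; rewrite ?mulf_neq0 ?invr_eq0.
  - by apply: listn0; rewrite !mulf_neq0 ?invr_eq0.
  - by apply: (cD) => //; apply: (cM).
  - by apply: (cD) => //; apply: (cM).
  - by apply: listl => /=; try exact: clim_cst; apply: (cD) => //; apply: (cM).
  - by apply: listl; apply: (cD) => //; apply: (cM).
apply: clim_prod => k _; apply: (cD); first exact: hfactor.
  apply: (ellpochs_clim (p := p) hp (L := [:: (fun N => A N * Q N * pz z (S N) k, a * q * z k);
    (fun N => pz z (S N) k / La N, z k / lambda); (fun N => La N * Q N * pz z (S N) k / d, lambda * q * z k / d);
    (fun N => La N * Q N * pz z (S N) k / e, lambda * q * z k / e)])) => //.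
  - by apply: listn0; rewrite !mulf_neq0 ?invr_eq0.
  - by apply: listl => /=; try apply: (cD) => //; try (apply: (cM) => //; apply: cM).
apply: (ellpochs_clim (p := p) hp (L := [:: (fun N => La N * Q N * pz z (S N) k, lambda * q * z k);
    (fun N => pz z (S N) k / A N, z k / a); (fun N => A N * Q N * pz z (S N) k / d, a * q * z k / d);
    (fun N => A N * Q N * pz z (S N) k / e, a * q * z k / e)])) => //.
- by apply: listn0; rewrite !mulf_neq0 ?invr_eq0.
- by apply: listl => /=; try apply: (cD) => //; try (apply: (cM) => //; apply: cM).
Qed.
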